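(* Let $(M,g)$ be a Riemannian manifold. A vector field $X$ on $M$ is a Killing vector field if and only if the following two assertions hold: (1) the divergence of $X$ with respect to the Levi-Civita connection vanishes; (2) for any open set $U\subset M$ and any function $f\in C^\infty(U)$ such that $X(f)=0$ on $U$, one has $[X,\nabla f]=0$ on $U$.
   Context: Manifolds, functions and vector fields are smooth. $\nabla f$ denotes the gradient vector field of $f$, given by $g(\nabla f,Y)=df(Y)$ for all vector fields $Y$. $X$ is Killing if $L_Xg=0$. $[\cdot,\cdot]$ is the Lie bracket of vector fields. *)

(* Defs.v *)
From HB Require Import structures.
From mathcomp Require Import all_boot all_order all_algebra.
From mathcomp Require Import all_classical all_reals all_analysis.

Set Implicit Arguments.
Unset Strict Implicit.
Unset Printing Implicit Defensive.
Import Order.TTheory GRing.Theory Num.Theory.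
Import numFieldNormedType.Exports.
Local Open Scope classical_set_scope.
Local Open Scope ring_scope.

Section Euclidean.
Context {R : realType} {n : nat}.

Definition partial (k : 'I_n) (F : 'rV[R]_n -> R) : 'rV[R]_n -> R :=
  'D_(delta_mx 0 k) F.

Definition iter_partial (s : seq 'I_n) (F : 'rV[R]_n -> R) : 'rV[R]_n -> R :=
  foldr partial F s.

(* C^oo on V, for V open: partial derivatives of all orders exist and are
   continuous at every point of V.  Values of F outside V are irrelevant. *)
Definition smooth_on (V : set 'rV[R]_n) (F : 'rV[R]_n -> R) : Prop :=
  forall (s : seq 'I_n) (x : 'rV[R]_n), V x ->
    {for x, continuous (iter_partial s F)} /\
    forall k, derivable (iter_partial s F) x (delta_mx 0 k).

End Euclidean.

(* A smooth n-manifold without boundary, given by a smooth atlas (not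
   necessarily maximal).  chart_at selects a chart around each point; it is
   used only to name tangent vectors, see vfield. *)
Record smoothManifold (R : realType) (n : nat) := SmoothManifold {
  points :> topologicalType;
  manifold_hausdorff : hausdorff_space points;
  manifold_second_countable : @second_countable points;
  chart : Type;
  dom : chart -> set points;
  coord : chart -> points -> 'rV[R]_n;
  param : chart -> 'rV[R]_n -> points;
  chart_at : points -> chart;
  dom_chart_at : forall p, dom (chart_at p) p;
  open_dom : forall i, open (dom i);
  open_coord : forall i, open (coord i @` dom i);
  coordK : forall i p, dom i p -> param i (coord i p) = p;
  coord_continuous : forall i p, dom i p -> {for p, continuous (coord i)};
  param_continuous : forall i p, dom i p ->
    {for coord i p, continuous (param i)};
  transition_smooth : forall i j k,
    smooth_on (coord i @` (dom i `&` dom j))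
              (fun x => coord j (param i x) 0 k)
}.

Section Manifold.
Context {R : realType} {n : nat} {M : smoothManifold R n}.
Implicit Types (U : set M) (f : M -> R) (p : M).

(* Functions and vector fields "on an open set U" are total functions whose
   values outside U are arbitrary; all operators below are local. *)

Definition smooth U f : Prop :=
  forall i : chart M, smooth_on (coord i @` (U `&` dom i)) (f \o param i).

Definition coordf (i : chart M) (k : 'I_n) : M -> R := fun q => coord i q 0 k.

(* The tangent space at p is identified with R^n by means of the coordinate
   basis of the chart chart_at p: the row v stands for
   \sum_k v 0 k * d/dx^k at p.  In the same basis differential f p is the
   covector df_p. *)
Definition vfield : Type := M -> 'rV[R]_n.

Definition differential f p : 'rV[R]_n :=
  \row_k partial k (f \o param (chart_at p)) (coord (chart_at p) p).

Definition pairing f p (v : 'rV[R]_n) : R :=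
  \sum_k v 0 k * differential f p 0 k.

(* The function X(f). *)
Definition vact (X : vfield) f : M -> R := fun p => pairing f p (X p).

(* X(x^k) is the k-th component of X in the chart with coordinates x^k. *)
Definition smooth_vfield U (X : vfield) : Prop :=
  forall (i : chart M) (k : 'I_n), smooth (U `&` dom i) (vact X (coordf i k)).

(* Components in chart_at p of the derivation f |-> X(Y(f)) - Y(X(f)). *)
Definition bracket (X Y : vfield) : vfield := fun p =>
  \row_k (vact X (vact Y (coordf (chart_at p) k)) p -
          vact Y (vact X (coordf (chart_at p) k)) p).

Definition mx_form (A : 'M[R]_n) (v w : 'rV[R]_n) : R :=
  (v *m A *m w^T) 0 0.

(* metric p is the Gram matrix of g_p in the basis of T_pM given by
   chart_at p. *)
Record riemannianMetric := RiemannianMetric {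
  metric : M -> 'M[R]_n;
  metric_sym : forall p v w, mx_form (metric p) v w = mx_form (metric p) w v;
  metric_posdef : forall p v, v != 0 -> 0 < mx_form (metric p) v v;
  metric_smooth : forall U (X Y : vfield), open U ->
    smooth_vfield U X -> smooth_vfield U Y ->
    smooth U (fun p => mx_form (metric p) (X p) (Y p))
}.

Definition inner (g : riemannianMetric) (X Y : vfield) : M -> R :=
  fun p => mx_form (metric g p) (X p) (Y p).

Definition gradient (g : riemannianMetric) f : vfield :=
  fun p => differential f p *m invmx (metric g p).

(* (L_X g)(Y, Z) *)
Definition lie_metric (g : riemannianMetric) (X Y Z : vfield) : M -> R :=
  fun p => vact X (inner g Y Z) p - inner g (bracket X Y) Z p
           - inner g Y (bracket X Z) p.

Definition killing (g : riemannianMetric) (X : vfield) : Prop :=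
  forall U (Y Z : vfield), open U -> smooth_vfield U Y -> smooth_vfield U Z ->
    forall p, U p -> lie_metric g X Y Z p = 0.

(* Affine connections; cov v X p is the covariant derivative at p of the field
   X along the tangent vector v at p. *)
Record connection := Connection {
  cov : 'rV[R]_n -> vfield -> vfield;
  cov_linear : forall U (X : vfield) p, open U -> U p -> smooth_vfield U X ->
    forall (a : R) v w, cov (a *: v + w) X p = a *: cov v X p + cov w X p;
  cov_add : forall U (X Y : vfield) p, open U -> U p ->
    smooth_vfield U X -> smooth_vfield U Y ->
    forall v, cov v (fun q => X q + Y q) p = cov v X p + cov v Y p;
  cov_leibniz : forall U f (X : vfield) p, open U -> U p ->
    smooth U f -> smooth_vfield U X ->
    forall v, cov v (fun q => f q *: X q) p =
              pairing f p v *: X p + f p *: cov v X p;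
  cov_local : forall U (X Y : vfield) p, open U -> U p ->
    smooth_vfield U X -> (forall q, U q -> X q = Y q) ->
    forall v, cov v X p = cov v Y p;
  cov_smooth : forall U (X Y : vfield), open U ->
    smooth_vfield U X -> smooth_vfield U Y ->
    smooth_vfield U (fun p => cov (X p) Y p)
}.

Definition torsion_free (D : connection) : Prop :=
  forall U (X Y : vfield) p, open U -> U p ->
    smooth_vfield U X -> smooth_vfield U Y ->
    cov D (X p) Y p - cov D (Y p) X p = bracket X Y p.

Definition metric_compatible (g : riemannianMetric) (D : connection) : Prop :=
  forall U (X Y Z : vfield) p, open U -> U p ->
    smooth_vfield U X -> smooth_vfield U Y -> smooth_vfield U Z ->
    vact X (inner g Y Z) p =
      inner g (fun q => cov D (X q) Y q) Z p +
      inner g Y (fun q => cov D (X q) Z q) p.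

Definition levi_civita (g : riemannianMetric) (D : connection) : Prop :=
  torsion_free D /\ metric_compatible g D.

(* Trace of the endomorphism v |-> D_v X of the tangent space at p. *)
Definition divergence (D : connection) (X : vfield) : M -> R :=
  fun p => \tr (lin1_mx (fun v => cov D v X p)).

Lemma metric_unit (g : riemannianMetric) p : metric g p \in unitmx.
Proof.
rewrite -row_free_unit -kermx_eq0; apply/rowV0P => v /sub_kermxP vg0.
apply/eqP; apply/negP => /negP v0; have := metric_posdef g p v0.
by rewrite /mx_form vg0 mul0mx mxE ltxx.
Qed.

(* gradient g f is the only field with g (gradient g f) Y = df Y. *)
Lemma gradientP (g : riemannianMetric) f p (w : 'rV[R]_n) :
  (forall v, mx_form (metric g p) w v = pairing f p v) <-> w = gradient g f p.
Proof.
have formE (u v : 'rV[R]_n) : (u *m v^T) 0 0 = \sum_k v 0 k * u 0 k.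
  by rewrite mxE; apply: eq_bigr => k _; rewrite !mxE mulrC.
split=> [H|-> v]; last first.
  by rewrite /mx_form /gradient mulmxKV ?metric_unit// formE.
suff wE : w *m metric g p = differential f p.
  by rewrite /gradient -wE mulmxK// metric_unit.
apply/rowP => k; have := H (delta_mx 0 k).
have pick (F : 'I_n -> R) : \sum_j (delta_mx 0 k : 'rV[R]_n) 0 j * F j = F k.
  rewrite (bigD1 k)//= mxE !eqxx mul1r big1 ?addr0// => j jk.
  by rewrite mxE (negbTE jk) andbF mul0r.
by rewrite /mx_form /pairing formE !pick.
Qed.

End Manifold.

Arguments vfield {R n} M.
Arguments riemannianMetric {R n} M.
Arguments connection {R n} M.

(* Main.v *)
Require Import Defs.
From mathcomp Require Import all_boot all_order all_algebra.
From mathcomp Require Import all_classical all_reals all_analysis.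
From mathcomp Require Import perm ring lra.

(** Let D be the Levi-Civita connection and S(v, w) = g(D_v X, w) + g(v, D_w X).
    Since D is torsion free and metric, S is the Lie derivative of g along X
    (lie_metric_killing_form), so X is Killing if and only if S = 0 at every point,
    and the trace of S with respect to g is 2 div X (symmetrized_trace). If f is
    smooth and X f = 0 near p, then S(grad f, w) = - g([X, grad f], w)
    (killing_form_gradient): this is the formula g(grad f, Z) = Z f together with
    [X, Z] f = X(Z f) - Z(X f), which rests on the symmetry of second partial
    derivatives.

    If X is Killing, both assertions follow from these formulas, the metric being
    nondegenerate. Conversely, assume them. At a point p where X does not vanish,
    every vector orthogonal to X p is the gradient at p of a local solution of
    X f = 0 (first_integral_with_differential). Hence S vanishes as soon as one
    argument is orthogonal to X p, S is a multiple of the square of the covector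
    g(X, -), and the multiple is zero because the trace is (symmetrized_eq0).
    By continuity S also vanishes at limits of such points, and it vanishes where
    X is zero in a neighbourhood (killing_form_everywhere).

    The analytic core is the existence of the first integrals
    (first_integrals). In a chart and after division by a nonzero component,
    X becomes a field V with V_i0 = 1, and a point x is moved by the flow of V to
    the hyperplane through p on which the coordinate i0 is constant; the
    coordinates of the endpoint are constant along V. With the time rescaled to
    [0, 1] the flow is the solution of an integral equation depending on x, which
    is a contraction near p because the time is small there. Its smoothness in x
    follows from that of solutions of linear equations: the derivatives of the flow
    solve the linear equation of variations, whose coefficients are as smooth as
    the flow itself (lin_smooth, flow_smooth). That the endpoint is constant along
    V is read off from the same linear equation, solved explicitly in the direction
    of V (flow_variation_along).

    For these arguments differentiability is uniform in the parameter s of the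
    flow: a family F x s is treated as a function of x with values in the bounded
    continuous functions of s, with Lipschitz bounds and quadratic remainders
    (smooth_fam). *)

Set Implicit Arguments.
Unset Strict Implicit.
Unset Printing Implicit Defensive.
Import Order.TTheory GRing.Theory Num.Theory.
Import numFieldNormedType.Exports.
Import Defs.
Local Open Scope classical_set_scope.
Local Open Scope ring_scope.

(** * Increments of smooth functions on balls *)

Section DerivativeEstimates.
Context {R : realType} {V W : normedModType R}.

Lemma is_derive_estimateP (f : V -> W) a v df :
  is_derive a v f df <->
  forall e : R, 0 < e ->
    \forall h \near (0 : R), `|f (a + h *: v) - f a - h *: df| <= e * `|h|.
Proof.
have quot (h : R) : h != 0 ->
    (`|df - h^-1 *: (f (h *: v + a) - f a)| =
     `|f (a + h *: v) - f a - h *: df| / `|h|).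
  move=> h0; rewrite -normfV mulrC -normrZ [in RHS]scalerBr scalerA mulVf//.
  by rewrite scale1r distrC (addrC a).
split=> [[dfa dfE] e e0|H].
  have : (fun h => h^-1 *: ((f \o shift a) (h *: v) - f a)) @ 0^' --> df.
    by rewrite -dfE; exact: dfa.
  move=> /cvgrPdist_le/(_ _ e0); rewrite near_withinE/=.
  apply: filter_app; near=> h => + /=; have [->|h0] := eqVneq h 0.
    by rewrite !scale0r addr0 !subrr !normr0 mulr0.
  by move=> /(_ isT)/=; rewrite quot// ler_pdivrMr ?normr_gt0.
have L : (fun h => h^-1 *: ((f \o shift a) (h *: v) - f a)) @ 0^' --> df.
  apply/cvgrPdist_le => e /H; rewrite near_withinE/=.
  apply: filter_app; near=> h => + h0 /=.
  by rewrite quot// ler_pdivrMr ?normr_gt0.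
apply: DeriveDef; first by apply/cvg_ex; exists df.
exact/cvg_lim.
Unshelve. all: by end_near. Qed.

Lemma is_derive_quadratic (f : V -> W) a v df (C : R) :
  (\forall h \near (0 : R), `|f (a + h *: v) - f a - h *: df| <= C * `|h| ^+ 2) ->
  is_derive a v f df.
Proof.
move=> H; apply/is_derive_estimateP => e e0.
have e'0 : 0 < e / (1 + `|C|) by rewrite divr_gt0// ltr_pwDl.
have := nbhs0_le e'0 : \forall h \near (0 : R), `|h| <= e / (1 + `|C|).
apply: filter_app; apply: filterS H => h.
move=> /le_trans + he; apply; rewrite expr2 mulrA ler_wpM2r//.
move: he; rewrite ler_pdivlMr ?ltr_pwDl// mulrDr mulr1 => he.
rewrite (le_trans _ he)// (@le_trans _ _ (`|h| * `|C|)) ?lerDr//.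
by rewrite mulrC ler_wpM2l// ler_norm.
Qed.

End DerivativeEstimates.

Lemma is_derive_line {R : realType} {V W : normedModType R} (f : V -> W) a v df (h t : R) :
  is_derive (a + (t * h) *: v) v f df ->
  is_derive t 1 (fun s : R => f (a + (s * h) *: v)) (h *: df).
Proof.
move=> /is_derive_estimateP H; apply/is_derive_estimateP => e e0.
have e'0 : 0 < e / (1 + `|h|) by rewrite divr_gt0// ltr_pwDl.
have kh0 : (fun k : R => k * h) @ (0 : R) --> (0 : R).
  by rewrite -[X in _ --> X](mul0r h); apply: cvgMr_tmp; exact: cvg_id.
have K0 := kh0 _ (H _ e'0); rewrite nbhs_simpl/= in K0.
near=> k.
have -> : f (a + ((t + k%:A) * h) *: v) - f (a + (t * h) *: v) - k *: (h *: df) =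
    f (a + (t * h) *: v + (k * h) *: v) - f (a + (t * h) *: v) - (k * h) *: df.
  by rewrite [k%:A]mulr1 -(addrA a) -scalerDl -mulrDl scalerA.
have K : `|f (a + (t * h) *: v + (k * h) *: v) - f (a + (t * h) *: v)
           - (k * h) *: df| <= e / (1 + `|h|) * `|k * h| by near: k; exact: K0.
rewrite (le_trans K)// normrM mulrA mulrAC ler_wpM2r// mulrAC ler_pdivrMr ?ltr_pwDl//.
by rewrite ler_wpM2l ?(ltW e0)// lerDr.
Unshelve. all: by end_near. Qed.



Lemma dist_continuous {R : realType} {V : normedModType R} (q : V) :
  continuous (fun x : V => `|x - q|).
Proof.
move=> x; apply: (@continuous_comp _ _ _ (fun x => x - q) Num.norm).
  by apply: continuousB; [exact: cvg_id|exact: cvg_cst].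
exact: norm_continuous.
Qed.

Section Increments.
Context {R : realType} {n : nat}.
Implicit Types (x y a b q v : 'rV[R]_n) (F : 'rV[R]_n -> R).

Definition basis_vec (k : 'I_n) : 'rV[R]_n := delta_mx 0 k.

Lemma rV_norm_le v r : 0 <= r -> (`|v| <= r) <-> forall k, `|v 0 k| <= r.
Proof.
move=> r0; rewrite {1}/Num.norm/= mx_normrE; split=> [/bigmax_leP[_ H] k|H].
  exact: (H (0, k)).
by apply/bigmax_leP; split=> //= -[i j] _ /=; rewrite (ord1 i).
Qed.

Lemma rV_norm_coord v k : `|v 0 k| <= `|v|.
Proof. exact: ((rV_norm_le v (normr_ge0 v)).1 (lexx _) k). Qed.

Lemma norm_basis_vec k : `|basis_vec k| = 1.
Proof.
apply/le_anti/andP; split.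
  apply/rV_norm_le => // j; rewrite mxE eqxx/=.
  by case: (j == k); rewrite ?normr1 ?normr0.
by rewrite (le_trans _ (rV_norm_coord _ k))// mxE !eqxx normr1.
Qed.

Lemma mvt_line F (c : 'rV[R]_n) k (h : R) :
  (forall t : R, 0 <= t <= 1 -> derivable F (c + (t * h) *: basis_vec k) (basis_vec k)) ->
  exists2 t : R, 0 <= t <= 1 &
    F (c + h *: basis_vec k) - F c = h * partial k F (c + (t * h) *: basis_vec k).
Proof.
move=> dF; pose f (s : R) := F (c + (s * h) *: basis_vec k).
have df (t : R) : 0 <= t <= 1 ->
    is_derive t 1 f (h * partial k F (c + (t * h) *: basis_vec k)).
  by move=> /dF /derivableP /is_derive_line.
have [t||t t01 ft] := @MVT_segment _ f
    (fun t : R => h * partial k F (c + (t * h) *: basis_vec k)) 0 1 ler01.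
- by rewrite in_itv/= => /andP[t0 t1]; apply: df; rewrite !ltW.
- apply: derivable_within_continuous => t; rewrite in_itv/= => t01.
  by have [] := df _ t01.
exists t; first by move: t01; rewrite in_itv.
by move: ft; rewrite /f mul1r mul0r scale0r addr0 subr0 mulr1.
Qed.

(** The segment from a to b is replaced by a path along the coordinate axes. For
    the maximum norm each point of this path is as close to a as b is, and stays
    in every ball containing a and b. *)
Lemma mvt_ball F q r a b :
  (forall x, `|x - q| <= r -> forall k, derivable F x (basis_vec k)) ->
  `|a - q| <= r -> `|b - q| <= r ->
  exists xi : 'I_n -> 'rV[R]_n,
    [/\ F b - F a = \sum_k (b 0 k - a 0 k) * partial k F (xi k),
        forall k, `|xi k - q| <= r & forall k, `|xi k - a| <= `|b - a|].
Proof.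
move=> dF aq bq; have r0 : 0 <= r := le_trans (normr_ge0 _) aq.
(* The first m coordinates of c m come from b, the others from a. *)
pose c (m : nat) : 'rV[R]_n := \row_j (if (j < m)%N then b 0 j else a 0 j).
have cS (k : 'I_n) : c k.+1 = c k + (b 0 k - a 0 k) *: basis_vec k.
  apply/rowP => j; rewrite !mxE eqxx/= ltnS; have [->|jk] := eqVneq j k.
    by rewrite leqnn ltnn mulr1 addrC subrK.
  by rewrite mulr0 addr0 ltn_neqAle jk.
have hull (k : 'I_n) (t : R) : 0 <= t <= 1 ->
    let x := c k + (t * (b 0 k - a 0 k)) *: basis_vec k in
    `|x - q| <= r /\ `|x - a| <= `|b - a|.
  move=> /andP[t0 t1] x.
  have xj j : exists2 s : R, 0 <= s <= 1 & x 0 j = a 0 j + s * (b 0 j - a 0 j).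
    rewrite !mxE eqxx/=; have [->|jk] := eqVneq j k.
      by exists t; rewrite ?t0 ?t1// ltnn mulr1.
    case: ifP => _; [exists 1|exists 0]; rewrite ?lexx ?ler01//.
      by rewrite mulr0 addr0 mul1r addrC subrK.
    by rewrite mulr0 mul0r.
  clearbody x; split; apply/rV_norm_le => // j; have [s /andP[s0 s1] xE] := xj j.
    rewrite !mxE.
    have -> : x 0 j - q 0 j = (1 - s) * (a 0 j - q 0 j) + s * (b 0 j - q 0 j).
      by rewrite xE; ring.
    have A : `|a 0 j - q 0 j| <= r.
      by have := (rV_norm_le _ r0).1 aq j; rewrite !mxE.
    have B : `|b 0 j - q 0 j| <= r.
      by have := (rV_norm_le _ r0).1 bq j; rewrite !mxE.
    rewrite (le_trans (ler_normD _ _))// !normrM (ger0_norm s0).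
    rewrite ger0_norm ?subr_ge0//.
    have -> : r = (1 - s) * r + s * r by ring.
    by rewrite lerD// ler_wpM2l// subr_ge0.
  rewrite !mxE xE addrAC subrr add0r normrM (ger0_norm s0).
  rewrite (@le_trans _ _ `|b 0 j - a 0 j|)// ?ler_piMl//.
  by have := rV_norm_coord (b - a) j; rewrite !mxE.
have /choice[th thP] : forall k : 'I_n, exists t : R, 0 <= t <= 1 /\
    F (c k.+1) - F (c k) = (b 0 k - a 0 k) *
      partial k F (c k + (t * (b 0 k - a 0 k)) *: basis_vec k).
  move=> k; have [t t01|t t01 E] := @mvt_line F (c k) k (b 0 k - a 0 k).
    by apply: dF; have [] := hull k t t01.
  by exists t; rewrite cS.
exists (fun k : 'I_n => c k + (th k * (b 0 k - a 0 k)) *: basis_vec k); split.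
- rewrite (eq_bigr (fun k : 'I_n => F (c k.+1) - F (c k))); last first.
    by move=> k _; rewrite -(thP k).2.
  rewrite -(big_mkord xpredT (fun m => F (c m.+1) - F (c m))) telescope_sumr//.
  congr (F _ - F _); apply/rowP => j; rewrite !mxE ?ltn_ord//.
- by move=> k; have [] := hull k _ (thP k).1.
- by move=> k; have [] := hull k _ (thP k).1.
Qed.

Lemma smooth_on_partial (O : set 'rV[R]_n) F k :
  smooth_on O F -> smooth_on O (partial k F).
Proof.
move=> sF s x Ox; have := sF (rcons s k) x Ox.
by rewrite /iter_partial foldr_rcons.
Qed.

Lemma smooth_on_continuous (O : set 'rV[R]_n) F x :
  smooth_on O F -> O x -> {for x, continuous F}.
Proof. by move=> sF Ox; have [] := sF [::] x Ox. Qed.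

Lemma smooth_on_derivable (O : set 'rV[R]_n) F x k :
  smooth_on O F -> O x -> derivable F x (basis_vec k).
Proof. by move=> sF Ox; have [_] := sF [::] x Ox; exact. Qed.

Definition ball_in (O : set 'rV[R]_n) q (r : R) := forall x, `|x - q| <= r -> O x.

Lemma smooth_bounded O F q r : smooth_on O F -> ball_in O q r ->
  exists2 C, 0 <= C & forall x, `|x - q| <= r -> `|F x| <= C.
Proof.
move=> sF Or; have [r0|r0] := ltP r 0.
  exists 0 => // x xr; have := le_lt_trans xr r0.
  by rewrite ltNge normr_ge0.
have [] := @EVT_max_rV R n (fun x => `|F x|) [set x | `|x - q| <= r].
- by exists q; rewrite /= subrr normr0.
- apply: bounded_closed_compact.
    exists (r + `|q|); split; first exact: num_real.
    move=> M rM x /= xr; rewrite -(subrK q x) (le_trans (ler_normD _ _))//.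
    by rewrite (le_trans _ (ltW rM))// lerD2r.
  rewrite (_ : mkset _ = (fun x => `|x - q|) @^-1` [set y | y <= r])//.
  apply: preimage_closed; last exact: closed_le.
  by move=> x _; exact: dist_continuous.
- apply: continuous_in_subspaceT => x /set_mem /= xr.
  apply: (@continuous_comp _ _ _ F Num.norm); last exact: norm_continuous.
  by apply: (smooth_on_continuous sF); exact: Or.
move=> c _ H; exists `|F c| => // x xr; apply: H; exact/mem_set.
Qed.

Lemma smooth_lipschitz O F q r : smooth_on O F -> ball_in O q r ->
  exists2 C, 0 <= C & forall a b, `|a - q| <= r -> `|b - q| <= r ->
    `|F b - F a| <= C * `|b - a|.
Proof.
move=> sF Or.
have /choice[C CP] : forall k : 'I_n, exists C, 0 <= C /\
    forall x, `|x - q| <= r -> `|partial k F x| <= C.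
  move=> k; have [C C0 HC] := smooth_bounded (smooth_on_partial k sF) Or.
  by exists C.
exists (\sum_k C k); first by apply: sumr_ge0 => k _; exact: (CP k).1.
move=> a b aq bq; have [|xi [-> xiq _]] := @mvt_ball F q r a b _ aq bq.
  by move=> x xq k; exact: smooth_on_derivable sF (Or x xq).
rewrite (le_trans (ler_norm_sum _ _ _))// mulr_suml ler_sum// => k _.
rewrite normrM mulrC ler_pM//; first exact: (CP k).2.
by have := rV_norm_coord (b - a) k; rewrite !mxE.
Qed.

(** Bounds on the second partial derivatives over a compact ball give a quadratic
    remainder with one constant for all pairs of points of the ball; this
    uniformity is what later makes differentiation uniform in a parameter. *)
Lemma smooth_taylor1 O F q r : smooth_on O F -> ball_in O q r ->
  exists2 C, 0 <= C & forall a b, `|a - q| <= r -> `|b - q| <= r ->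
    `|F b - F a - \sum_k (b 0 k - a 0 k) * partial k F a| <= C * `|b - a| ^+ 2.
Proof.
move=> sF Or.
have /choice[C CP] : forall k : 'I_n, exists C, 0 <= C /\
    forall a b, `|a - q| <= r -> `|b - q| <= r ->
    `|partial k F b - partial k F a| <= C * `|b - a|.
  move=> k; have [C C0 HC] := smooth_lipschitz (smooth_on_partial k sF) Or.
  by exists C.
exists (\sum_k C k); first by apply: sumr_ge0 => k _; exact: (CP k).1.
move=> a b aq bq; have [|xi [-> xiq xia]] := @mvt_ball F q r a b _ aq bq.
  by move=> x xq k; exact: smooth_on_derivable sF (Or x xq).
rewrite -sumrB (le_trans (ler_norm_sum _ _ _))// mulr_suml ler_sum// => k _.
rewrite -mulrBr normrM expr2 mulrCA ler_pM//.
  by have := rV_norm_coord (b - a) k; rewrite !mxE.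
rewrite (le_trans ((CP k).2 _ _ aq (xiq k)))// ler_wpM2l//; exact: (CP k).1.
Qed.

End Increments.
(** * Symmetry of second partial derivatives *)

Lemma is_derive_translate {R : realType} {V W : normedModType R} (f : V -> W) a c v df :
  is_derive (a + c) v f df -> is_derive a v (fun y => f (y + c)) df.
Proof.
move=> /is_derive_estimateP H; apply/is_derive_estimateP => e /H.
by apply: filterS => h; rewrite (addrAC a).
Qed.

Lemma open_ball_in {R : realType} {n : nat} (O : set 'rV[R]_n) x :
  open O -> O x -> exists2 r, 0 < r & ball_in O x r.
Proof.
move=> oO Ox; have /nbhs_ballP[r /= r0 rO] : nbhs x O by exact: open_nbhs_nbhs.
exists (r / 2); first by rewrite divr_gt0.
move=> y yx; apply: rO; rewrite -ball_normE/= distrC (le_lt_trans yx)//.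
by rewrite ltr_pdivrMr// ltr_pMr// ltr1n.
Qed.

Section Clairaut.
Context {R : realType} {n : nat}.
Implicit Types (x : 'rV[R]_n) (F : 'rV[R]_n -> R).

(** The difference of the increments of F is an increment, along the i-th axis,
    of the increment of F along the j-th axis: the mean value theorem applies
    twice. *)
Lemma second_difference (O : set 'rV[R]_n) F x (h : R) i j :
  smooth_on O F -> ball_in O x (`|h| + `|h|) ->
  exists2 xi, `|xi - x| <= `|h| + `|h| &
    F (x + h *: basis_vec i + h *: basis_vec j) - F (x + h *: basis_vec i)
    - (F (x + h *: basis_vec j) - F x) = h * (h * partial j (partial i F) xi).
Proof.
move=> sF xO.
have near2 (s t : R) : 0 <= s <= 1 -> 0 <= t <= 1 ->
    `|x + (s * h) *: basis_vec i + (t * h) *: basis_vec j - x| <= `|h| + `|h|.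
  move=> /andP[s0 s1] /andP[t0 t1].
  rewrite -(addrA x) (addrC _ (- x)) addKr (le_trans (ler_normD _ _))//.
  rewrite !normrZ !norm_basis_vec !mulr1 (ger0_norm s0) (ger0_norm t0).
  by rewrite lerD// ler_piMl.
have le01 : 0 <= (1 : R) <= 1 by rewrite ler01 lexx.
have le00 : 0 <= (0 : R) <= 1 by rewrite ler01 lexx.
pose G y := F (y + h *: basis_vec j) - F y.
have dG (s : R) : 0 <= s <= 1 ->
    is_derive (x + (s * h) *: basis_vec i) (basis_vec i) G
     (partial i F (x + (s * h) *: basis_vec i + h *: basis_vec j)
      - partial i F (x + (s * h) *: basis_vec i)).
  move=> s01; apply: is_deriveB.
    apply: is_derive_translate; apply: derivableP.
    apply: (smooth_on_derivable sF); apply: xO.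
    by have := near2 s 1 s01 le01; rewrite mul1r.
  apply: derivableP; apply: (smooth_on_derivable sF); apply: xO.
  by have := near2 s 0 s01 le00; rewrite mul0r scale0r addr0.
have [s /dG[] //|s s01 GE] := @mvt_line _ _ G x i h.
have [t t01|t t01 FE] := @mvt_line _ _ (partial i F) (x + (s * h) *: basis_vec i) j h.
  apply: (smooth_on_derivable (smooth_on_partial i sF)); apply: xO.
  exact: near2.
exists (x + (s * h) *: basis_vec i + (t * h) *: basis_vec j); first exact: near2.
rewrite -FE; have [_ <-] := dG s s01; rewrite -GE /G.
by rewrite addrAC.
Qed.

Lemma partialC (O : set 'rV[R]_n) F x i j : open O -> O x -> smooth_on O F ->
  partial i (partial j F) x = partial j (partial i F) x.
Proof.
move=> oO Ox sF; have [r r0 rO] := open_ball_in oO Ox.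
have [C C0 HC] := smooth_lipschitz (smooth_on_partial i (smooth_on_partial j sF)) rO.
have [D D0 HD] := smooth_lipschitz (smooth_on_partial j (smooth_on_partial i sF)) rO.
apply/eqP; rewrite -subr_eq0 -normr_le0; apply/ler_addgt0Pr => e e0.
(* Both mixed derivatives vary by at most C or D times 2h around x, and h is
   small enough for the ball and for the error e. *)
rewrite add0r; pose h := Num.min (r / 2) (e / (2 * (1 + C + D))).
have h0 : 0 < h.
  by rewrite lt_min !divr_gt0// mulr_gt0// ltr_pwDl// ltr_pwDl.
have hr : `|h| + `|h| <= r.
  have : h <= r / 2 by rewrite ge_min lexx.
  by rewrite (gtr0_norm h0); lra.
have he : (C + D) * (`|h| + `|h|) <= e.
  have : h <= e / (2 * (1 + C + D)) by rewrite ge_min lexx orbT.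
  by rewrite (gtr0_norm h0) ler_pdivlMr ?mulr_gt0 ?ltr_pwDl ?ltr_pwDl//; nra.
have hO : ball_in O x (`|h| + `|h|) by move=> y /le_trans/(_ hr); exact: rO.
have [xi xix E1] := second_difference i j sF hO.
have [et etx E2] := second_difference j i sF hO.
have xx : `|x - x| <= r by rewrite subrr normr0 ltW.
have := HC _ _ xx (le_trans etx hr); have := HD _ _ xx (le_trans xix hr).
rewrite (addrAC x (h *: basis_vec j)) in E2.
have swap (a b c d : R) : a - b - (c - d) = a - c - (b - d) by ring.
have := etrans (esym E1) (etrans (swap _ _ _ _) E2).
move=> /(mulfI (lt0r_neq0 h0)) /(mulfI (lt0r_neq0 h0)) ->.
move: (partial i (partial j F) et) => u B A.
rewrite (le_trans (ler_distD u _ _))// (le_trans _ he)// mulrDl lerD//.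
  by rewrite distrC (le_trans A)// ler_wpM2l.
by rewrite (le_trans B)// ler_wpM2l.
Qed.

End Clairaut.

(** * Primitives of continuous functions *)

Section Primitive.
Context {R : realType}.
Implicit Types (f g : R -> R) (s t C : R).

(** The parameter of a family runs over the whole line, but only [0, 1] matters:
    primitives are frozen outside this interval, so that the bounds on them need
    no condition on the parameter. *)
Definition clamp s : R := Num.max 0 (Num.min s 1).

Lemma clamp_itv s : 0 <= clamp s <= 1.
Proof. by rewrite /clamp le_max lexx ge_max ler01 ge_min lexx orbT. Qed.

Lemma clamp_id s : 0 <= s <= 1 -> clamp s = s.
Proof. by move=> /andP[s0 s1]; rewrite /clamp min_l// max_r. Qed.

Lemma clamp_continuous : continuous clamp.
Proof.
move=> s; apply: (@continuous_max _ _ (cst 0) (fun s => Num.min s 1)).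
  exact: cvg_cst.
by apply: (@continuous_min _ _ id (cst 1)); [exact: cvg_id|exact: cvg_cst].
Qed.

Definition primitive f s : R :=
  Rintegral lebesgue_measure `[0, clamp s] f.

Lemma continuous_integrable f a b : continuous f ->
  lebesgue_measure.-integrable `[a, b] (EFin \o f).
Proof.
move=> cf; apply: continuous_compact_integrable; first exact: segment_compact.
exact: continuous_subspaceT.
Qed.

Lemma primitiveD f g s : continuous f -> continuous g ->
  primitive (fun t => f t + g t) s = primitive f s + primitive g s.
Proof.
move=> cf cg; rewrite /primitive RintegralD//; exact: continuous_integrable.
Qed.

Lemma primitiveZ a f s : continuous f ->
  primitive (fun t => a * f t) s = a * primitive f s.
Proof. by move=> cf; rewrite /primitive RintegralZl//; exact: continuous_integrable. Qed.

Lemma primitive_le f C s : continuous f -> (forall t, `|f t| <= C) ->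
  `|primitive f s| <= C.
Proof.
move=> cf fC; have /andP[c0 c1] := clamp_itv s.
have C0 : 0 <= C := le_trans (normr_ge0 _) (fC 0).
rewrite /primitive (le_trans (le_normr_Rintegral _ _))//.
  exact: continuous_integrable.
rewrite (@le_trans _ _ (Rintegral lebesgue_measure `[0, clamp s] (cst C)))//.
  apply: le_Rintegral => //.
  - apply: continuous_integrable => t.
    by apply: continuous_comp; [exact: cf|exact: norm_continuous].
  - by apply: continuous_integrable => t; exact: cvg_cst.
rewrite Rintegral_cst//= lebesgue_measure_itv/= lte_fin.
case: ifP => _; last by rewrite mulr0.
by rewrite -EFinB/= subr0 ler_piMr.
Qed.

Lemma primitive_derive f t : continuous f -> 0 < t < 1 ->
  is_derive t 1 (primitive f) (f t).
Proof.
move=> cf /andP[t0 t1].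
have [d1 d2] := continuous_FTC1_closed t1 (@continuous_integrable f 0 1 cf) t0 (cf t).
have D : is_derive t 1 (fun x => Rintegral lebesgue_measure `[0, x] f) (f t).
  by apply: (DeriveDef d1); rewrite -derive1E d2.
apply: near_eq_is_derive D; near=> x.
rewrite /primitive clamp_id//; apply/andP; split; apply: ltW.
  by near: x; exact: lt_nbhsr.
by near: x; exact: lt_nbhsl.
Unshelve. all: by end_near. Qed.

Lemma primitive_continuous f : continuous f -> continuous (primitive f).
Proof.
move=> cf s; have [c0 c1] := andP (clamp_itv s).
have /subspace_continuousP/(_ (clamp s)) :=
  parameterized_integral_continuous ler01 (@continuous_integrable f 0 1 cf).
rewrite /= in_itv/= clamp_itv => /(_ isT) Fs P /Fs FP.
have FQ := @clamp_continuous s _ FP; rewrite nbhs_simpl/= in FQ.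
change (nbhs s (primitive f @^-1` P)); apply: filterS FQ => t; apply.
by rewrite /= in_itv/= clamp_itv.
Qed.

Lemma primitive0 f : primitive f 0 = 0.
Proof. by rewrite /primitive clamp_id ?lexx ?ler01// set_itv1 Rintegral_set1. Qed.

(** Both sides are continuous on [0, 1] and have the same derivative inside. *)
Lemma primitive_eq f (phi : R -> R) s : continuous f -> continuous phi ->
  (forall t, 0 < t < 1 -> is_derive t 1 phi (f t)) ->
  primitive f s = phi (clamp s) - phi 0.
Proof.
move=> cf cphi dphi; have /andP[c0 c1] := clamp_itv s.
have clampK : clamp (clamp s) = clamp s by rewrite clamp_id ?c0.
have [||t _] := @MVT_segment _ (primitive f - phi) (fun=> 0) _ _ c0.
- move=> t; rewrite in_itv/= => /andP[t0 ts].
  have t01 : 0 < t < 1 by rewrite t0 (lt_le_trans ts).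
  rewrite -(subrr (f t)); apply: is_deriveB; [exact: primitive_derive|exact: dphi].
- apply: continuous_subspaceT => t; apply: continuousB; last exact: cphi.
  exact: primitive_continuous.
rewrite mul0r => /eqP; rewrite subr_eq0 => /eqP.
change (primitive f (clamp s) - phi (clamp s) = primitive f 0 - phi 0 ->
  primitive f s = phi (clamp s) - phi 0).
have -> : primitive f (clamp s) = primitive f s by rewrite /primitive clampK.
by rewrite primitive0; lra.
Qed.

End Primitive.

(** * Uniform error terms *)

Section UniformO.
Context {R : realType} {T S : Type} {F : set_system T} {FF : Filter F}.
Context {rho : T -> R}.
Context (rho_ge0 : forall t, 0 <= rho t).
Context (rho_le1 : \forall t \near F, rho t <= 1).
Implicit Types (E : T -> S -> R) (g : S -> R) (p q : nat).

Definition bounded_fam g := exists2 C, 0 <= C & forall s, `|g s| <= C.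

(** The O of Landau along the filter F, uniformly in s. In the applications rho is
    the distance to a base point or the size of an increment. *)
Definition uniformO p E := exists2 C, 0 <= C &
  \forall t \near F, forall s, `|E t s| <= C * rho t ^+ p.

Lemma uniformO_le p E E' : uniformO p E ->
  (\forall t \near F, forall s, `|E' t s| <= `|E t s|) -> uniformO p E'.
Proof.
move=> [C C0 EC] EE; exists C => //; move: EC EE; apply: filterS2 => t EC EE s.
exact: le_trans (EE s) (EC s).
Qed.

Lemma uniformO_eq p E E' : uniformO p E ->
  (\forall t \near F, forall s, E' t s = E t s) -> uniformO p E'.
Proof. by move=> /uniformO_le + EE; apply; move: EE; apply: filterS => t EE s; rewrite EE. Qed.

Lemma uniformO_norm p E : uniformO p E -> uniformO p (fun t s => `|E t s|).
Proof.
by move=> /uniformO_le; apply; near=> t => s; rewrite normr_id.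
Unshelve. all: by end_near. Qed.

Lemma uniformO_bounded g : bounded_fam g -> uniformO 0 (fun=> g).
Proof. by move=> [C C0 gC]; exists C => //; near=> t => s; rewrite mulr1.
Unshelve. all: by end_near. Qed.

Lemma uniformO0 p : uniformO p (fun _ _ => 0).
Proof. by exists 0 => //; near=> t => s; rewrite normr0 mul0r.
Unshelve. all: by end_near. Qed.

Lemma uniformOD p E E' : uniformO p E -> uniformO p E' ->
  uniformO p (fun t s => E t s + E' t s).
Proof.
move=> [C C0 EC] [D D0 ED]; exists (C + D); first exact: addr_ge0.
move: EC ED; apply: filterS2 => t EC ED s.
by rewrite (le_trans (ler_normD _ _))// mulrDl lerD.
Qed.

Lemma uniformOM p q E E' : uniformO p E -> uniformO q E' ->
  uniformO (p + q) (fun t s => E t s * E' t s).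
Proof.
move=> [C C0 EC] [D D0 ED]; exists (C * D); first exact: mulr_ge0.
move: EC ED; apply: filterS2 => t EC ED s.
by rewrite normrM exprD mulrACA ler_pM.
Qed.

Lemma uniformOM0 p E E' : uniformO p E -> uniformO 0 E' ->
  uniformO p (fun t s => E t s * E' t s).
Proof. by move=> pE E0; rewrite -[p]addn0; exact: uniformOM. Qed.

Lemma uniformO_sum p (I : Type) (r : seq I) (E : I -> T -> S -> R) :
  (forall j, uniformO p (E j)) -> uniformO p (fun t s => \sum_(j <- r) E j t s).
Proof.
move=> Ep; elim: r => [|j r IH].
  by apply: (uniformO_eq (uniformO0 p)); near=> t => s; rewrite big_nil.
apply: (uniformO_eq (uniformOD (Ep j) IH)); near=> t => s.
by rewrite big_cons.
Unshelve. all: by end_near. Qed.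

Lemma uniformO_weaken p q E : (q <= p)%N -> uniformO p E -> uniformO q E.
Proof.
move=> qp [C C0 EC]; exists C => //.
move: EC rho_le1; apply: filterS2 => t EC r1 s.
by rewrite (le_trans (EC s))// ler_wpM2l// ler_wiXn2l.
Qed.

End UniformO.

Section UniformOConsequences.
Context {R : realType} {T : Type} {F : set_system T} {FF : Filter F}.
Context {rho : T -> R}.

Lemma uniformO_row p q (S : Type) (E : 'I_q -> T -> S -> R) :
  (forall t, 0 <= rho t) ->
  (forall j, uniformO (F := F) (rho := rho) p (E j)) ->
  uniformO (F := F) (rho := rho) p (fun t s => `|\row_j E j t s|).
Proof.
move=> rho0 Ep; have S0 : uniformO (F := F) (rho := rho) p (fun t s => \sum_j `|E j t s|).
  by apply: uniformO_sum => j; exact: uniformO_norm.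
apply: (uniformO_le S0); near=> t => s.
rewrite normr_id; apply: (iffRL (rV_norm_le _ _)) => // k; rewrite mxE.
rewrite [leRHS]ger0_norm ?sumr_ge0// (bigD1 k)//= lerDl sumr_ge0//.
Unshelve. all: by end_near. Qed.

Lemma uniformO_primitive p (E : T -> R -> R) :
  uniformO (F := F) (rho := rho) p E -> (\forall t \near F, continuous (E t)) ->
  uniformO (F := F) (rho := rho) p (fun t => primitive (E t)).
Proof.
move=> [C C0 EC] Ec; exists C => //; move: EC Ec; apply: filterS2 => t EC Ec s.
exact: primitive_le.
Qed.

(** A bound that improves itself by halving is absorbed into its additive part;
    this replaces a Gronwall inequality. *)
Lemma sup_absorb (S : Type) (f : S -> R) (K : R) : bounded_fam f ->
  (forall D, (forall s, `|f s| <= D) -> forall s, `|f s| <= K + D / 2) ->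
  forall s, `|f s| <= 2 * K.
Proof.
move=> [D0 _ fD] H s; pose A := [set `|f s| | s in setT].
have supA : has_sup A.
  by split; [exists `|f s|, s|exists D0 => _ [t _ <-]; exact: fD].
have fA t : `|f t| <= sup A by apply: (ub_le_sup supA.2); exists t.
have : sup A <= K + sup A / 2.
  by apply: (ge_sup supA.1) => _ [t _ <-]; exact: H.
have := fA s; lra.
Qed.

End UniformOConsequences.

(** * Families of functions differentiable uniformly in a parameter *)

Section Families.
Context {R : realType} {n : nat}.
Local Notation family := ('rV[R]_n -> R -> R).
Implicit Types (F G : family) (x : 'rV[R]_n) (W : set 'rV[R]_n) (m : nat).

Lemma dist_ge0 x (y : 'rV[R]_n) : 0 <= `|y - x|. Proof. by []. Qed.

Lemma dist_le1 x : \forall y \near x, `|y - x| <= 1.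
Proof.
apply/nbhs_ballP; exists 1 => //= y.
by rewrite -ball_normE/= distrC => /ltW.
Qed.

Lemma norm_le1 : \forall h \near (0 : R), `|h| <= 1.
Proof. by apply: nbhs0_le. Qed.

Definition lipschitzO x (E : 'rV[R]_n -> R -> R) :=
  uniformO (F := nbhs x) (rho := fun y => `|y - x|) 1 E.
Definition incrementO p (E : R -> R -> R) :=
  uniformO (F := nbhs (0 : R)) (rho := fun h : R => `|h|) p E.

(** Locally Lipschitz dependence on x, in the supremum norm over the parameter. *)
Definition tame W F := forall x, W x ->
  [/\ continuous (F x), bounded_fam (F x) &
      lipschitzO x (fun y s => F y s - F x s)].

Definition partial_fam k F : family := fun x s => partial k (fun y => F y s) x.

(** The remainder is quadratic rather than o(h): smooth functions give no less,
    and estimates with explicit powers can be multiplied. *)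
Definition has_partial k F x (g : R -> R) :=
  incrementO 2 (fun h s => F (x + h *: basis_vec k) s - F x s - h * g s).

(** Families x |-> F x that are m times differentiable as maps into the bounded
    continuous functions of the parameter, with Lipschitz derivatives. *)
Fixpoint smooth_fam m W F : Prop :=
  tame W F /\
  if m is m'.+1 then forall k,
    (forall x, W x -> has_partial k F x (partial_fam k F x)) /\
    smooth_fam m' W (partial_fam k F)
  else True.

Lemma near_translate x v (P : set 'rV[R]_n) :
  (\forall y \near x, P y) -> \forall h \near (0 : R), P (x + h *: v).
Proof.
move=> xP; have : (fun h : R => x + h *: v) @ (0 : R) --> x.
  rewrite -[X in _ --> X]addr0 -(scale0r v).
  by apply: cvgD; [exact: cvg_cst|apply: cvgZr_tmp; exact: cvg_id].
by move=> /(_ _ xP).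
Qed.

Lemma has_partial_derive k F x g s : has_partial k F x g ->
  is_derive x (basis_vec k) (fun y => F y s) (g s).
Proof.
move=> [C C0 FC]; apply: (@is_derive_quadratic _ _ _ _ _ _ _ C).
by apply: filterS FC => h; exact.
Qed.

Lemma has_partialE k F x g : has_partial k F x g -> partial_fam k F x = g.
Proof.
by move=> Fg; apply/funext => s; have [_ <-] := has_partial_derive s Fg.
Qed.

Lemma smooth_fam_tame m W F : smooth_fam m W F -> tame W F.
Proof. by case: m => [|m] []. Qed.

Lemma smooth_famW m W F : smooth_fam m.+1 W F -> smooth_fam m W F.
Proof.
elim: m F => [|m IH] F [tF H]; split=> // k; have [dF sF] := H k.
by split=> //; exact: IH.
Qed.

Lemma tame_eq W F G : open W -> (forall x, W x -> F x = G x) ->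
  tame W F -> tame W G.
Proof.
move=> oW FG tF x Wx; have [cF bF lF] := tF x Wx; rewrite -(FG x Wx); split=> //.
apply: (uniformO_eq lF); near=> y => s; rewrite (FG y)//.
by near: y; exact: open_nbhs_nbhs.
Unshelve. all: by end_near. Qed.

Lemma partial_fam_eq W F G k x : open W -> (forall x, W x -> F x = G x) ->
  W x -> partial_fam k F x = partial_fam k G x.
Proof.
move=> oW FG Wx; apply/funext => s; apply: near_eq_derive; near=> y.
rewrite (FG y)//; near: y; exact: open_nbhs_nbhs.
Unshelve. all: by end_near. Qed.

Lemma has_partial_eq W F G k x g : open W -> (forall x, W x -> F x = G x) ->
  W x -> has_partial k F x g -> has_partial k G x g.
Proof.
move=> oW FG Wx dF; apply: (uniformO_eq dF).
have xW : \forall y \near x, W y by exact: open_nbhs_nbhs.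
by apply: filterS (near_translate (basis_vec k) xW) => h Wh s; rewrite !FG.
Qed.

Lemma smooth_fam_eq m W F G : open W -> (forall x, W x -> F x = G x) ->
  smooth_fam m W F -> smooth_fam m W G.
Proof.
move=> oW; elim: m F G => [|m IH] F G FG [tF H]; split=> //;
  try exact: (tame_eq oW FG).
move=> k; have [dF sF] := H k; have E x Wx := partial_fam_eq k oW FG (x := x) Wx.
split; last exact: IH E sF.
by move=> x Wx; rewrite -E//; apply: (has_partial_eq oW FG) => //; exact: dF.
Qed.

(** Derivatives are unique, so it suffices to exhibit them; their regularity may
    be checked on any family that agrees with them on the open set. *)
Lemma smooth_fam_intro m W F : open W -> tame W F ->
  (forall k, exists G, (forall x, W x -> has_partial k F x (G x)) /\
    smooth_fam m W G) ->
  smooth_fam m.+1 W F.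
Proof.
move=> oW tF H; split=> // k; have [G [dF sG]] := H k.
have E x : W x -> G x = partial_fam k F x by move=> /dF /has_partialE.
split; last exact: smooth_fam_eq E sG.
by move=> x Wx; rewrite -E//; exact: dF.
Qed.

Lemma smooth_fam_smooth_on W F s : (forall m, smooth_fam m W F) ->
  smooth_on W (fun x => F x s).
Proof.
move=> sF sq x Wx.
have E : iter_partial sq (fun x => F x s) = fun x => foldr partial_fam F sq x s.
  by elim: sq => [|k sq IH]//=; rewrite IH.
have {}sF : smooth_fam 1 W (foldr partial_fam F sq).
  have : forall m, smooth_fam m W (foldr partial_fam F sq); last exact.
  by elim: sq {E} => [|k sq IH]//= m; have [_ /(_ k)[]] := IH m.+1.
rewrite E; have [tF dF] := sF; split; last first.
  by move=> k; have [+ _] := dF k => /(_ x Wx)/(has_partial_derive s)[].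
have [_ _ [C C0 FC]] := tF x Wx.
apply/(@cvgrPdist_le _ _ _ (nbhs x) _) => e e0.
have ye : \forall y \near x, `|y - x| <= e / (1 + C).
  apply/nbhs_ballP; exists (e / (1 + C)); first by rewrite /= divr_gt0 ?ltr_pwDl.
  by move=> y; rewrite -ball_normE/= distrC => /ltW.
move: FC ye; apply: filterS2 => y /(_ s) FC ye; rewrite distrC (le_trans FC)//.
move: ye; rewrite ler_pdivlMr ?ltr_pwDl// mulrC => /(le_trans _); apply.
by rewrite expr1 ler_wpM2r// lerDr.
Qed.

End Families.

(** * Closure properties of smooth families *)

Section FamilyAlgebra.
Context {R : realType} {n : nat}.
Local Notation family := ('rV[R]_n -> R -> R).
Implicit Types (F G : family) (x : 'rV[R]_n) (W : set 'rV[R]_n) (m : nat).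

Lemma bounded_famD {S : Type} (f g : S -> R) : bounded_fam f -> bounded_fam g ->
  bounded_fam (fun s => f s + g s).
Proof.
move=> [C C0 fC] [D D0 gD]; exists (C + D); first exact: addr_ge0.
by move=> s; rewrite (le_trans (ler_normD _ _))// lerD.
Qed.

Lemma bounded_famM {S : Type} (f g : S -> R) : bounded_fam f -> bounded_fam g ->
  bounded_fam (fun s => f s * g s).
Proof.
move=> [C C0 fC] [D D0 gD]; exists (C * D); first exact: mulr_ge0.
by move=> s; rewrite normrM ler_pM.
Qed.

Lemma bounded_fam_primitive (f : R -> R) : continuous f -> bounded_fam f ->
  bounded_fam (primitive f).
Proof. by move=> cf [C C0 fC]; exists C => // s; exact: primitive_le. Qed.

Lemma continuousD_fam (f g : R -> R) : continuous f -> continuous g ->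
  continuous (fun s => f s + g s).
Proof. by move=> cf cg s; apply: continuousD; [exact: cf|exact: cg]. Qed.

Lemma continuousM_fam (f g : R -> R) : continuous f -> continuous g ->
  continuous (fun s => f s * g s).
Proof. by move=> cf cg s; apply: continuousM; [exact: cf|exact: cg]. Qed.

Lemma tame_near_bounded W F x : tame W F -> W x ->
  uniformO (F := nbhs x) (rho := fun y => `|y - x|) 0 F.
Proof.
move=> tF Wx; have [_ bF lF] := tF x Wx.
apply: (uniformO_eq (uniformOD (uniformO_bounded (F := nbhs x) bF)
  (uniformO_weaken _ _ (leq0n 1) lF))).
- by move=> y; exact: dist_ge0.
- exact: dist_le1.
by near=> y => s; rewrite addrC subrK.
Unshelve. all: by end_near. Qed.

Lemma tame_cst W (c : R) : tame W (fun _ _ => c).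
Proof.
move=> x Wx; split; first by move=> s; exact: cvg_cst.
  by exists `|c|.
by apply: (uniformO_eq (uniformO0 1)); near=> y => s; rewrite subrr.
Unshelve. all: by end_near. Qed.

Lemma tame_coord W j : tame W (fun x _ => x 0 j).
Proof.
move=> x Wx; split; first by move=> s; exact: cvg_cst.
  by exists `|x 0 j|.
exists 1 => //; near=> y => s; rewrite mul1r expr1.
by have := rV_norm_coord (y - x) j; rewrite !mxE.
Unshelve. all: by end_near. Qed.

Lemma tameD W F G : tame W F -> tame W G -> tame W (fun x s => F x s + G x s).
Proof.
move=> tF tG x Wx; have [cF bF lF] := tF x Wx; have [cG bG lG] := tG x Wx.
split; [exact: continuousD_fam|exact: bounded_famD|].
by apply: (uniformO_eq (uniformOD lF lG)); near=> y => s; ring.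
Unshelve. all: by end_near. Qed.

Lemma tameM W F G : tame W F -> tame W G -> tame W (fun x s => F x s * G x s).
Proof.
move=> tF tG x Wx; have [cF bF lF] := tF x Wx; have [cG bG lG] := tG x Wx.
split; [exact: continuousM_fam|exact: bounded_famM|].
have nF := tame_near_bounded tF Wx.
(* F y G y - F x G x = F y (G y - G x) + G x (F y - F x). *)
apply: (uniformO_eq (uniformOD (uniformOM nF lG)
  (uniformOM (uniformO_bounded (F := nbhs x) bG) lF))).
by near=> y => s; ring.
Unshelve. all: by end_near. Qed.

Lemma primitiveB (f g : R -> R) s : continuous f -> continuous g ->
  primitive (fun t => f t - g t) s = primitive f s - primitive g s.
Proof.
move=> cf cg; have cNg : continuous (fun t => -1 * g t).
  by apply: continuousM_fam => // t; exact: cvg_cst.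
under [in LHS]eq_fun do rewrite -mulN1r.
by rewrite primitiveD// primitiveZ// mulN1r.
Qed.

Lemma tame_near W x (F : family) : open W -> tame W F -> W x ->
  \forall y \near x, continuous (F y).
Proof.
move=> oW tF Wx; near=> y; have [//|cF _ _] := tF y _.
by near: y; exact: open_nbhs_nbhs.
Unshelve. all: by end_near. Qed.

Lemma tame_primitive W F : open W -> tame W F ->
  tame W (fun x => primitive (F x)).
Proof.
move=> oW tF x Wx; have [cF bF lF] := tF x Wx.
split; [exact: primitive_continuous|exact: bounded_fam_primitive|].
have nF := tame_near oW tF Wx.
have : lipschitzO x (fun y => primitive (fun s => F y s - F x s)).
  apply: uniformO_primitive => //; apply: filterS nF => y cy.
  apply: continuousD_fam => // s; apply: continuousN; exact: cF.
move=> /uniformO_eq; apply; apply: filterS nF => y cy s.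
by rewrite primitiveB.
Qed.

Lemma has_partialD k F G x f g : has_partial k F x f -> has_partial k G x g ->
  has_partial k (fun x s => F x s + G x s) x (fun s => f s + g s).
Proof.
move=> dF dG; apply: (uniformO_eq (uniformOD dF dG)).
by near=> h => s; ring.
Unshelve. all: by end_near. Qed.

Lemma has_partial_increment k F x f : bounded_fam f -> has_partial k F x f ->
  incrementO 1 (fun h s => F (x + h *: basis_vec k) s - F x s).
Proof.
move=> bf dF.
have O1 : incrementO 1 (fun h (_ : R) => h).
  by exists 1 => //; near=> h => s; rewrite mul1r.
apply: (uniformO_eq (uniformOD (uniformO_weaken _ _ (leqnSn 1) dF)
  (uniformOM O1 (uniformO_bounded bf)))).
- by move=> h; exact: normr_ge0.
- exact: norm_le1.
by near=> h => s; ring.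
Unshelve. all: by end_near. Qed.

Lemma has_partialM k F G x f g : bounded_fam (F x) -> bounded_fam (G x) ->
  bounded_fam f -> bounded_fam g ->
  has_partial k F x f -> has_partial k G x g ->
  has_partial k (fun x s => F x s * G x s) x (fun s => f s * G x s + F x s * g s).
Proof.
move=> bF bG bf bg dF dG.
have iF := has_partial_increment bf dF; have iG := has_partial_increment bg dG.
apply: (uniformO_eq (uniformOD (uniformOM iF iG)
  (uniformOD (uniformOM (uniformO_bounded bG) dF)
             (uniformOM (uniformO_bounded bF) dG)))).
by near=> h => s; ring.
Unshelve. all: by end_near. Qed.

(** Taking primitives is linear and does not increase the supremum norm, hence it
    commutes with differentiation in x. *)
Lemma has_partial_primitive W k F x g : open W -> tame W F -> W x ->
  continuous g -> has_partial k F x g ->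
  has_partial k (fun x => primitive (F x)) x (primitive g).
Proof.
move=> oW tF Wx cg dF; have [cF _ _] := tF x Wx.
have nF := near_translate (basis_vec k) (tame_near oW tF Wx).
have chg h : continuous (fun s => h * g s).
  by apply: continuousM_fam => // s; exact: cvg_cst.
have cB (f1 f2 : R -> R) : continuous f1 -> continuous f2 ->
    continuous (fun s => f1 s - f2 s).
  by move=> c1 c2; apply: continuousD_fam => // s; apply: continuousN; exact: c2.
have : incrementO 2 (fun h => primitive (fun s =>
    F (x + h *: basis_vec k) s - F x s - h * g s)).
  apply: uniformO_primitive => //; apply: filterS nF => h ch.
  by apply: (cB); first exact: cB.
move=> /uniformO_eq; apply; apply: filterS nF => h ch s.
by rewrite primitiveB ?primitiveB ?primitiveZ//; exact: cB.
Qed.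

Lemma smooth_fam_cst W m c : open W -> smooth_fam m W (fun _ _ => c).
Proof.
move=> oW; elim: m c => [|m IH] c; first by split=> //; exact: tame_cst.
apply: smooth_fam_intro => //; first exact: tame_cst.
move=> k; exists (fun _ _ => 0); split=> // x Wx.
by apply: (uniformO_eq (uniformO0 2)); near=> h => s /=; rewrite subrr mulr0 subr0.
Unshelve. all: by end_near. Qed.

Lemma smooth_fam_coord W m j : open W -> smooth_fam m W (fun x _ => x 0 j).
Proof.
move=> oW; case: m => [|m]; first by split=> //; exact: tame_coord.
apply: smooth_fam_intro => //; first exact: tame_coord.
move=> k; exists (fun _ _ => (j == k)%:R); split; last exact: smooth_fam_cst.
move=> x Wx; apply: (uniformO_eq (uniformO0 2)); near=> h => s.
by rewrite !mxE eqxx/=; ring.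
Unshelve. all: by end_near. Qed.

Lemma smooth_famD W m F G : open W -> smooth_fam m W F -> smooth_fam m W G ->
  smooth_fam m W (fun x s => F x s + G x s).
Proof.
move=> oW; elim: m F G => [|m IH] F G sF sG.
  by split=> //; apply: tameD; [exact: sF.1|exact: sG.1].
apply: smooth_fam_intro => //; first by apply: tameD; [exact: sF.1|exact: sG.1].
move=> k; have [dF sdF] := sF.2 k; have [dG sdG] := sG.2 k.
exists (fun x s => partial_fam k F x s + partial_fam k G x s); split.
  by move=> x Wx; apply: has_partialD; [exact: dF|exact: dG].
exact: IH.
Qed.

Lemma smooth_famM W m F G : open W -> smooth_fam m W F -> smooth_fam m W G ->
  smooth_fam m W (fun x s => F x s * G x s).
Proof.
move=> oW; elim: m F G => [|m IH] F G sF sG.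
  by split=> //; apply: tameM; [exact: sF.1|exact: sG.1].
have bnd m' H x : smooth_fam m' W H -> W x -> bounded_fam (H x).
  by move=> /smooth_fam_tame tH /tH [].
apply: smooth_fam_intro => //; first by apply: tameM; [exact: sF.1|exact: sG.1].
move=> k; have [dF sdF] := sF.2 k; have [dG sdG] := sG.2 k.
exists (fun x s => partial_fam k F x s * G x s + F x s * partial_fam k G x s).
split; last first.
  by apply: smooth_famD => //; apply: IH => //; exact: smooth_famW.
move=> x Wx; apply: has_partialM;
  by [exact: bnd sF Wx|exact: bnd sG Wx|exact: bnd sdF Wx|exact: bnd sdG Wx|
      exact: dF|exact: dG].
Qed.

Lemma smooth_fam_sum W m (I : Type) (r : seq I) (F : I -> family) : open W ->
  (forall j, smooth_fam m W (F j)) ->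
  smooth_fam m W (fun x s => \sum_(j <- r) F j x s).
Proof.
move=> oW sF; elim: r => [|j r IH].
  apply: (@smooth_fam_eq _ _ _ _ (fun _ _ => 0)) => //; last exact: smooth_fam_cst.
  by move=> x _; apply/funext => s; rewrite big_nil.
apply: (@smooth_fam_eq _ _ _ _ (fun x s => F j x s + \sum_(j <- r) F j x s)) => //.
  by move=> x _; apply/funext => s; rewrite big_cons.
exact: smooth_famD.
Qed.

Lemma smooth_fam_primitive W m F : open W -> smooth_fam m W F ->
  smooth_fam m W (fun x => primitive (F x)).
Proof.
move=> oW; elim: m F => [|m IH] F sF.
  by split=> //; exact: tame_primitive oW sF.1.
apply: smooth_fam_intro => //; first exact: tame_primitive oW sF.1.
move=> k; have [dF sdF] := sF.2 k.
exists (fun x => primitive (partial_fam k F x)); split; last exact: IH.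
move=> x Wx; apply: (has_partial_primitive oW sF.1 Wx); last exact: dF.
by have [] := smooth_fam_tame sdF Wx.
Qed.

(** The lower bound is uniform in the parameter: inverses must stay bounded in the
    supremum norm. *)
Lemma tameV W F : open W -> tame W F ->
  (forall x, W x -> exists2 c, 0 < c & forall s, c <= `|F x s|) ->
  tame W (fun x s => (F x s)^-1) /\
  forall x, W x -> uniformO (F := nbhs x) (rho := fun y => `|y - x|) 0
     (fun y s => (F y s)^-1).
Proof.
move=> oW tF F0.
have nb x : W x -> uniformO (F := nbhs x) (rho := fun y => `|y - x|) 0
     (fun y s => (F y s)^-1).
  move=> Wx; have [_ _ [C C0 lF]] := tF x Wx; have [c c0 Fc] := F0 x Wx.
  exists (c / 2)^-1; first by rewrite invr_ge0 divr_ge0// ltW.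
  have near0 : \forall y \near x, C * `|y - x| <= c / 2.
    apply/nbhs_ballP; exists (c / 2 / (1 + C)).
      by rewrite /= !divr_gt0// ltr_pwDl.
    move=> y; rewrite -ball_normE/= distrC ltr_pdivlMr ?ltr_pwDl// => /ltW.
    rewrite mulrC => /(le_trans _); apply.
    by rewrite ler_wpM2r// lerDr.
  move: lF near0; apply: filterS2 => y lF cy s; rewrite mulr1 normfV.
  have Fys : c / 2 <= `|F y s|.
    have := lF s; rewrite expr1 => /le_trans/(_ cy) A.
    have := ler_normD (F y s) (F x s - F y s).
    by rewrite addrC subrK distrC; have := Fc s; lra.
  have c20 : 0 < c / 2 by rewrite divr_gt0.
  by rewrite lef_pV2 ?posrE// (lt_le_trans c20).
split=> // x Wx; have [cF bF lF] := tF x Wx; have [c c0 Fc] := F0 x Wx.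
have Fn0 s : F x s != 0 by rewrite -normr_gt0 (lt_le_trans c0).
have bV : bounded_fam (fun s => (F x s)^-1).
  exists c^-1; first by rewrite invr_ge0 ltW.
  by move=> s; rewrite normfV lef_pV2 ?posrE// (lt_le_trans c0).
split=> //.
  by move=> s; apply: continuousV; [exact: Fn0|exact: cF].
have xW : \forall y \near x, W y by exact: open_nbhs_nbhs.
have := uniformOM (uniformOM (nb x Wx) (uniformO_bounded (F := nbhs x) bV)) lF.
move=> [D D0 HD]; exists D => //; move: HD xW; apply: filterS2 => y HD Wy s.
rewrite (le_trans _ (HD s))// -normrN.
have [d d0 Fd] := F0 y Wy.
have Fyn0 : F y s != 0 by rewrite -normr_gt0 (lt_le_trans d0).
suff -> : - ((F y s)^-1 - (F x s)^-1) =
    (F y s)^-1 * (F x s)^-1 * (F y s - F x s) by [].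
by have := Fn0 s; move: Fyn0; clear; move: (F y s) (F x s) => u v u0 v0; field; rewrite ?u0 ?v0.
Qed.

Lemma has_partialV W k F x g : open W -> tame W F ->
  (forall x, W x -> exists2 c, 0 < c & forall s, c <= `|F x s|) ->
  W x -> bounded_fam g -> has_partial k F x g ->
  has_partial k (fun x s => (F x s)^-1) x
    (fun s => -1 * (g s * ((F x s)^-1 * (F x s)^-1))).
Proof.
move=> oW tF F0 Wx bg dF; have [tV nbV] := tameV oW tF F0.
have [_ bV _] := tV x Wx; have iF := has_partial_increment bg dF.
have Vh : incrementO 0 (fun h s => (F (x + h *: basis_vec k) s)^-1).
  have [C C0 HC] := nbV x Wx; exists C => //.
  by apply: filterS (near_translate (basis_vec k) HC).
have O1 : incrementO 1 (fun h (_ : R) => h).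
  by exists 1 => //; near=> h => s; rewrite mul1r.
have bV0 : incrementO 0 (fun _ s => (F x s)^-1) by exact: uniformO_bounded.
have xW : \forall y \near x, W y by exact: open_nbhs_nbhs.
have bg0 : incrementO 0 (fun=> g) by exact: uniformO_bounded.
have A : incrementO 2 (fun h s => (F (x + h *: basis_vec k) s)^-1 * (F x s)^-1 *
    (F (x + h *: basis_vec k) s - F x s - h * g s)).
  exact: uniformOM (uniformOM Vh bV0) dF.
have B : incrementO 2 (fun h s => h * g s * ((F x s)^-1 * (F x s)^-1 *
    ((F (x + h *: basis_vec k) s)^-1 * (F (x + h *: basis_vec k) s - F x s)))).
  exact: uniformOM (uniformOM O1 bg0) (uniformOM (uniformOM bV0 bV0) (uniformOM Vh iF)).
have N1 : incrementO 0 (fun _ (_ : R) => -1).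
  by apply: uniformO_bounded; exists 1 => // s; rewrite normrN1.
have NA : incrementO 2 (fun h s => -1 * ((F (x + h *: basis_vec k) s)^-1 *
    (F x s)^-1 * (F (x + h *: basis_vec k) s - F x s - h * g s))).
  exact: uniformOM N1 A.
apply: (uniformO_eq (uniformOD NA B)).
apply: filterS (near_translate (basis_vec k) xW) => h Wh s.
have n0 y : W y -> F y s != 0.
  by move=> Wy; have [d d0 Fd] := F0 y Wy; rewrite -normr_gt0 (lt_le_trans d0).
have := n0 _ Wx; have := n0 _ Wh; clear.
by move: (F _ s) (F x s) (g s) => u v w u0 v0; field; rewrite ?u0 ?v0.
Unshelve. all: by end_near. Qed.

Lemma smooth_famV W m F : open W ->
  (forall x, W x -> exists2 c, 0 < c & forall s, c <= `|F x s|) ->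
  smooth_fam m W F -> smooth_fam m W (fun x s => (F x s)^-1).
Proof.
move=> oW F0; elim: m => [|m IH] sF.
  by split=> //; exact: (tameV oW sF.1 F0).1.
apply: smooth_fam_intro => //; first exact: (tameV oW sF.1 F0).1.
move=> k; have [dF sdF] := sF.2 k; have sV := IH (smooth_famW sF).
exists (fun x s => -1 * (partial_fam k F x s * ((F x s)^-1 * (F x s)^-1))); split.
  move=> x Wx; apply: (has_partialV oW sF.1 F0 Wx); last exact: dF.
  by have [] := smooth_fam_tame sdF Wx.
by do 3?[apply: smooth_famM => //]; exact: smooth_fam_cst.
Qed.

End FamilyAlgebra.

(** * Composition, and the algebra of smooth functions on open sets *)

Section Composition.
Context {R : realType} {n q : nat}.
Local Notation family := ('rV[R]_n -> R -> R).
Implicit Types (u : 'I_q -> family) (x : 'rV[R]_n) (W : set 'rV[R]_n).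
Implicit Types (O : set 'rV[R]_q) (V : 'rV[R]_q -> R).

Definition row_fam u x s : 'rV[R]_q := \row_j u j x s.

(** The values of the family near each point stay, uniformly in the parameter,
    in one closed ball inside the domain of the outer function: the estimates on
    increments are available on closed balls only. *)
Definition locally_in O W u := forall x, W x -> exists c r,
  ball_in O c r /\ \forall y \near x, forall s, `|row_fam u y s - c| <= r.

Lemma row_continuous (f : 'I_q -> R -> R) :
  (forall j, continuous (f j)) -> continuous (fun s => \row_j f j s : 'rV[R]_q).
Proof.
move=> cf s; apply/(@cvgrPdist_le _ _ _ (nbhs s)) => e e0.
have : \forall t \near s, forall j, `|f j s - f j t| <= e.
  apply: (@filter_forall _ _ _ (nbhs s)) => j.
  by have /cvgrPdist_le := cf j s; exact.
apply: filterS => t H; apply/(rV_norm_le _ (ltW e0)) => j.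
by rewrite !mxE.
Qed.

Lemma tame_comp W O u V : smooth_on O V -> locally_in O W u ->
  (forall j, tame W (u j)) -> tame W (fun x s => V (row_fam u x s)).
Proof.
move=> sV uO tu x Wx; have [c [r [cO near_c]]] := uO x Wx.
have xc := nbhs_singleton near_c; have xO s : O (row_fam u x s) by exact: cO.
split.
- move=> s; apply: (@continuous_comp _ _ _ (row_fam u x) V).
    by apply: row_continuous => j; have [] := tu j x Wx.
  exact: smooth_on_continuous sV (xO s).
- have [C C0 HC] := smooth_bounded sV cO.
  by exists C => // s; exact: HC.
have [C C0 HC] := smooth_lipschitz sV cO.
have lu : lipschitzO x (fun y s => `|\row_j (u j y s - u j x s) : 'rV[R]_q|).
  apply: uniformO_row; first by move=> y; exact: dist_ge0.
  by move=> j; have [] := tu j x Wx.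
have bC : uniformO (F := nbhs x) (rho := fun y => `|y - x|) 0 (fun _ (_ : R) => C).
  by apply: uniformO_bounded; exists `|C|.
apply: (uniformO_le (uniformOM bC lu)).
apply: filterS near_c => y yc s; rewrite (le_trans (HC _ _ (xc s) (yc s)))//.
rewrite ger0_norm ?mulr_ge0// ler_wpM2l// le_eqVlt; apply/orP; left; apply/eqP.
by congr (`| _ |); apply/rowP => j; rewrite !mxE.
Qed.

(** First-order Taylor expansion along a line: only a Lipschitz bound on the
    inner family is used, so that the estimate is available before the inner
    family is known to be differentiable. *)
Lemma increment_taylor W O u V k x :
  smooth_on O V -> locally_in O W u -> W x ->
  (forall j, incrementO 1 (fun h s => u j (x + h *: basis_vec k) s - u j x s)) ->
  incrementO 2 (fun h s => V (row_fam u (x + h *: basis_vec k) s) -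
    V (row_fam u x s) - \sum_j (u j (x + h *: basis_vec k) s - u j x s) *
      partial j V (row_fam u x s)).
Proof.
move=> sV uO Wx du; have [c [r [cO near_c]]] := uO x Wx.
have xc := nbhs_singleton near_c.
have near_h := near_translate (basis_vec k) near_c.
have [C C0 HC] := smooth_taylor1 sV cO.
have iu : incrementO 1 (fun h s =>
    `|\row_j (u j (x + h *: basis_vec k) s - u j x s) : 'rV[R]_q|).
  by apply: uniformO_row => // h; exact: normr_ge0.
have bC : incrementO 0 (fun _ (_ : R) => C).
  by apply: uniformO_bounded; exists `|C|.
have iu2 : incrementO 2 (fun h s => C * (
    `|\row_j (u j (x + h *: basis_vec k) s - u j x s) : 'rV[R]_q| *
    `|\row_j (u j (x + h *: basis_vec k) s - u j x s) : 'rV[R]_q|)).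
  exact: uniformOM bC (uniformOM iu iu).
apply: (uniformO_le iu2); apply: filterS near_h => h hc s.
have := HC _ _ (xc s) (hc s).
have -> : row_fam u (x + h *: basis_vec k) s - row_fam u x s =
    \row_j (u j (x + h *: basis_vec k) s - u j x s).
  by apply/rowP => j; rewrite !mxE.
rewrite expr2 => HV; rewrite [leRHS]ger0_norm ?mulr_ge0// (le_trans _ HV)//.
by under [in leRHS]eq_bigr do rewrite !mxE.
Qed.

Lemma has_partial_comp W O u V k x (w : 'I_q -> R -> R) :
  smooth_on O V -> locally_in O W u -> W x ->
  (forall j, bounded_fam (w j)) -> (forall j, has_partial k (u j) x (w j)) ->
  has_partial k (fun x s => V (row_fam u x s)) x
    (fun s => \sum_j w j s * partial j V (row_fam u x s)).
Proof.
move=> sV uO Wx bw dw; have [c [r [cO near_c]]] := uO x Wx.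
have xc := nbhs_singleton near_c.
have T1 := increment_taylor sV uO Wx
  (fun j => has_partial_increment (bw j) (dw j)).
have T2 : incrementO 2 (fun h s => \sum_j
    (u j (x + h *: basis_vec k) s - u j x s - h * w j s) *
    partial j V (row_fam u x s)).
  apply: uniformO_sum => j; apply: uniformOM0; first exact: dw.
  have [D D0 HD] := smooth_bounded (smooth_on_partial j sV) cO.
  by apply: uniformO_bounded; exists D => // s; exact: HD.
apply: (uniformO_eq (uniformOD T1 T2)); near=> h => s.
rewrite mulr_sumr -!addrA; congr (_ + (_ + _)).
rewrite -!sumrN -big_split/=; apply: eq_bigr => j _.
move: (partial j V _) (u j _ s) (u j _ s) (w j s) => a d e f; ring.
Unshelve. all: by end_near. Qed.

End Composition.

Section SmoothComposition.
Context {R : realType} {n q : nat}.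
Implicit Types (O : set 'rV[R]_q) (W : set 'rV[R]_n).

(** Induction on m for all outer functions at once: by the chain rule a derivative
    of the composite involves the composites of the first derivatives of V. *)
Lemma smooth_fam_comp W O (u : 'I_q -> 'rV[R]_n -> R -> R) V m :
  open W -> smooth_on O V -> locally_in O W u ->
  (forall j, smooth_fam m W (u j)) ->
  smooth_fam m W (fun x s => V (row_fam u x s)).
Proof.
move=> oW + uO; elim: m V => [|m IH] V sV su.
  by split=> //; apply: (tame_comp sV uO) => j; exact: (su j).1.
apply: smooth_fam_intro => //.
  by apply: (tame_comp sV uO) => j; exact: (su j).1.
move=> k; exists (fun x s => \sum_j partial_fam k (u j) x s *
  partial j V (row_fam u x s)); split.
  move=> x Wx; apply: (has_partial_comp sV uO Wx) => j.
    by have [_ /(_ k)[_ /smooth_fam_tame tu]] := su j; have [] := tu x Wx.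
  by have [_ /(_ k)[du _]] := su j; exact: du.
apply: smooth_fam_sum => // j; apply: smooth_famM => //.
  by have [_ /(_ k)[]] := su j.
apply: IH; first exact: smooth_on_partial.
by move=> i; apply: smooth_famW.
Qed.

Lemma smooth_on_tame W F : open W -> smooth_on W F -> tame W (fun x (_ : R) => F x).
Proof.
move=> oW sF x Wx; have [r r0 rW] := open_ball_in oW Wx.
split; first by move=> s; exact: cvg_cst.
  by exists `|F x|.
have [C C0 HC] := smooth_lipschitz sF rW; exists C => //.
apply/nbhs_ballP; exists r => //= y; rewrite -ball_normE/= distrC => /ltW yr _.
by rewrite expr1 HC// subrr normr0 ltW.
Qed.

Lemma smooth_on_has_partial W F k x : open W -> smooth_on W F -> W x ->
  has_partial k (fun x (_ : R) => F x) x (fun=> partial k F x).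
Proof.
move=> oW sF Wx; have [r r0 rW] := open_ball_in oW Wx.
have [C C0 HC] := smooth_taylor1 sF rW; exists C => //.
have : \forall y \near x, `|y - x| <= r.
  by apply/nbhs_ballP; exists r => //= y; rewrite -ball_normE/= distrC => /ltW.
move=> /(near_translate (basis_vec k)); apply: filterS => h hr _.
have xx : `|x - x| <= r by rewrite subrr normr0 ltW.
have := HC x _ xx hr.
rewrite [X in _ <= _ * `|X| ^+ 2]addrAC subrr add0r normrZ norm_basis_vec mulr1.
rewrite (bigD1 k)//= !mxE !eqxx/= mulr1 (addrC (x 0 k)) addrK big1 ?addr0//.
by move=> j jk; rewrite !mxE eqxx/= (negbTE jk) mulr0 addr0 subrr mul0r.
Qed.

Lemma smooth_on_smooth_fam m W F : open W -> smooth_on W F ->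
  smooth_fam m W (fun x (_ : R) => F x).
Proof.
move=> oW; elim: m F => [|m IH] F sF; first by split=> //; exact: smooth_on_tame.
apply: smooth_fam_intro => //; first exact: smooth_on_tame.
move=> k; exists (fun x (_ : R) => partial k F x); split.
  by move=> x Wx; exact: smooth_on_has_partial oW sF Wx.
exact/IH/smooth_on_partial.
Qed.

(** Smooth functions are the smooth families that do not depend on the parameter.
    Sums, products, inverses and composites of smooth functions are treated
    through this equivalence. *)
Lemma smooth_on_famP W F : open W ->
  smooth_on W F <-> forall m, smooth_fam m W (fun x (_ : R) => F x).
Proof.
move=> oW; split=> [sF m|sF]; first exact: smooth_on_smooth_fam.
exact: (smooth_fam_smooth_on 0 sF).
Qed.

Lemma smooth_on_locally_in W O (phi : 'I_q -> 'rV[R]_n -> R) :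
  open W -> open O -> (forall j, smooth_on W (phi j)) ->
  (forall x, W x -> O (\row_j phi j x)) ->
  locally_in O W (fun j x (_ : R) => phi j x).
Proof.
move=> oW oO sphi WO x Wx; have [r r0 rO] := open_ball_in oO (WO x Wx).
exists (\row_j phi j x), r; split=> //.
have : \forall y \near x, forall j, `|phi j x - phi j y| <= r.
  apply: (@filter_forall _ _ _ (nbhs x)) => j; have := smooth_on_continuous (sphi j) Wx.
  by move=> /(@cvgrPdist_le _ _ _ (nbhs x)); exact.
apply: filterS => y yr s; apply/(rV_norm_le _ (ltW r0)) => j.
by rewrite !mxE distrC.
Qed.

Lemma smooth_on_comp W O (phi : 'I_q -> 'rV[R]_n -> R) V :
  open W -> open O -> smooth_on O V -> (forall j, smooth_on W (phi j)) ->
  (forall x, W x -> O (\row_j phi j x)) ->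
  smooth_on W (fun x => V (\row_j phi j x)).
Proof.
move=> oW oO sV sphi WO; apply/(smooth_on_famP _ oW) => m.
apply: (smooth_fam_comp oW sV (smooth_on_locally_in oW oO sphi WO)) => j.
exact: smooth_on_smooth_fam.
Qed.

Lemma partial_comp W O (phi : 'I_q -> 'rV[R]_n -> R) V k x :
  open W -> open O -> smooth_on O V -> (forall j, smooth_on W (phi j)) ->
  (forall x, W x -> O (\row_j phi j x)) -> W x ->
  partial k (fun x => V (\row_j phi j x)) x =
  \sum_j partial k (phi j) x * partial j V (\row_j phi j x).
Proof.
move=> oW oO sV sphi WO Wx.
have bw j : bounded_fam (fun _ : R => partial k (phi j) x).
  by exists `|partial k (phi j) x|.
have := has_partial_comp sV (smooth_on_locally_in oW oO sphi WO) Wx bw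
  (fun j => smooth_on_has_partial k oW (sphi j) Wx).
by move=> /(has_partial_derive 0)[_].
Qed.

End SmoothComposition.

Section SmoothAlgebra.
Context {R : realType} {n : nat}.
Implicit Types (W : set 'rV[R]_n) (F G : 'rV[R]_n -> R).

Lemma smooth_on_eq W F G : open W -> (forall x, W x -> F x = G x) ->
  smooth_on W F -> smooth_on W G.
Proof.
move=> oW FG /(smooth_on_famP _ oW) sF; apply/(smooth_on_famP _ oW) => m.
apply: (smooth_fam_eq oW _ (sF m)) => x Wx.
by apply/funext => s; rewrite FG.
Qed.

Lemma smooth_on_sub W W' F : W' `<=` W -> smooth_on W F -> smooth_on W' F.
Proof. by move=> WW sF s x /WW; exact: sF. Qed.

Lemma smooth_on_local W F :
  (forall x, W x -> exists2 W', W' x & smooth_on W' F) -> smooth_on W F.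
Proof. by move=> H s x Wx; have [W' W'x sF] := H x Wx; exact: sF. Qed.

Lemma smooth_on_cst W c : open W -> smooth_on W (fun=> c).
Proof. by move=> oW; apply/(smooth_on_famP _ oW) => m; exact: smooth_fam_cst. Qed.

Lemma smooth_onD W F G : open W -> smooth_on W F -> smooth_on W G ->
  smooth_on W (fun x => F x + G x).
Proof.
move=> oW /(smooth_on_famP _ oW) sF /(smooth_on_famP _ oW) sG.
by apply/(smooth_on_famP _ oW) => m; exact: smooth_famD.
Qed.

Lemma smooth_onM W F G : open W -> smooth_on W F -> smooth_on W G ->
  smooth_on W (fun x => F x * G x).
Proof.
move=> oW /(smooth_on_famP _ oW) sF /(smooth_on_famP _ oW) sG.
by apply/(smooth_on_famP _ oW) => m; exact: smooth_famM.
Qed.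

Lemma smooth_onV W F : open W -> (forall x, W x -> F x != 0) ->
  smooth_on W F -> smooth_on W (fun x => (F x)^-1).
Proof.
move=> oW F0 /(smooth_on_famP _ oW) sF; apply/(smooth_on_famP _ oW) => m.
apply: smooth_famV => // x /F0 Fx0; exists `|F x| => //.
by rewrite normr_gt0.
Qed.

End SmoothAlgebra.

(** * Fixed points and linear integral equations *)

Section FixedPoint.
Context {R : realType} {T : Type}.
Implicit Types (y z : T -> R) (P : (T -> R) -> Prop).

Lemma halving_le (D e : R) : 0 < e -> exists k, D / 2 ^+ k <= e.
Proof.
move=> e0; exists (Num.bound (D / e)).
rewrite ler_pdivrMr ?exprn_gt0// mulrC -ler_pdivrMr//.
have [D0|D0] := ltP D 0.
  by rewrite (@le_trans _ _ 0)// ?exprn_ge0// ltW// pmulr_llt0// invr_gt0.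
rewrite (le_trans (ltW (archi_boundP _)))//; first by rewrite divr_ge0// ltW.
by rewrite -natrX ler_nat ltnW// ltn_expl.
Qed.

(** The limit of the iterates is taken as the supremum of the lower ends of the
    nested intervals given by the geometric error bound. *)
Lemma contraction_fixpoint P (Phi : (T -> R) -> T -> R) y0 (D : R) :
  P y0 -> (forall y, P y -> P (Phi y)) ->
  (forall y z C, P y -> P z -> (forall t, `|y t - z t| <= C) ->
     forall t, `|Phi y t - Phi z t| <= C / 2) ->
  0 <= D -> (forall t, `|Phi y0 t - y0 t| <= D) ->
  (forall y, (forall e, 0 < e -> exists2 z, P z & forall t, `|y t - z t| <= e) ->
     P y) ->
  exists2 y, P y & forall t, Phi y t = y t.
Proof.
move=> P0 PPhi Phi2 D0 y0D Plim.
pose Y k := iter k Phi y0.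
have PY k : P (Y k) by elim: k => //= k; exact: PPhi.
have dY k t : `|Y k.+1 t - Y k t| <= D / 2 ^+ k.
  elim: k t => [|k IH] t; first by rewrite expr0 divr1; exact: y0D.
  by rewrite exprSr invfM mulrA; apply: (Phi2 _ _ _ (PY k.+1) (PY k)).
pose r k : R := 2 * D / 2 ^+ k.
have rS k : r k.+1 = D / 2 ^+ k by rewrite /r exprS; field; rewrite expf_neq0.
have r2 k : r k = D / 2 ^+ k + D / 2 ^+ k by rewrite /r -mulrA mulr_natl mulr2n.
have r0 k : 0 <= r k by rewrite divr_ge0 ?mulr_ge0// exprn_ge0.
have lo t : {homo (fun k => Y k t - r k) : k m / (k <= m)%N >-> k <= m}.
  apply: homo_leq => // [a b c|k]; first exact: le_trans.
  by have := dY k t; rewrite ler_norml rS r2 => /andP[]; lra.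
have hi t : {homo (fun k => - (Y k t + r k)) : k m / (k <= m)%N >-> k <= m}.
  apply: homo_leq => // [a b c|k]; first exact: le_trans.
  by have := dY k t; rewrite ler_norml rS r2 => /andP[]; lra.
have lohi t k m : Y k t - r k <= Y m t + r m.
  have := lo t _ _ (leq_maxl k m); have := hi t _ _ (leq_maxr k m).
  by have := r0 (maxn k m); lra.
pose y t := sup [set Y k t - r k | k in setT].
have yY k t : `|y t - Y k t| <= r k.
  have ubA : has_sup [set Y k t - r k | k in setT].
    split; first by exists (Y 0 t - r 0), 0%N.
    by exists (Y 0 t + r 0) => _ [m _ <-]; exact: lohi.
  have A : Y k t - r k <= y t by apply: (ub_le_sup ubA.2); exists k.
  have B : y t <= Y k t + r k.
    by apply: (ge_sup ubA.1) => _ [m _ <-]; exact: lohi.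
  by rewrite ler_norml; apply/andP; split; lra.
have Py : P y.
  apply: Plim => e /(halving_le (2 * D))[k ke].
  by exists (Y k) => // t; exact: le_trans (yY k t) ke.
exists y => // t; apply/eqP; rewrite -subr_eq0 -normr_le0.
apply/ler_addgt0Pr => e /(halving_le (2 * D))[k ke]; rewrite add0r.
rewrite (le_trans _ ke)// -/(r k).
have := Phi2 _ _ _ Py (PY k) (yY k) t; have := yY k.+1 t; rewrite rS.
have := ler_distD (Phi (Y k) t) (Phi y t) (y t).
rewrite (distrC (y t)) /=; move: (r2 k); lra.
Qed.

End FixedPoint.

Section LinearEquation.
Context {R : realType} {q : nat}.
Implicit Types (a w z : 'I_q -> R -> R) (B : 'I_q -> 'I_q -> R -> R).

Definition lin_op B w i : R -> R :=
  primitive (fun t => \sum_l B i l t * w l t).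

(** The bound 1/2 makes lin_op B a contraction by the factor
    1/2 for the supremum norm. *)
Definition small B := forall i t, \sum_l `|B i l t| <= 1 / 2.

Lemma continuous_fam_sum (I : Type) (r : seq I) (f : I -> R -> R) :
  (forall l, continuous (f l)) -> continuous (fun t => \sum_(l <- r) f l t).
Proof.
move=> cf; elim: r => [|l r IH].
  by rewrite (_ : (fun t => _) = cst 0);
    [move=> t; exact: cvg_cst|apply/funext => t; rewrite big_nil].
rewrite (_ : (fun t => _) = fun t => f l t + \sum_(l <- r) f l t).
  exact: continuousD_fam.
by apply/funext => t; rewrite big_cons.
Qed.

Lemma primitive_sum (I : Type) (r : seq I) (f : I -> R -> R) s :
  (forall l, continuous (f l)) ->
  primitive (fun t => \sum_(l <- r) f l t) s = \sum_(l <- r) primitive (f l) s.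
Proof.
move=> cf; elim: r => [|l r IH].
  rewrite big_nil (_ : (fun t => _) = fun=> 0 * 0); last first.
    by apply/funext => t; rewrite big_nil mul0r.
  by rewrite (@primitiveZ _ 0 (fun=> 0)) ?mul0r// => t; exact: cvg_cst.
rewrite big_cons -IH -primitiveD//; last exact: continuous_fam_sum.
by congr (primitive _ s); apply/funext => t; rewrite big_cons.
Qed.

Lemma lin_continuous B w : (forall i l, continuous (B i l)) ->
  (forall l, continuous (w l)) ->
  forall i, continuous (fun t => \sum_l B i l t * w l t).
Proof.
by move=> cB cw i; apply: continuous_fam_sum => l; exact: continuousM_fam.
Qed.

Lemma lin_op_continuous B w : (forall i l, continuous (B i l)) ->
  (forall l, continuous (w l)) -> forall i, continuous (lin_op B w i).
Proof. by move=> cB cw i; apply: primitive_continuous; exact: lin_continuous. Qed.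

Lemma lin_op_le B w (D : R) : (forall i l, continuous (B i l)) -> small B ->
  (forall l, continuous (w l)) -> (forall l t, `|w l t| <= D) ->
  forall i s, `|lin_op B w i s| <= D / 2.
Proof.
move=> cB sB cw wD i s; apply: primitive_le; first exact: lin_continuous.
move=> t; have D0 : 0 <= D := le_trans (normr_ge0 _) (wD i t).
rewrite (le_trans (ler_norm_sum _ _ _))//.
rewrite (@le_trans _ _ (\sum_l `|B i l t| * D))//.
  by apply: ler_sum => l _; rewrite normrM ler_wpM2l.
by rewrite -mulr_suml mulrC ler_wpM2l// -[2^-1]mul1r; exact: sB.
Qed.

Lemma lin_opB B w z i s : (forall i l, continuous (B i l)) ->
  (forall l, continuous (w l)) -> (forall l, continuous (z l)) ->
  lin_op B w i s - lin_op B z i s = lin_op B (fun l t => w l t - z l t) i s.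
Proof.
move=> cB cw cz; rewrite /lin_op -primitiveB; last 2 first.
- exact: lin_continuous.
- exact: lin_continuous.
congr (primitive _ s); apply/funext => t; rewrite -sumrB.
by apply: eq_bigr => l _; rewrite mulrBr.
Qed.

Lemma continuousB_fam (f g : R -> R) : continuous f -> continuous g ->
  continuous (fun s => f s - g s).
Proof. by move=> cf cg s; apply: continuousB; [exact: cf|exact: cg]. Qed.

Lemma uniform_limit_continuous_fam (f : R -> R) :
  (forall e, 0 < e -> exists2 g : R -> R, continuous g &
    forall t, `|f t - g t| <= e) -> continuous f.
Proof.
move=> H s; apply/(@cvgrPdist_le _ _ _ (nbhs s)) => e e0.
have [g cg fg] := H (e / 3) (divr_gt0 e0 (ltr0Sn _ 2)).
have /(@cvgrPdist_le _ _ _ (nbhs s))/(_ _ (divr_gt0 e0 (ltr0Sn _ 2))) := cg s.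
apply: filterS => t gst; have A := fg s; have B := fg t.
have := ler_distD (g s) (f s) (f t); have := ler_distD (g t) (g s) (f t).
by rewrite (distrC (g t) (f t)); lra.
Qed.

Lemma lin_exists a B : (forall i, continuous (a i)) ->
  (forall i, bounded_fam (a i)) -> (forall i l, continuous (B i l)) -> small B ->
  exists w, [/\ forall i, continuous (w i), forall i, bounded_fam (w i) &
    forall i s, w i s = a i s + lin_op B w i s].
Proof.
move=> ca ba cB sB; have [A A0 aA] : exists2 A, 0 <= A & forall i s, `|a i s| <= A.
  have /choice[C HC] : forall i, exists C, 0 <= C /\ forall s, `|a i s| <= C.
    by move=> i; have [C C0 HC] := ba i; exists C.
  exists (\sum_i C i); first by apply: sumr_ge0 => i _; exact: (HC i).1.
  move=> i s; rewrite (le_trans ((HC i).2 s))// (bigD1 i)//= lerDl.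
  by apply: sumr_ge0 => j _; exact: (HC j).1.
pose P (y : 'I_q * R -> R) := (forall i, continuous (fun s => y (i, s))) /\
  bounded_fam y.
pose Phi (y : 'I_q * R -> R) (t : 'I_q * R) :=
  a t.1 t.2 + lin_op B (fun l s => y (l, s)) t.1 t.2.
have [||y z C [cy _] [cz _] yz [i s]||[i s]|y Hy|y [cy [C C0 yC]] yE] :=
    @contraction_fixpoint R _ P Phi (fun=> 0) A.
- by split; [move=> i s; exact: cvg_cst|exists 0 => // t; rewrite normr0].
- move=> y [cy [C C0 yC]]; split.
    move=> i; apply: (@continuousD_fam _ (a i)) => //.
    have cl := lin_op_continuous cB cy; exact: (cl i).
  exists (A + C / 2); first by rewrite addr_ge0// divr_ge0.
  move=> [i s]; rewrite (le_trans (ler_normD _ _))// lerD//.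
  by apply: lin_op_le => // l t; exact: yC.
- rewrite /Phi/= opprD addrACA subrr add0r lin_opB//.
  by apply: lin_op_le => // l; exact: continuousB_fam.
- by [].
- rewrite subr0 (le_trans (ler_normD _ _))// -[leRHS]addr0 lerD//.
  rewrite -[leRHS](mul0r 2^-1); apply: lin_op_le => // [l t|l t].
    exact: cvg_cst.
  by rewrite normr0.
- split.
    move=> i; apply: uniform_limit_continuous_fam => e /Hy[z [cz _] yz].
    by exists (fun s => z (i, s)).
  have [z [_ [C C0 zC]] yz] := Hy 1 ltr01; exists (1 + C); first exact: addr_ge0.
  by move=> t; rewrite -(subrK (z t) (y t)) (le_trans (ler_normD _ _))// lerD.
exists (fun i s => y (i, s)); split=> // [i|i s].
  by exists C => // s; exact: yC.
by rewrite -[LHS]yE.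
Qed.

(** The linear part contributes at most half of the supremum of w, which
    sup_absorb removes. *)
Lemma lin_bound B e w (K : R) : (forall i l, continuous (B i l)) -> small B ->
  (forall l, continuous (w l)) -> (forall l, bounded_fam (w l)) ->
  (forall i s, w i s = e i s + lin_op B w i s) ->
  (forall i s, `|e i s| <= K) -> forall i s, `|w i s| <= 2 * K.
Proof.
move=> cB sB cw bw wE eK i s.
apply: (@sup_absorb _ _ (fun t : 'I_q * R => w t.1 t.2) K _ _ (i, s)).
  have /choice[C HC] : forall i, exists C, 0 <= C /\ forall s, `|w i s| <= C.
    by move=> j; have [C C0 HC] := bw j; exists C.
  exists (\sum_i C i); first by apply: sumr_ge0 => j _; exact: (HC j).1.
  move=> [j t] /=; rewrite (le_trans ((HC j).2 t))// (bigD1 j)//= lerDl.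
  by apply: sumr_ge0 => l _; exact: (HC l).1.
move=> D wD [j t] /=; rewrite wE (le_trans (ler_normD _ _))// lerD//.
by apply: lin_op_le => // l t'; exact: (wD (l, t')).
Qed.

Lemma lin_unique B a w z : (forall i l, continuous (B i l)) -> small B ->
  (forall l, continuous (w l)) -> (forall l, bounded_fam (w l)) ->
  (forall l, continuous (z l)) -> (forall l, bounded_fam (z l)) ->
  (forall i s, w i s = a i s + lin_op B w i s) ->
  (forall i s, z i s = a i s + lin_op B z i s) ->
  forall i s, w i s = z i s.
Proof.
move=> cB sB cw bw cz bz wE zE i s; apply/eqP; rewrite -subr_eq0 -normr_le0.
rewrite -[leRHS](mulr0 2).
apply: (@lin_bound B (fun _ _ => 0) (fun l t => w l t - z l t) 0) => //.
- by move=> l; exact: continuousB_fam.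
- move=> l; have [C C0 wC] := bw l; have [D D0 zD] := bz l.
  exists (C + D); first exact: addr_ge0.
  by move=> t; rewrite (le_trans (ler_normB _ _))// lerD.
- by move=> j t; rewrite add0r -lin_opB// wE zE opprD addrACA subrr add0r.
- by move=> *; rewrite normr0.
Qed.

End LinearEquation.

Arguments lin_continuous {R q B w} _ _ i.

(** * Smooth dependence on parameters of solutions of linear equations *)

Section LinearEstimate.
Context {R : realType} {q : nat} {T : Type} {F : set_system T} {FF : Filter F}.
Context {rho : T -> R}.

(** An error term satisfying a linear equation inherits the order of magnitude of
    the inhomogeneous term. All differentiability statements about solutions of
    integral equations below are obtained by finding the equation satisfied by
    the error. *)
Lemma lin_uniformO p (B : T -> 'I_q -> 'I_q -> R -> R) (e w : T -> 'I_q -> R -> R) :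
  (forall t, 0 <= rho t) ->
  (\forall t \near F, [/\ forall i l, continuous (B t i l), small (B t),
     forall l, continuous (w t l), forall l, bounded_fam (w t l) &
     forall i s, w t i s = e t i s + lin_op (B t) (w t) i s]) ->
  (forall i, uniformO (F := F) (rho := rho) p (fun t => e t i)) ->
  forall i, uniformO (F := F) (rho := rho) p (fun t => w t i).
Proof.
move=> rho0 Bw ep i.
have /choice[C HC] : forall i, exists C, 0 <= C /\
    \forall t \near F, forall s, `|e t i s| <= C * rho t ^+ p.
  by move=> j; have [C C0 HC] := ep j; exists C.
have sC0 : 0 <= \sum_i C i by apply: sumr_ge0 => j _; exact: (HC j).1.
exists (2 * \sum_i C i); first by rewrite mulr_ge0.
have : \forall t \near F, forall j s, `|e t j s| <= C j * rho t ^+ p.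
  by apply: filter_forall => j; exact: (HC j).2.
move: Bw; apply: filterS2 => t [cB sB cw bw wE] eC s.
rewrite -mulrA; apply: (lin_bound cB sB cw bw wE) => j s'.
rewrite (le_trans (eC j s'))// ler_wpM2r ?exprn_ge0// (bigD1 j)//= lerDl.
by apply: sumr_ge0 => l _; exact: (HC l).1.
Qed.

End LinearEstimate.

Section LinearRegularity.
Context {R : realType} {n q : nat}.
Local Notation family := ('rV[R]_n -> R -> R).
Implicit Types (a w z : 'I_q -> family) (B : 'I_q -> 'I_q -> family).
Implicit Types (x : 'rV[R]_n) (W : set 'rV[R]_n).

Definition at_pt2 B x i l : R -> R := B i l x.
Definition at_pt w x i : R -> R := w i x.

Definition lin_solution W a B w := forall x, W x ->
  [/\ forall i, continuous (w i x), forall i, bounded_fam (w i x) &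
    forall i s, w i x s = a i x s + lin_op (at_pt2 B x) (at_pt w x) i s].

Lemma lin_tame W a B w : open W -> (forall x, W x -> small (at_pt2 B x)) ->
  (forall i, tame W (a i)) -> (forall i l, tame W (B i l)) ->
  lin_solution W a B w -> forall i, tame W (w i).
Proof.
move=> oW sB ta tB sw i x Wx; have [cw bw wE] := sw x Wx; split=> //.
have cB y : W y -> forall i l, continuous (at_pt2 B y i l).
  by move=> Wy j l; have [] := tB j l y Wy.
have xW : \forall y \near x, W y by exact: open_nbhs_nbhs.
pose dB y i l s := at_pt2 B y i l s - at_pt2 B x i l s.
have cdB y : W y -> forall i l, continuous (dB y i l).
  by move=> Wy j l; apply: continuousB_fam; exact: cB.
apply: (@lin_uniformO R q _ (nbhs x) _ (fun y => `|y - x|) 1 (at_pt2 B)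
  (fun y i s => a i y s - a i x s + lin_op (dB y) (at_pt w x) i s)
  (fun y i s => w i y s - w i x s)).
- by move=> y; exact: dist_ge0.
- apply: filterS xW => y Wy; have [cy by_ yE] := sw y Wy.
  split=> [||l|l|j s]; [exact: cB|exact: sB|exact: continuousB_fam| |].
    have [C C0 HC] := bw l; have [D D0 HD] := by_ l; exists (D + C).
      exact: addr_ge0.
    by move=> s; rewrite (le_trans (ler_normB _ _))// lerD.
  rewrite yE wE.
  suff -> : lin_op (at_pt2 B y) (at_pt w y) j s =
     lin_op (at_pt2 B x) (at_pt w x) j s + lin_op (dB y) (at_pt w x) j s +
     lin_op (at_pt2 B y) (fun l s => w l y s - w l x s) j s by ring.
  have cd l : continuous (fun s => w l y s - w l x s) by exact: continuousB_fam.
  have c1 := lin_continuous (cB x Wx) cw j.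
  have c2 := lin_continuous (cdB y Wy) cw j.
  have c3 := lin_continuous (cB y Wy) cd j.
  rewrite /lin_op -!primitiveD//; try by repeat (apply: continuousD_fam => //).
  congr (primitive _ s); apply/funext => t; rewrite -!big_split/=.
  by apply: eq_bigr => l _; rewrite /dB /at_pt /at_pt2; ring.
move=> j; apply: uniformOD; first by have [] := ta j x Wx.
apply: uniformO_primitive; last first.
  by apply: filterS xW => y Wy; apply: lin_continuous => //; exact: cdB.
apply: uniformO_sum => l; apply: uniformOM0; first by have [] := tB j l x Wx.
by apply: uniformO_bounded; exact: bw.
Qed.

(** The candidate z for the derivative solves the differentiated equation. The
    error w(x + h e_k) - w(x) - h z(x) then solves the linear equation at x + h e_k
    with an inhomogeneous term that is quadratic in h. *)
Lemma lin_has_partial W a B w k (da : 'I_q -> family) (dB : 'I_q -> 'I_q -> family) z :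
  open W -> (forall x, W x -> small (at_pt2 B x)) ->
  (forall i, tame W (a i)) -> (forall i l, tame W (B i l)) ->
  (forall i l, tame W (dB i l)) ->
  (forall i x, W x -> has_partial k (a i) x (da i x)) ->
  (forall i l x, W x -> has_partial k (B i l) x (dB i l x)) ->
  lin_solution W a B w ->
  lin_solution W (fun i x s => da i x s + lin_op (at_pt2 dB x) (at_pt w x) i s) B z ->
  forall i x, W x -> has_partial k (w i) x (z i x).
Proof.
move=> oW sB ta tB tdB da_ dB_ sw sz i x Wx.
have [cw bw wE] := sw x Wx; have [cz bz zE] := sz x Wx.
have cB y : W y -> forall i l, continuous (at_pt2 B y i l).
  by move=> Wy j l; have [] := tB j l y Wy.
have cdB : forall i l, continuous (dB i l x).
  by move=> j l; have [] := tdB j l x Wx.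
have xW : \forall y \near x, W y by exact: open_nbhs_nbhs.
have hW := near_translate (basis_vec k) xW.
have chf (h : R) (f : R -> R) : continuous f -> continuous (fun s => h * f s).
  by move=> cf; apply: continuousM_fam => // s; exact: cvg_cst.
pose xh (h : R) := x + h *: basis_vec k.
pose B1 h i l s := at_pt2 B (xh h) i l s - at_pt2 B x i l s.
pose B2 h i l s := at_pt2 B (xh h) i l s - at_pt2 B x i l s - h * dB i l x s.
have cB1 h : W (xh h) -> forall i l, continuous (B1 h i l).
  by move=> Wh j l; apply: continuousB_fam; exact: cB.
have cB2 h : W (xh h) -> forall i l, continuous (B2 h i l).
  by move=> Wh j l; apply: continuousB_fam; [exact: cB1|exact/chf/cdB].
pose hz (h : R) l s := h * z l x s.
have chz h l : continuous (hz h l) by apply: chf; exact: cz.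
apply: (@lin_uniformO R q _ (nbhs (0 : R)) _ (fun h : R => `|h|) 2
  (fun h => at_pt2 B (xh h))
  (fun h i s => a i (xh h) s - a i x s - h * da i x s +
     (lin_op (B2 h) (at_pt w x) i s + lin_op (B1 h) (hz h) i s))
  (fun h i s => w i (xh h) s - w i x s - h * z i x s)).
- by move=> h; exact: normr_ge0.
- apply: filterS hW => h Wh; have [cy by_ yE] := sw _ Wh.
  have cd l : continuous (fun s => w l (xh h) s - w l x s - h * z l x s).
    by apply: continuousB_fam; [exact: continuousB_fam|exact: chz].
  split=> [||l|l|j s]; [exact: cB|exact: sB|exact: cd| |].
    have [C C0 HC] := bw l; have [D D0 HD] := by_ l; have [E E0 HE] := bz l.
    exists (D + C + `|h| * E); first by rewrite !addr_ge0// mulr_ge0.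
    move=> s; rewrite (le_trans (ler_normB _ _))// lerD//.
      by rewrite (le_trans (ler_normB _ _))// lerD.
    by rewrite normrM ler_wpM2l.
  rewrite yE wE zE.
  suff -> : lin_op (at_pt2 B (xh h)) (at_pt w (xh h)) j s =
     lin_op (at_pt2 B x) (at_pt w x) j s + h * lin_op (at_pt2 dB x) (at_pt w x) j s +
     h * lin_op (at_pt2 B x) (at_pt z x) j s +
     (lin_op (B2 h) (at_pt w x) j s + lin_op (B1 h) (hz h) j s) +
     lin_op (at_pt2 B (xh h))
       (fun l s => w l (xh h) s - w l x s - h * z l x s) j s by ring.
  have c1 := lin_continuous (cB x Wx) cw j.
  have c2 := lin_continuous cdB cw j.
  have c3 := lin_continuous (cB x Wx) cz j.
  have c4 := lin_continuous (cB2 h Wh) cw j.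
  have c5 := lin_continuous (cB1 h Wh) (chz h) j.
  have c6 := lin_continuous (cB _ Wh) cd j.
  rewrite /lin_op -!primitiveZ// -!primitiveD//;
    try by repeat (apply: continuousD_fam => //); exact: chf.
  congr (primitive _ s); apply/funext => t.
  rewrite !mulr_sumr -!big_split/=.
  by apply: eq_bigr => l _; rewrite /B2 /B1 /hz /at_pt /at_pt2; ring.
move=> j; apply: uniformOD; first exact: da_.
apply: uniformOD.
  apply: uniformO_primitive; last first.
    by apply: filterS hW => h Wh; apply: lin_continuous => //; exact: cB2.
  apply: uniformO_sum => l.
  by apply: uniformOM0; [exact: dB_|apply: uniformO_bounded; exact: bw].
apply: uniformO_primitive; last first.
  by apply: filterS hW => h Wh; apply: lin_continuous => //; exact: cB1.
apply: uniformO_sum => l; apply: (@uniformOM _ _ _ _ _ _ 1 1).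
  apply: has_partial_increment; last exact: dB_.
  by have [] := tdB j l x Wx.
apply: uniformOM0; last by apply: uniformO_bounded; exact: bz.
by exists 1 => //; near=> h => s; rewrite mul1r.
Unshelve. all: by end_near. Qed.

Lemma lin_op_smooth W m B w i : open W ->
  (forall l, smooth_fam m W (B i l)) -> (forall l, smooth_fam m W (w l)) ->
  smooth_fam m W (fun x s => lin_op (at_pt2 B x) (at_pt w x) i s).
Proof.
move=> oW sB sw.
apply: (smooth_fam_primitive (F := fun x t => \sum_l B i l x t * w l x t)) => //.
by apply: smooth_fam_sum => // l; exact: smooth_famM.
Qed.

(** The derivative of a solution solves an equation with the same linear part and
    an inhomogeneous term containing the solution itself, which is one order
    smoother than what has to be proved: induction on m. *)
Lemma lin_smooth W m a B w : open W -> (forall x, W x -> small (at_pt2 B x)) ->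
  (forall i, smooth_fam m W (a i)) -> (forall i l, smooth_fam m W (B i l)) ->
  lin_solution W a B w -> forall i, smooth_fam m W (w i).
Proof.
move=> oW sB; elim: m a w => [|m IH] a w sa sB' sw i.
  by split=> //; apply: (lin_tame oW sB _ _ sw) => [j|j l];
    [exact: (sa j).1|exact: (sB' j l).1].
have tw := lin_tame oW sB (fun j => (sa j).1) (fun j l => (sB' j l).1) sw.
apply: smooth_fam_intro => // k.
have sw' := IH a w (fun j => smooth_famW (sa j)) (fun j l => smooth_famW (sB' j l)) sw.
pose dB i l := partial_fam k (B i l).
pose da i x s := partial_fam k (a i) x s + lin_op (at_pt2 dB x) (at_pt w x) i s.
have sda j : smooth_fam m W (da j).
  apply: smooth_famD => //; first by have [_ /(_ k)[]] := sa j.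
  by apply: lin_op_smooth => // l; have [_ /(_ k)[]] := sB' j l.
have cB x : W x -> forall i l, continuous (at_pt2 B x i l).
  by move=> Wx j l; have [] := (sB' j l).1 x Wx.
have /choice[z zP] : forall x, exists z : 'I_q -> R -> R, W x ->
    [/\ forall i, continuous (z i), forall i, bounded_fam (z i) &
      forall i s, z i s = da i x s + lin_op (at_pt2 B x) z i s].
  move=> x; have [Wx|nWx] := pselect (W x); last by exists (fun _ _ => 0).
  have cda j : continuous (da j x) by have [] := smooth_fam_tame (sda j) Wx.
  have bda j : bounded_fam (da j x) by have [] := smooth_fam_tame (sda j) Wx.
  by have [z] := lin_exists cda bda (cB x Wx) (sB x Wx); exists z.
have sz : lin_solution W da B (fun i x => z x i) by [].
exists (fun x => z x i); split.
  apply: (lin_has_partial (a := a) (B := B) (da := fun i => partial_fam k (a i))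
    (dB := dB) (z := fun i x => z x i) oW sB) => //.
  - by move=> j; exact: (sa j).1.
  - by move=> j l; exact: (sB' j l).1.
  - by move=> j l; have [_ /(_ k)[_ /smooth_fam_tame]] := sB' j l.
  - by move=> j; have [_ /(_ k)[]] := sa j.
  - by move=> j l; have [_ /(_ k)[]] := sB' j l.
by apply: (IH da (fun i x => z x i)) => // j l; exact: smooth_famW.
Qed.

End LinearRegularity.

(** * First integrals of a vector field *)

Section ChainRuleAlongCurve.
Context {R : realType} {n : nat}.
Implicit Types (O : set 'rV[R]_n) (V : 'rV[R]_n -> R).

(** The curve is differentiable at a single parameter value, so its remainder is
    o(h), not quadratic as for smooth families. *)
Lemma is_derive_curve O V (f : 'I_n -> R -> R) (d : 'I_n -> R) t :
  open O -> smooth_on O V -> O (\row_j f j t) ->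
  (forall j, is_derive t 1 (f j) (d j)) ->
  is_derive t 1 (fun t => V (\row_j f j t))
    (\sum_j d j * partial j V (\row_j f j t)).
Proof.
move=> oO sV Ot df; have [r r0 rO] := open_ball_in oO Ot.
have [C C0 HC] := smooth_taylor1 sV rO.
set a : 'rV[R]_n := \row_j f j t.
pose K := 1 + \sum_j `|d j|.
(* |b - a| <= K |h| bounds the Taylor remainder of V by C K^2 h^2; e1 and e2
   make this term and the error on the curve at most e/2 |h| each. *)
have K0 : 0 < K by rewrite ltr_pwDl// sumr_ge0.
pose S := \sum_j `|partial j V a|.
have S0 : 0 <= S by rewrite sumr_ge0.
apply/is_derive_estimateP => e e0.
pose e1 := Num.min 1 (e / (2 * (1 + S))).
have e10 : 0 < e1 by rewrite lt_min ltr01 divr_gt0// mulr_gt0// ltr_pwDl.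
pose e2 := Num.min (r / K) (e / (2 * (1 + C * K ^+ 2))).
have CK0 : 0 <= C * K ^+ 2 by rewrite mulr_ge0// exprn_ge0// ltW.
have e20 : 0 < e2.
  by rewrite lt_min divr_gt0//= divr_gt0// mulr_gt0// ltr_pwDl.
have near1 : \forall h \near (0 : R), forall j,
    `|f j (t + h%:A) - f j t - h * d j| <= e1 * `|h|.
  apply: (@filter_forall _ _ _ (nbhs (0 : R))) => j.
  have /is_derive_estimateP := df j; exact.
have near2 : \forall h \near (0 : R), `|h| <= e2 by apply: nbhs0_le.
move: near1 near2; apply: filterS2 => h fh he.
pose b : 'rV[R]_n := \row_j f j (t + h%:A).
have ba : `|b - a| <= K * `|h|.
  apply/rV_norm_le; first by rewrite mulr_ge0// ltW.
  move=> j; rewrite !mxE.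
  have := ler_normD (f j (t + h%:A) - f j t - h * d j) (h * d j).
  rewrite subrK => /le_trans; apply.
  rewrite /K mulrDl lerD//.
    by rewrite (le_trans (fh j))// ler_wpM2r// ge_min lexx.
  rewrite normrM mulrC ler_wpM2r// (bigD1 j)//= lerDl.
  by apply: sumr_ge0.
have br : `|b - a| <= r.
  rewrite (le_trans ba)// mulrC -ler_pdivlMr// (le_trans he)//.
  by rewrite ge_min lexx.
have aa : `|a - a| <= r by rewrite subrr normr0 ltW.
have T := HC a b aa br.
have -> : V b - V a - h *: (\sum_j d j * partial j V a) =
    (V b - V a - \sum_j (b 0 j - a 0 j) * partial j V a) +
    \sum_j (f j (t + h%:A) - f j t - h * d j) * partial j V a.
  rewrite [h *: _]mulr_sumr -!addrA; congr (_ + (_ + _)).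
  rewrite -!sumrN -big_split/=; apply: eq_bigr => j _; rewrite !mxE.
  by move: (partial j V a) (f j _) (f j _) => u v w; ring.
rewrite (le_trans (ler_normD _ _))//.
have -> : e * `|h| = e / 2 * `|h| + e / 2 * `|h| by field.
rewrite lerD//.
  rewrite (le_trans T)// (@le_trans _ _ (C * (K * `|h|) ^+ 2))//.
    by rewrite ler_wpM2l// lerXn2r// nnegrE// mulr_ge0// ltW.
  rewrite exprMn mulrA expr2 mulrA ler_wpM2r//.
  have : `|h| <= e / (2 * (1 + C * K ^+ 2)) by rewrite (le_trans he)// ge_min lexx orbT.
  rewrite ler_pdivlMr; last by rewrite mulr_gt0// ltr_pwDl.
  have := normr_ge0 h; move: (C * K ^+ 2) CK0 => A A0 h0 hA.
  rewrite ler_pdivlMr//; nra.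
rewrite (le_trans (ler_norm_sum _ _ _))//.
rewrite (@le_trans _ _ (\sum_j e1 * `|h| * `|partial j V a|))//.
  by apply: ler_sum => j _; rewrite normrM ler_wpM2r.
rewrite -mulr_sumr -/S mulrAC ler_wpM2r//.
have : e1 <= e / (2 * (1 + S)) by rewrite ge_min lexx orbT.
rewrite ler_pdivlMr; last by rewrite mulr_gt0// ltr_pwDl.
by move=> ?; rewrite ler_pdivlMr//; nra.
Qed.

End ChainRuleAlongCurve.


Section Flow.
Context {R : realType} {n : nat}.
Context {O : set 'rV[R]_n} {V : 'I_n -> 'rV[R]_n -> R} {p : 'rV[R]_n} {i0 : 'I_n}.
Context {rho r M L D : R}.
Context (oO : open O) (sV : forall j, smooth_on O (V j)).
Context (rhoO : ball_in O p rho) (rho0 : 0 < rho) (r0 : 0 < r).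
Context (M0 : 0 <= M) (L0 : 0 <= L) (D0 : 0 <= D).
Context (VM : forall j x, `|x - p| <= rho -> `|V j x| <= M).
Context (VL : forall j a b, `|a - p| <= rho -> `|b - p| <= rho ->
  `|V j b - V j a| <= L * `|b - a|).
Context (VD : forall i x, `|x - p| <= rho -> \sum_l `|partial l (V i) x| <= D).
Context (r_rho : r + r * M <= rho) (rL : r * L <= 1 / 2) (rD : r * D <= 1 / 2).
Implicit Types x y : 'rV[R]_n.

Let W := [set x : 'rV[R]_n | `|x - p| < r].
Let c (x : 'rV[R]_n) : R := p 0 i0 - x 0 i0.

Lemma flow_open : open W.
Proof.
have -> : W = ball p r.
  by apply/seteqP; split=> x; rewrite -ball_normE/= distrC.
exact: ball_open.
Qed.

Let cr x : W x -> `|c x| <= r.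
Proof.
move=> /ltW xr; rewrite (le_trans _ xr)// /c.
by have := rV_norm_coord (x - p) i0; rewrite !mxE distrC.
Qed.

(** The integral equation of du/ds = c(x) V(u), u(0) = x: at s = 1 the flow of V
    has run for the time c(x), which is the time needed to reach the hyperplane
    y_i0 = p_i0 when V_i0 = 1. Since c vanishes at p, the equation is a contraction
    for x close to p. *)
Definition flow_spec x (u : 'I_n -> R -> R) :=
  [/\ forall i, continuous (u i), forall s, `|\row_j u j s - p| <= rho &
    forall i s, u i s = x 0 i + c x * primitive (fun t => V i (\row_j u j t)) s].

Lemma flow_fam_continuous (u : 'I_n -> R -> R) : (forall i, continuous (u i)) ->
  (forall s, `|\row_j u j s - p| <= rho) ->
  forall i, continuous (fun t => V i (\row_j u j t)).
Proof.
move=> cu up i s; apply: (@continuous_comp _ _ _ (fun t => \row_j u j t) (V i)).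
  exact: row_continuous.
by apply: (smooth_on_continuous (sV i)); exact: rhoO.
Qed.

Arguments flow_fam_continuous {u} _ _ i.

Lemma flow_exists x : W x -> exists u, flow_spec x u.
Proof.
move=> Wx; pose P (y : 'I_n * R -> R) := (forall i, continuous (fun s => y (i, s))) /\
  forall s, `|\row_j y (j, s) - p| <= rho.
pose Phi (y : 'I_n * R -> R) (t : 'I_n * R) :=
  x 0 t.1 + c x * primitive (fun s => V t.1 (\row_j y (j, s))) t.2.
have rM0 : 0 <= r * M by rewrite mulr_ge0// ltW.
have rhoge : 0 <= rho by exact: ltW.
have xp : `|x - p| <= rho.
  by rewrite (le_trans (ltW Wx))// (le_trans _ r_rho)// lerDl.
have xE : \row_j x 0 j = x by apply/rowP => j; rewrite mxE.
have P0 : P (fun t => x 0 t.1).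
  by split=> [i s|s] /=; [exact: cvg_cst|rewrite xE].
have [|y z C [cy yp] [cz zp] yz [i s]||[i s]|y Hy|y [cy yp] yE] :=
    @contraction_fixpoint R _ P Phi (fun t => x 0 t.1) (r * M) P0.
- move=> y [cy yp]; have cV := flow_fam_continuous cy yp; split.
    move=> i; rewrite /Phi/=; have cP := primitive_continuous (cV i).
    have cc (a : R) : continuous (fun _ : R => a) by move=> s; exact: cvg_cst.
    have cM := continuousM_fam (cc (c x)) cP.
    exact (continuousD_fam (cc (x 0 i)) cM).
  move=> s; apply/rV_norm_le => // j; rewrite !mxE /Phi/= addrAC.
  rewrite (le_trans (ler_normD _ _))// (le_trans _ r_rho)// lerD//.
    have := rV_norm_coord (x - p) j; rewrite !mxE => /le_trans; apply.
    exact: ltW.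
  rewrite normrM ler_pM//; first exact: cr.
  by apply: primitive_le => [|t]; [exact: cV|exact: VM].
- have cV := flow_fam_continuous cy yp; have cV' := flow_fam_continuous cz zp.
  have C0 : 0 <= C by rewrite (le_trans _ (yz (i, s))).
  rewrite /Phi/= opprD addrACA subrr add0r -mulrBr -primitiveB; last 2 first.
  + exact: cV.
  + exact: cV'.
  rewrite normrM (@le_trans _ _ (r * (L * C)))//.
    rewrite ler_pM//; first exact: cr.
    apply: primitive_le => [|t]; first by apply: continuousB_fam; [exact: cV|exact: cV'].
    rewrite (le_trans (VL _ (zp t) (yp t)))// ler_wpM2l//.
    by apply/rV_norm_le => // j; rewrite !mxE; exact: yz.
  by rewrite mulrA mulrC ler_wpM2l// -[2^-1]mul1r.
- by [].
- have [cx xp'] := P0.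
  rewrite /Phi/= addrAC subrr add0r normrM ler_pM//; first exact: cr.
  by apply: primitive_le => [|t]; [exact: (flow_fam_continuous cx xp')|exact: VM (xp' t)].
- split.
    move=> i; apply: uniform_limit_continuous_fam => e /Hy[z [cz _] yz].
    by exists (fun s => z (i, s)).
  move=> s; apply/rV_norm_le => // j; rewrite !mxE; apply/ler_addgt0Pr => e /Hy.
  move=> [z [_ zp] yz]; have := rV_norm_coord (\row_j z (j, s) - p) j.
  rewrite !mxE => /le_trans/(_ (zp s)) A; have B := yz (j, s).
  rewrite -(subrKA (z (j, s))) addrC (le_trans (ler_normD _ _))//.
  by rewrite lerD.
exists (fun i s => y (i, s)); split=> // i s.
by rewrite -[LHS]yE.
Qed.

Context {u : 'I_n -> 'rV[R]_n -> R -> R}.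
Context (uP : forall x, W x -> flow_spec x (fun i => u i x)).

Lemma flow_ball x s : W x -> `|row_fam u x s - p| <= rho.
Proof. by move=> /uP[_ up _]; exact: up. Qed.

Lemma flow_near x : W x -> \forall y \near x, W y.
Proof. by move=> Wx; apply: open_nbhs_nbhs; split=> //; exact: flow_open. Qed.

Lemma flow_locally_in : locally_in O W u.
Proof.
move=> x Wx; exists p, rho; split=> //.
by apply: filterS (flow_near Wx) => y Wy s; exact: flow_ball.
Qed.

Lemma flow_V_continuous x i : W x -> continuous (fun t => V i (row_fam u x t)).
Proof. by move=> /uP[cu up _]; exact: (flow_fam_continuous cu up i). Qed.

(** The difference of two solutions is bounded by the difference of the data plus
    half of its own supremum. *)
Lemma flow_lipschitz x y : W x -> W y -> forall j s,
  `|u j y s - u j x s| <= 2 * (`|y - x| * (1 + M)).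
Proof.
move=> Wx Wy j s; have [cx bx Ex] := uP Wx; have [cy by_ Ey] := uP Wy.
apply: (@sup_absorb _ _ (fun t : 'I_n * R => u t.1 y t.2 - u t.1 x t.2) _ _ _ (j, s)).
  exists (rho + rho); first by rewrite addr_ge0// ltW.
  move=> [l t] /=; rewrite -(subrKA (p 0 l)) (le_trans (ler_normD _ _))// lerD//.
    have := rV_norm_coord (row_fam u y t - p) l; rewrite !mxE => /le_trans; apply.
    exact: flow_ball.
  have := rV_norm_coord (row_fam u x t - p) l; rewrite !mxE distrC => /le_trans.
  by apply; exact: flow_ball.
move=> C uC [l t] /=; have C0 : 0 <= C := le_trans (normr_ge0 _) (uC (l, t)).
have cVx := flow_V_continuous (i := l) Wx; have cVy := flow_V_continuous (i := l) Wy.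
set Py := primitive (fun t => V l (row_fam u y t)) t.
set Px := primitive (fun t => V l (row_fam u x t)) t.
have -> : u l y t - u l x t =
    (y 0 l - x 0 l) + (c y - c x) * Px + c y * (Py - Px).
  by rewrite Ey Ex -/Py -/Px; ring.
rewrite (le_trans (ler_normD _ _))// lerD//.
  rewrite (le_trans (ler_normD _ _))// mulrDr mulr1 lerD//.
    by have := rV_norm_coord (y - x) l; rewrite !mxE.
  rewrite normrM ler_pM//.
    have -> : c y - c x = - (y - x) 0 i0 by rewrite !mxE /c; ring.
    by rewrite normrN; exact: rV_norm_coord.
  by apply: primitive_le => // t'; apply: VM; exact: flow_ball.
rewrite normrM (@le_trans _ _ (r * (L * C)))//.
  rewrite ler_pM//; first exact: cr.
  rewrite /Py /Px -primitiveB//; apply: primitive_le; first exact: continuousB_fam.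
  move=> t'; rewrite (le_trans (VL _ (flow_ball _ Wx) (flow_ball _ Wy)))//.
  by rewrite ler_wpM2l//; apply/rV_norm_le => // i; rewrite !mxE; exact: (uC (i, t')).
by rewrite mulrA mulrC ler_wpM2l// -[2^-1]mul1r.
Qed.

Lemma flow_tame j : tame W (u j).
Proof.
move=> x Wx; have [cx bx Ex] := uP Wx; split=> //.
  exists (rho + `|p|); first by rewrite addr_ge0// ltW.
  move=> s; rewrite -(subrK (p 0 j) (u j x s)) (le_trans (ler_normD _ _))// lerD//.
    have := rV_norm_coord (row_fam u x s - p) j; rewrite !mxE => /le_trans; apply.
    exact: flow_ball.
  exact: rV_norm_coord.
exists (2 * (1 + M)); first by rewrite mulr_ge0// addr_ge0.
apply: filterS (flow_near Wx) => y Wy s; rewrite expr1.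
by rewrite (le_trans (flow_lipschitz Wx Wy j s))// mulrAC mulrA.
Qed.

(** Linear part and inhomogeneous term of the equation obtained by differentiating
    the integral equation of the flow in the direction k; the derivative of the
    time c contributes to the inhomogeneous term. *)
Definition flow_lin j l x (s : R) : R := c x * partial l (V j) (row_fam u x s).
Definition flow_inhom k j x (s : R) : R :=
  (j == k)%:R + - (k == i0)%:R * primitive (fun t => V j (row_fam u x t)) s.

Lemma flow_small x : W x -> small (at_pt2 flow_lin x).
Proof.
move=> Wx i t; rewrite (le_trans _ rD)//.
under eq_bigr do rewrite /at_pt2 /flow_lin normrM.
rewrite -mulr_sumr ler_pM//; [exact: sumr_ge0|exact: cr|].
by apply: VD; exact: flow_ball.
Qed.

Lemma tame_partial_flow j l : tame W (fun x s => partial l (V j) (row_fam u x s)).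
Proof.
apply: (tame_comp (smooth_on_partial l (sV j)) flow_locally_in) => i.
exact: flow_tame.
Qed.

Lemma tame_V_flow j : tame W (fun x s => V j (row_fam u x s)).
Proof. by apply: (tame_comp (sV j) flow_locally_in) => i; exact: flow_tame. Qed.

Lemma smooth_fam_flow_time m : smooth_fam m W (fun x _ => c x).
Proof.
have oW := flow_open; apply: (@smooth_fam_eq _ _ _ _
    (fun x (_ : R) => p 0 i0 + (-1 * x 0 i0))) => //.
  by move=> x _; apply/funext => s; rewrite mulN1r.
apply: smooth_famD => //; first exact: smooth_fam_cst.
by apply: smooth_famM => //; [exact: smooth_fam_cst|exact: smooth_fam_coord].
Qed.

Lemma flow_variation_exists k : exists w : 'I_n -> 'rV[R]_n -> R -> R,
  lin_solution W (flow_inhom k) flow_lin w.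
Proof.
have tc : tame W (fun x (_ : R) => c x) := smooth_fam_tame (smooth_fam_flow_time 0).
have oW := flow_open.
have /choice[w wP] : forall x, exists w : 'I_n -> R -> R, W x ->
    [/\ forall i, continuous (w i), forall i, bounded_fam (w i) &
      forall i s, w i s = flow_inhom k i x s + lin_op (at_pt2 flow_lin x) w i s].
  move=> x; have [Wx|nWx] := pselect (W x); last by exists (fun _ _ => 0).
  have ta j : tame W (flow_inhom k j).
    apply: tameD; first exact: tame_cst.
    apply: tameM; first exact: tame_cst.
    by apply: tame_primitive => //; exact: tame_V_flow.
  have tB j l : tame W (flow_lin j l) by apply: tameM => //; exact: tame_partial_flow.
  have ca j : continuous (flow_inhom k j x) by have [] := ta j x Wx.
  have ba j : bounded_fam (flow_inhom k j x) by have [] := ta j x Wx.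
  have cB j l : continuous (at_pt2 flow_lin x j l) by have [] := tB j l x Wx.
  by have [w] := lin_exists ca ba cB (flow_small Wx); exists w.
by exists (fun i x => w x i).
Qed.

Lemma tame_increment k (F : 'rV[R]_n -> R -> R) x : tame W F -> W x ->
  incrementO 1 (fun h s => F (x + h *: basis_vec k) s - F x s).
Proof.
move=> tF Wx; have [_ _ [C C0 HC]] := tF x Wx; exists C => //.
apply: filterS (near_translate (basis_vec k) HC) => h H s.
have := H s; rewrite [X in _ * `|X| ^+ _]addrAC subrr add0r normrZ.
by rewrite norm_basis_vec mulr1.
Qed.

(** The Lipschitz bound makes the Taylor remainder of V along the flow quadratic in
    h, so the error satisfies the linear equation at x up to a term of order h^2. *)
Lemma flow_has_partial k w : lin_solution W (flow_inhom k) flow_lin w ->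
  forall j x, W x -> has_partial k (u j) x (w j x).
Proof.
move=> sw j x Wx; have [cw bw wE] := sw x Wx.
have oW := flow_open; have hW := near_translate (basis_vec k) (flow_near Wx).
pose xh (h : R) := x + h *: basis_vec k.
have [cx bx Ex] := uP Wx.
have cD i l : continuous (fun s => partial l (V i) (row_fam u x s)).
  by have [] := tame_partial_flow i l Wx.
have cc (a : R) : continuous (fun _ : R => a) by move=> s; exact: cvg_cst.
have cB i l : continuous (at_pt2 flow_lin x i l) by exact: continuousM_fam.
pose dV i h s := V i (row_fam u (xh h) s) - V i (row_fam u x s).
pose tay i h s := dV i h s - \sum_l (u l (xh h) s - u l x s) *
  partial l (V i) (row_fam u x s).
have cdV i h : W (xh h) -> continuous (dV i h).
  by move=> Wh; apply: continuousB_fam; exact: flow_V_continuous.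
have ctay i h : W (xh h) -> continuous (tay i h).
  move=> Wh; have [ch _ _] := uP Wh.
  apply: continuousB_fam; first exact: cdV.
  apply: continuous_fam_sum => l; apply: continuousM_fam; last exact: cD.
  exact: continuousB_fam.
apply: (@lin_uniformO R n _ (nbhs (0 : R)) _ (fun h : R => `|h|) 2
  (fun=> at_pt2 flow_lin x)
  (fun h i s => - (k == i0)%:R * (h * primitive (dV i h) s) + c x * primitive (tay i h) s)
  (fun h i s => u i (xh h) s - u i x s - h * w i x s)).
- by move=> h; exact: normr_ge0.
- apply: filterS hW => h Wh; have [ch bh Eh] := uP Wh.
  have chw l : continuous (fun s => h * w l x s) by exact: continuousM_fam.
  have cd l : continuous (fun s => u l (xh h) s - u l x s - h * w l x s).
    by apply: continuousB_fam => //; exact: continuousB_fam.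
  split=> [||l|l|i s]; [exact: cB|exact: flow_small|exact: cd| |].
    have [_ [C C0 HC] _] := @flow_tame l _ Wx.
    have [_ [C' C'0 HC'] _] := @flow_tame l _ Wh.
    have [E E0 HE] := bw l; exists (C' + C + `|h| * E).
      by rewrite !addr_ge0// mulr_ge0.
    move=> s; rewrite (le_trans (ler_normB _ _))// lerD//.
      by rewrite (le_trans (ler_normB _ _))// lerD.
    by rewrite normrM ler_wpM2l.
  rewrite Eh Ex wE /flow_inhom.
  set P0 := primitive (fun t => V i (\row_j u j x t)) s.
  set P1 := primitive (fun t => V i (\row_j u j (xh h) t)) s.
  have dVE : primitive (dV i h) s = P1 - P0.
    by rewrite /dV primitiveB//; exact: flow_V_continuous.
  have xhE : xh h 0 i = x 0 i + h * (i == k)%:R by rewrite !mxE eqxx.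
  have chE : c (xh h) = c x + h * - (k == i0)%:R.
    by rewrite /c !mxE eqxx/= (eq_sym i0); ring.
  have linE : lin_op (at_pt2 flow_lin x) (fun l s => u l (xh h) s - u l x s - h * w l x s) i s
     = c x * (primitive (dV i h) s - primitive (tay i h) s)
       - h * lin_op (at_pt2 flow_lin x) (at_pt w x) i s.
    have cdt : continuous (fun s => dV i h s - tay i h s).
      by apply: continuousB_fam; [exact: cdV|exact: ctay].
    have cL := lin_continuous cB cw i.
    have c1 : continuous (fun s => c x * (dV i h s - tay i h s)) by exact: continuousM_fam.
    have c2 : continuous (fun s => h * \sum_l at_pt2 flow_lin x i l s * at_pt w x l s).
      exact: continuousM_fam.
    rewrite /lin_op -primitiveB; last 2 first.
    + exact: cdV.
    + exact: ctay.
    rewrite -primitiveZ// -(primitiveZ h)// -primitiveB//.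
    congr (primitive _ s); apply/funext => t; rewrite /tay subKr !mulr_sumr -sumrB.
    by apply: eq_bigr => l _; rewrite /at_pt2 /flow_lin /at_pt; ring.
  by rewrite linE dVE xhE chE; ring.
move=> i; apply: uniformOD.
  have N1 : incrementO 0 (fun _ (_ : R) => - (k == i0)%:R).
    by apply: uniformO_bounded; exists `|- (k == i0)%:R|.
  have O1 : incrementO 1 (fun h (_ : R) => h).
    by exists 1 => //; near=> h => s; rewrite mul1r.
  apply: (uniformOM N1 (uniformOM O1 _)); apply: uniformO_primitive.
    exact: tame_increment (tame_V_flow i) Wx.
  by apply: filterS hW => h; exact: cdV.
have Nc : incrementO 0 (fun _ (_ : R) => c x).
  by apply: uniformO_bounded; exists `|c x|.
apply: (uniformOM Nc); apply: uniformO_primitive; last first.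
  by apply: filterS hW => h; exact: ctay.
apply: (increment_taylor (sV i) flow_locally_in Wx) => l.
exact: tame_increment (flow_tame l) Wx.
Unshelve. all: by end_near. Qed.

(** If the flow is m times differentiable, so are the coefficients of the equation
    of variations, hence its solutions, which are the first derivatives of the
    flow. *)
Lemma flow_smooth m j : smooth_fam m W (u j).
Proof.
have oW := flow_open.
elim: m j => [|m IH] j; first by split=> //; exact: flow_tame.
apply: smooth_fam_intro => //; first exact: flow_tame.
move=> k; have [w sw] := flow_variation_exists k.
exists (w j); split; first by move=> x Wx; exact: flow_has_partial sw j x Wx.
apply: (lin_smooth oW flow_small _ _ sw) => [i|i l].
  apply: smooth_famD => //; first exact: smooth_fam_cst.
  apply: smooth_famM => //; first exact: smooth_fam_cst.
  apply: smooth_fam_primitive => //.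
  exact: (smooth_fam_comp oW (sV i) flow_locally_in IH).
apply: smooth_famM => //; first exact: smooth_fam_flow_time.
exact: (smooth_fam_comp oW (smooth_on_partial l (sV i)) flow_locally_in IH).
Qed.

Lemma clampK s : clamp (clamp s) = clamp s :> R.
Proof. exact/clamp_id/clamp_itv. Qed.

Lemma clamp0 : clamp 0 = 0 :> R.
Proof. by apply: clamp_id; rewrite lexx ler01. Qed.

Lemma flow_clamp x s j : W x -> u j x (clamp s) = u j x s.
Proof. by move=> /uP[_ _ Ex]; rewrite !Ex /primitive clampK. Qed.

Lemma flow0 x j : W x -> u j x 0 = x 0 j.
Proof. by move=> /uP[_ _ Ex]; rewrite Ex primitive0 mulr0 addr0. Qed.

(** Along the vector field itself the variation of the flow is explicit: both
    sides solve the same linear equation. *)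
Lemma flow_variation_along (w : 'I_n -> 'I_n -> 'rV[R]_n -> R -> R) x :
  (forall k, lin_solution W (flow_inhom k) flow_lin (w k)) -> W x -> V i0 x = 1 ->
  forall j s, \sum_k V k x * w k j x s = (1 - clamp s) * V j (row_fam u x s).
Proof.
move=> sw Wx V1; have [cx bx Ex] := uP Wx.
have cc (a : R) : continuous (fun _ : R => a) by move=> s; exact: cvg_cst.
have cD i l : continuous (fun s => partial l (V i) (row_fam u x s)).
  by have [] := tame_partial_flow i l Wx.
have cB i l : continuous (at_pt2 flow_lin x i l) by exact: continuousM_fam.
have cV i : continuous (fun s => V i (row_fam u x s)) by exact: flow_V_continuous.
have cw k i : continuous (w k i x) by have [+ _ _] := sw k x Wx.
have c1c : continuous (fun s : R => 1 - clamp s).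
  by apply: continuousB_fam => //; exact: clamp_continuous.
have cz i : continuous (fun s => (1 - clamp s) * V i (row_fam u x s)).
  exact: continuousM_fam.
apply: (@lin_unique R n (at_pt2 flow_lin x)
  (fun j s => V j x - primitive (fun t => V j (row_fam u x t)) s)
  (fun j s => \sum_k V k x * w k j x s)
  (fun j s => (1 - clamp s) * V j (row_fam u x s))) => //.
- exact: flow_small.
- by move=> i; apply: continuous_fam_sum => k; exact: continuousM_fam.
- move=> i; have /choice[C HC] : forall k, exists C, 0 <= C /\
      forall s, `|V k x * w k i x s| <= C.
    move=> k; have [_ bw _] := sw k x Wx; have [C C0 HC] := bw i.
    exists (`|V k x| * C); split; first by rewrite mulr_ge0.
    by move=> s; rewrite normrM ler_wpM2l.
  exists (\sum_k C k); first by apply: sumr_ge0 => k _; exact: (HC k).1.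
  move=> s; rewrite (le_trans (ler_norm_sum _ _ _))// ler_sum// => k _.
  exact: (HC k).2.
- move=> i; exists M => // s; have /andP[s0 s1] := clamp_itv s.
  rewrite normrM ger0_norm ?subr_ge0// -[leRHS]mul1r ler_pM ?subr_ge0//.
    by rewrite lerBlDl lerDr.
  by apply: VM; exact: flow_ball.
- move=> i s; rewrite (eq_bigr (fun k => V k x * flow_inhom k i x s +
      V k x * lin_op (at_pt2 flow_lin x) (at_pt (w k) x) i s)); last first.
    by move=> k _; have [_ _ ->] := sw k x Wx; rewrite mulrDr.
  rewrite big_split/=; congr (_ + _).
    rewrite /flow_inhom; set P := primitive _ s.
    under eq_bigr do rewrite mulrDr mulrA.
    rewrite big_split/= -mulr_suml; congr (_ + _).
      rewrite (bigD1 i)//= eqxx mulr1 big1 ?addr0// => k ki.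
      by rewrite eq_sym (negbTE ki) mulr0.
    rewrite (bigD1 i0)//= eqxx V1 mul1r big1 ?addr0 ?mulN1r// => k ki.
    by rewrite (negbTE ki) oppr0 mulr0.
  have cL k := lin_continuous cB (cw k) i.
  transitivity (primitive (fun t => \sum_k V k x *
      \sum_l at_pt2 flow_lin x i l t * at_pt (w k) x l t) s).
    rewrite primitive_sum; last by move=> k; apply: continuousM_fam => //; exact: cL.
    by apply: eq_bigr => k _; rewrite primitiveZ//; exact: cL.
  congr (primitive _ s); apply/funext => t.
  under eq_bigr do rewrite mulr_sumr.
  rewrite exchange_big/=; apply: eq_bigr => l _; rewrite mulr_sumr.
  by apply: eq_bigr => k _; rewrite /at_pt mulrCA.
- move=> i s.
  have cL : continuous (fun t => \sum_l at_pt2 flow_lin x i l t *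
      ((1 - clamp t) * V l (row_fam u x t))) by exact: (lin_continuous cB cz i).
  rewrite /lin_op -addrA (addrC (- _)) -primitiveB//.
  suff -> : primitive (fun t => \sum_l at_pt2 flow_lin x i l t *
      ((1 - clamp t) * V l (row_fam u x t)) - V i (row_fam u x t)) s =
      (1 - clamp (clamp s)) * V i (row_fam u x (clamp s)) -
      (1 - clamp 0) * V i (row_fam u x 0).
    have -> : row_fam u x (clamp s) = row_fam u x s.
      by apply/rowP => j; rewrite !mxE flow_clamp.
    have -> : row_fam u x 0 = x by apply/rowP => j; rewrite !mxE flow0.
    by rewrite clampK clamp0 subr0 mul1r addrC subrK.
  apply: (primitive_eq (phi := fun t => (1 - clamp t) * V i (row_fam u x t))) => //.
    exact: continuousB_fam.
  move=> t t01.
  have du j : is_derive t 1 (u j x) (c x * V j (row_fam u x t)).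
    have dP := primitive_derive (cV j) t01.
    have -> : u j x = (fun s => x 0 j + c x * primitive (fun t => V j (row_fam u x t)) s).
      by apply/funext => s'; rewrite Ex.
    rewrite -[X in is_derive _ _ _ X]add0r.
    apply: is_deriveD; exact: is_deriveZ.
  have dV := is_derive_curve oO (sV i) (rhoO (flow_ball t Wx)) du.
  have dc : is_derive t 1 (fun t : R => 1 - clamp t) (-1).
    apply: near_eq_is_derive (_ : is_derive t 1 (fun t : R => 1 - t) (-1)).
      have /andP[t0 t1] := t01.
      near=> s'; rewrite clamp_id//; apply/andP; split; apply: ltW.
        by near: s'; exact: lt_nbhsr.
      by near: s'; exact: lt_nbhsl.
    by rewrite -[X in is_derive _ _ _ X]sub0r; apply: is_deriveB.
  have dM := is_deriveM dc dV; refine (is_derive_eq dM _).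
  rewrite clamp_id ?ltW ?(andP t01).1 ?(andP t01).2//.
  rewrite scalerN [_ *: _]mulrC [_%:A]mulr1 mulr_suml; congr (_ - _).
  apply: eq_bigr => l _; rewrite /at_pt2 /flow_lin /row_fam.
  by move: (partial l _ _) (V l _) => d v; ring.
Unshelve. all: by end_near. Qed.

End Flow.

(** Near a point where one component of the field is 1 the equation X f = 0 is
    solved by flowing back to a coordinate hyperplane; at the point itself the
    differentials of the solutions span the annihilator of the field. *)
Theorem first_integrals {R : realType} {n : nat} (O : set 'rV[R]_n)
    (V : 'I_n -> 'rV[R]_n -> R) (p : 'rV[R]_n) (i0 : 'I_n) :
  open O -> (forall j, smooth_on O (V j)) -> O p -> (forall x, O x -> V i0 x = 1) ->
  exists (W : set 'rV[R]_n) (F : 'I_n -> 'rV[R]_n -> R),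
    [/\ open W /\ W `<=` O, W p, forall j, smooth_on W (F j),
      forall j x, W x -> \sum_k V k x * partial k (F j) x = 0 &
      forall j k, partial k (F j) p = (j == k)%:R - (k == i0)%:R * V j p].
Proof.
move=> oO sV Op V1; have [rho rho0 rhoO] := open_ball_in oO Op.
have /choice[M HM] : forall j, exists C, 0 <= C /\
    forall x, `|x - p| <= rho -> `|V j x| <= C.
  by move=> j; have [C C0 HC] := smooth_bounded (sV j) rhoO; exists C.
have /choice[L HL] : forall j, exists C, 0 <= C /\ forall a b,
    `|a - p| <= rho -> `|b - p| <= rho -> `|V j b - V j a| <= C * `|b - a|.
  by move=> j; have [C C0 HC] := smooth_lipschitz (sV j) rhoO; exists C.
have /choice[D HD] : forall jl : 'I_n * 'I_n, exists C, 0 <= C /\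
    forall x, `|x - p| <= rho -> `|partial jl.2 (V jl.1) x| <= C.
  move=> [j l]; have [C C0 HC] := smooth_bounded (smooth_on_partial l (sV j)) rhoO.
  by exists C.
have sum_ge (C : 'I_n -> R) j : (forall j, 0 <= C j) -> C j <= \sum_i C i.
  by move=> C0; rewrite (bigD1 j)//= lerDl sumr_ge0.
pose M' := \sum_j M j; pose L' := \sum_j L j; pose D' := \sum_jl D jl.
have M0 : 0 <= M' by apply: sumr_ge0 => j _; exact: (HM j).1.
have L0 : 0 <= L' by apply: sumr_ge0 => j _; exact: (HL j).1.
have D0 : 0 <= D' by apply: sumr_ge0 => j _; exact: (HD j).1.
have VM j x : `|x - p| <= rho -> `|V j x| <= M'.
  move=> /((HM j).2 x) /le_trans; apply; apply: sum_ge => i; exact: (HM i).1.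
have VL j a b : `|a - p| <= rho -> `|b - p| <= rho ->
    `|V j b - V j a| <= L' * `|b - a|.
  move=> ap bp; rewrite (le_trans ((HL j).2 _ _ ap bp))// ler_wpM2r//.
  by apply: sum_ge => i; exact: (HL i).1.
have VD i x : `|x - p| <= rho -> \sum_l `|partial l (V i) x| <= D'.
  move=> xp; rewrite /D' (eq_bigr (fun jl => D (jl.1, jl.2))); last by move=> [].
  rewrite -(pair_bigA _ (fun j l => D (j, l)))/=.
  apply: (@le_trans _ _ (\sum_l D (i, l))).
    by apply: ler_sum => l _; exact: (HD (i, l)).2.
  apply: (sum_ge (fun j => \sum_l D (j, l))) => j.
  by apply: sumr_ge0 => l _; exact: (HD (j, l)).1.
(* In the ball of radius r the time c is at most r, so r bounds both the length
   of the trajectories and the contraction factors. *)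
pose r := Num.min (rho / (1 + M')) (1 / (2 * (1 + L' + D'))).
have r0 : 0 < r.
  by rewrite lt_min !divr_gt0// ?mulr_gt0// -?addrA ltr_pwDl// addr_ge0.
have r_rho : r + r * M' <= rho.
  have : r <= rho / (1 + M') by rewrite ge_min lexx.
  by rewrite ler_pdivlMr ?ltr_pwDl// mulrDr mulr1.
have rLD : r * (1 + L' + D') <= 1 / 2.
  have : r <= 1 / (2 * (1 + L' + D')) by rewrite ge_min lexx orbT.
  by rewrite ler_pdivlMr; [lra|rewrite mulr_gt0// -addrA ltr_pwDl// addr_ge0].
have rL : r * L' <= 1 / 2.
  by rewrite (le_trans _ rLD)// ler_wpM2l ?(ltW r0)//; lra.
have rD : r * D' <= 1 / 2.
  by rewrite (le_trans _ rLD)// ler_wpM2l ?(ltW r0)//; lra.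
pose W := [set x : 'rV[R]_n | `|x - p| < r].
have oW : open W := flow_open.
have Wp : W p by rewrite /W/= subrr normr0.
have r_le_rho : r <= rho by rewrite (le_trans _ r_rho)// lerDl mulr_ge0// ltW.
have WO : W `<=` O by move=> x /ltW xr; apply: rhoO; exact: le_trans xr r_le_rho.
have /choice[u0 u0P] : forall x, exists u : 'I_n -> R -> R,
    W x -> flow_spec (V := V) (p := p) (i0 := i0) (rho := rho) x u.
  move=> x; have [Wx|nWx] := pselect (W x); last by exists (fun _ _ => 0).
  have [u uP] := flow_exists (i0 := i0) sV rhoO rho0 r0 M0 L0 VM VL r_rho rL Wx.
  by exists u.
pose u j x := u0 x j.
have uP x : W x -> flow_spec (V := V) (p := p) (i0 := i0) (rho := rho) x (fun i => u i x).
  exact: u0P.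
have su := flow_smooth sV rhoO rho0 M0 L0 VM VL VD rL rD uP.
have /choice[w sw] := flow_variation_exists sV rhoO rho0 M0 L0 VM VL VD rL rD uP.
have dF j k x : W x -> partial k (fun x => u j x 1) x = w k j x 1.
  move=> Wx; have dw := flow_has_partial sV rhoO rho0 M0 L0 VM VL VD rL rD uP (sw k) j Wx.
  by have [_ dE] := has_partial_derive 1 dw; exact: dE.
exists W, (fun j x => u j x 1); split=> //.
- by move=> j; exact: (smooth_fam_smooth_on 1 (fun m => su m j)).
- move=> j x Wx; rewrite (eq_bigr (fun k => V k x * w k j x 1)); last first.
    by move=> k _; rewrite dF.
  rewrite (flow_variation_along oO sV rhoO rho0 M0 L0 VM VL VD rL rD uP sw Wx (V1 x (WO x Wx))).
  by rewrite clamp_id ?lexx ?ler01// subrr mul0r.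
move=> j k; rewrite dF//; have [_ _ ->] := sw k p Wp.
have -> : lin_op (at_pt2 (flow_lin (V := V) (p := p) (i0 := i0) (u := u)) p)
    (at_pt (w k) p) j 1 = 0.
  have c0 : continuous (fun _ : R => 0 : R) by move=> s; exact: cvg_cst.
  rewrite /lin_op (_ : (fun t => _) = fun=> 0 * 0); last first.
    apply/funext => t; rewrite big1 ?mul0r// => l _.
    by rewrite /at_pt2 /flow_lin subrr !mul0r.
  by rewrite primitiveZ ?mul0r.
have [_ _ uE] := uP p Wp.
have Vc : (fun t => V j (row_fam u p t)) = fun=> V j p.
  apply/funext => t; congr (V j); apply/rowP => i.
  by rewrite mxE uE subrr mul0r addr0.
rewrite addr0 /flow_inhom Vc.
have -> : primitive (fun=> V j p) 1 = V j p.
  transitivity (clamp 1 * V j p - 0 * V j p).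
    apply: (primitive_eq (phi := fun t => t * V j p)).
    - by move=> t; exact: cvg_cst.
    - by move=> t; apply: continuousM; [exact: cvg_id|exact: cvg_cst].
    - move=> t _; have dM := is_deriveM (is_derive_id t 1) (is_derive_cst (V j p) t 1).
      refine (is_derive_eq dM _).
      by rewrite scaler0 add0r [_ *: _]mulr1.
  by rewrite mul0r subr0 clamp_id ?lexx ?ler01// mul1r.
by rewrite mulNr.
Qed.

(** * Calculus in charts *)

Section Charts.
Context {R : realType} {n : nat} {M : smoothManifold R n}.
Implicit Types (U : set M) (f h : M -> R) (p q : M) (i j : chart M) (X Y : vfield M).

Lemma coord_image i U x : (coord i @` (U `&` dom i)) x ->
  [/\ U (param i x), dom i (param i x) & coord i (param i x) = x].
Proof. by move=> [q [Uq iq] <-]; rewrite coordK. Qed.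

Lemma coord_image_mem i U q : U q -> dom i q -> (coord i @` (U `&` dom i)) (coord i q).
Proof. by move=> Uq iq; exists q. Qed.

Lemma open_coord_image i U : open U -> open (coord i @` (U `&` dom i)).
Proof.
move=> oU; rewrite openE => x [q [Uq iq] <-].
have nU : \forall y \near coord i q, U (param i y).
  have /(_ U) := param_continuous iq; rewrite coordK//; apply.
  exact: open_nbhs_nbhs.
have nD : \forall y \near coord i q, (coord i @` dom i) y.
  by apply: open_nbhs_nbhs; split; [exact: open_coord|exists q].
move: nU nD; apply: filterS2 => y Uy [q' iq' yE].
by exists q' => //; split=> //; rewrite -(coordK iq') yE.
Qed.

Arguments open_coord_image i {U} _.

Lemma open_coord_preimage i (W : set 'rV[R]_n) : open W ->
  open [set q | dom i q /\ W (coord i q)].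
Proof.
move=> oW; rewrite openE => q [iq Wq].
have n1 : \forall q' \near q, dom i q'.
  by apply: open_nbhs_nbhs; split=> //; exact: open_dom.
have n2 : \forall q' \near q, W (coord i q').
  by apply: (coord_continuous iq); exact: open_nbhs_nbhs.
by move: n1 n2; apply: filterS2.
Qed.

Lemma row_coordf i q : \row_k coordf i k q = coord i q.
Proof. by apply/rowP => k; rewrite mxE. Qed.

Lemma smooth_subset U U' f : U' `<=` U -> smooth U f -> smooth U' f.
Proof.
by move=> UU sf i; apply: smooth_on_sub (sf i); apply: image_subset; exact: setSI.
Qed.

Lemma smooth_local U f :
  (forall p, U p -> exists U', [/\ open U', U' p & smooth U' f]) -> smooth U f.
Proof.
move=> H i; apply: smooth_on_local => x [p [Up ip] <-].
have [U' [oU' U'p sf]] := H p Up; exists (coord i @` (U' `&` dom i)); last exact: sf.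
exact: coord_image_mem.
Qed.

Lemma smooth_coordf j k : smooth (dom j) (coordf j k).
Proof. by move=> i; rewrite setIC; exact: transition_smooth. Qed.
Arguments smooth_coordf : clear implicits.

(** Smoothness in one chart around each point is enough, because the other charts
    are related to it by smooth transition maps. *)
Lemma smooth_in_chart U f i : open U -> U `<=` dom i ->
  smooth_on (coord i @` (U `&` dom i)) (f \o param i) -> smooth U f.
Proof.
move=> oU Ui sf j; have oW := open_coord_image j oU.
have oV := open_coord_image i oU.
apply: (@smooth_on_eq _ _ _ (fun x => (f \o param i) (\row_k (coordf i k \o param j) x))).
- exact: oW.
- move=> x /coord_image[Ux jx xE] /=.
  by rewrite row_coordf coordK//; exact: Ui.
apply: (smooth_on_comp oW oV sf) => [k|x].
  by apply: smooth_on_sub (smooth_coordf i k j); apply: image_subset; exact: setSI.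
by move=> /coord_image[Ux jx xE] /=; rewrite row_coordf; apply: coord_image_mem => //; exact: Ui.
Qed.

Lemma smooth_eq U f h : open U -> (forall q, U q -> f q = h q) ->
  smooth U f -> smooth U h.
Proof.
move=> oU fh sf i; apply: (smooth_on_eq (open_coord_image i oU)) (sf i).
by move=> x /coord_image[Ux _ _] /=; exact: fh.
Qed.

Lemma smooth_cst U c : open U -> smooth U (fun=> c).
Proof. by move=> oU i; apply: smooth_on_cst; exact: open_coord_image. Qed.

Lemma smoothD U f h : open U -> smooth U f -> smooth U h ->
  smooth U (fun q => f q + h q).
Proof. by move=> oU sf sh i; apply: (smooth_onD (open_coord_image i oU) (sf i) (sh i)). Qed.

Lemma smoothM U f h : open U -> smooth U f -> smooth U h ->
  smooth U (fun q => f q * h q).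
Proof. by move=> oU sf sh i; apply: (smooth_onM (open_coord_image i oU) (sf i) (sh i)). Qed.

Lemma smoothV U f : open U -> (forall q, U q -> f q != 0) -> smooth U f ->
  smooth U (fun q => (f q)^-1).
Proof.
move=> oU f0 sf i; apply: (smooth_onV (open_coord_image i oU) _ (sf i)).
by move=> x /coord_image[Ux _ _]; exact: f0.
Qed.

Lemma smoothB U f h : open U -> smooth U f -> smooth U h ->
  smooth U (fun q => f q - h q).
Proof.
move=> oU sf sh.
have sN := smoothM oU (smooth_cst (-1) oU) sh.
apply: (smooth_eq oU _ (smoothD oU sf sN)) => q _.
by rewrite mulN1r.
Qed.

Lemma smooth_sum (I : Type) (r : seq I) U (f : I -> M -> R) : open U ->
  (forall k, smooth U (f k)) -> smooth U (fun q => \sum_(k <- r) f k q).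
Proof.
move=> oU sf; elim: r => [|k r IH].
  by apply: (smooth_eq oU _ (smooth_cst 0 oU)) => q _; rewrite big_nil.
by apply: (smooth_eq oU _ (smoothD oU (sf k) IH)) => q _; rewrite big_cons.
Qed.

Lemma smooth_prod (I : Type) (r : seq I) U (f : I -> M -> R) : open U ->
  (forall k, smooth U (f k)) -> smooth U (fun q => \prod_(k <- r) f k q).
Proof.
move=> oU sf; elim: r => [|k r IH].
  by apply: (smooth_eq oU _ (smooth_cst 1 oU)) => q _; rewrite big_nil.
by apply: (smooth_eq oU _ (smoothM oU (sf k) IH)) => q _; rewrite big_cons.
Qed.

Lemma smooth_det U m (A : M -> 'M[R]_m) : open U ->
  (forall k l, smooth U (fun q => A q k l)) -> smooth U (fun q => \det (A q)).
Proof.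
move=> oU sA; have sP (s : 'S_m) : smooth U (fun q => \prod_k A q k (s k)).
  by apply: (smooth_prod _ oU) => k; exact: sA.
exact (smooth_sum _ oU (fun s : 'S_m => smoothM oU (smooth_cst ((-1) ^+ s) oU) (sP s))).
Qed.

(** Cramer's rule writes the entries of the inverse as rational functions of the
    entries. *)
Lemma smooth_invmx U m (A : M -> 'M[R]_m) : open U ->
  (forall q, U q -> A q \in unitmx) ->
  (forall k l, smooth U (fun q => A q k l)) ->
  forall k l, smooth U (fun q => invmx (A q) k l).
Proof.
move=> oU uA sA k l.
have sdetV : smooth U (fun q => (\det (A q))^-1).
  apply: (smoothV oU _ (smooth_det oU sA)) => q Uq.
  by rewrite -unitfE -unitmxE uA.
have scof : smooth U (fun q => \det (row' l (col' k (A q)))).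
  apply: (smooth_det oU) => k' l'.
  apply: (smooth_eq oU _ (sA (lift l k') (lift k l'))) => q _.
  by rewrite !mxE.
apply: (smooth_eq oU _ (smoothM oU sdetV
  (smoothM oU (smooth_cst ((-1) ^+ (l + k)) oU) scof))) => q Uq.
by rewrite /invmx uA// !mxE.
Qed.

Definition dchart i k f q : R := partial k (f \o param i) (coord i q).

Lemma dchart_eq U f h i k q : open U -> (forall q, U q -> f q = h q) ->
  U q -> dom i q -> dchart i k f q = dchart i k h q.
Proof.
move=> oU fh Uq iq; apply: near_eq_derive.
have : \forall x \near coord i q, (coord i @` (U `&` dom i)) x.
  by apply: open_nbhs_nbhs; split; [exact: open_coord_image|exact: coord_image_mem].
by apply: filterS => x /coord_image[Ux _ _] /=; exact: fh.
Qed.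

Lemma dchart_derivable U f i k q : smooth U f -> U q -> dom i q ->
  derivable (f \o param i) (coord i q) (basis_vec k).
Proof.
by move=> sf Uq iq; apply: (smooth_on_derivable (sf i)); exact: coord_image_mem.
Qed.

Lemma dchartD U f h i k q : smooth U f -> smooth U h -> U q -> dom i q ->
  dchart i k (fun q => f q + h q) q = dchart i k f q + dchart i k h q.
Proof.
by move=> sf sh Uq iq; apply: deriveD; exact: dchart_derivable Uq iq.
Qed.

Lemma dchartM U f h i k q : smooth U f -> smooth U h -> U q -> dom i q ->
  dchart i k (fun q => f q * h q) q = f q * dchart i k h q + h q * dchart i k f q.
Proof.
move=> sf sh Uq iq.
have := deriveM (dchart_derivable (k := k) sf Uq iq) (dchart_derivable (k := k) sh Uq iq).
by rewrite /= coordK.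
Qed.

Lemma dchart_cst c i k q : dchart i k (fun=> c) q = 0.
Proof. exact: derive_cst. Qed.

Lemma dchart_sum (I : Type) (r : seq I) U (f : I -> M -> R) i k q : open U ->
  (forall l, smooth U (f l)) -> U q -> dom i q ->
  dchart i k (fun q => \sum_(l <- r) f l q) q = \sum_(l <- r) dchart i k (f l) q.
Proof.
move=> oU sf Uq iq; elim: r => [|l r IH].
  rewrite big_nil (@dchart_eq U _ (fun=> 0)) ?dchart_cst// => q' _.
  by rewrite big_nil.
rewrite big_cons -IH -(dchartD k (sf l) (smooth_sum r oU sf) Uq iq).
by apply: (dchart_eq k oU _ Uq iq) => q' _; rewrite big_cons.
Qed.

Lemma dchart_coordf i k l q : dom i q -> dchart i l (coordf i k) q = (k == l)%:R.
Proof.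
move=> iq; transitivity (partial l (fun x : 'rV[R]_n => x 0 k) (coord i q)).
  apply: near_eq_derive.
  have : \forall x \near coord i q, (coord i @` (dom i `&` dom i)) x.
    apply: open_nbhs_nbhs; split; last exact: coord_image_mem.
    by apply: open_coord_image; exact: open_dom.
  by apply: filterS => x /coord_image[_ _ xE] /=; rewrite /coordf xE.
have /(has_partial_derive 0)[_] : has_partial l (fun x (_ : R) => x 0 k)
    (coord i q) (fun=> (k == l)%:R); last by [].
apply: (uniformO_eq (uniformO0 2)); near=> h => s.
by rewrite !mxE eqxx/=; ring.
Unshelve. all: by end_near. Qed.

(** Chain rule for the transition map from the chart i to the chart j. *)
Lemma dchart_change U f i j l q : open U -> smooth U f -> U q -> dom i q -> dom j q ->
  dchart i l f q = \sum_k dchart i l (coordf j k) q * dchart j k f q.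
Proof.
move=> oU sf Uq iq jq.
have oUi : open (U `&` dom i) by apply: openI => //; exact: open_dom.
have oUj : open (U `&` dom j) by apply: openI => //; exact: open_dom.
have oW := open_coord_image i oUj; have oV := open_coord_image j oUi.
have sV : smooth_on (coord j @` (U `&` dom i `&` dom j)) (f \o param j).
  by apply: smooth_on_sub (sf j); apply: image_subset; apply: setSI; exact: subIsetl.
have sphi k : smooth_on (coord i @` (U `&` dom j `&` dom i)) (coordf j k \o param i).
  apply: smooth_on_sub (smooth_coordf j k i); apply: image_subset.
  by apply: setSI; exact: subIsetr.
have phiV x : (coord i @` (U `&` dom j `&` dom i)) x ->
    (coord j @` (U `&` dom i `&` dom j)) (\row_k (coordf j k \o param i) x).
  move=> /coord_image[[Ux jx] ix xE]; rewrite [X in (_ @` _) X]row_coordf.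
  exact: coord_image_mem.
have Wq : (coord i @` (U `&` dom j `&` dom i)) (coord i q) by exact: coord_image_mem.
transitivity (partial l (fun x => (f \o param j) (\row_k (coordf j k \o param i) x)) (coord i q)).
  apply: near_eq_derive; have := open_nbhs_nbhs (conj oW Wq).
  apply: filterS => x /coord_image[[Ux jx] ix xE] /=.
  by rewrite row_coordf coordK.
rewrite (partial_comp l oW oV sV sphi phiV Wq); apply: eq_bigr => k _.
by rewrite row_coordf /= coordK.
Qed.

Lemma smooth_dchart U f i l : open U -> U `<=` dom i -> smooth U f ->
  smooth U (dchart i l f).
Proof.
move=> oU Ui sf; apply: (smooth_in_chart oU Ui).
apply: (smooth_on_eq (open_coord_image i oU)) (smooth_on_partial l (sf i)).
by move=> x /coord_image[_ _ xE] /=; rewrite /dchart xE.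
Qed.

Lemma dchartC U f i k l q : open U -> smooth U f -> U q -> dom i q ->
  dchart i k (dchart i l f) q = dchart i l (dchart i k f) q.
Proof.
move=> oU sf Uq iq; have oW := open_coord_image i oU.
have Wq := coord_image_mem Uq iq.
have E m m' : dchart i m (dchart i m' f) q =
    partial m (partial m' (f \o param i)) (coord i q).
  apply: near_eq_derive; have := open_nbhs_nbhs (conj oW Wq).
  by apply: filterS => x /coord_image[_ _ xE] /=; rewrite /dchart xE.
by rewrite !E; apply: (partialC _ _ oW Wq); exact: sf.
Qed.

Lemma vactE X f q : vact X f q = \sum_k X q 0 k * dchart (chart_at q) k f q.
Proof. by apply: eq_bigr => k _; rewrite mxE. Qed.

End Charts.

Arguments smooth_coordf {R n M} j k.
Arguments open_coord_image {R n M} i {U} _.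

(** * Vector fields in charts *)

Section Fields.
Context {R : realType} {n : nat} {M : smoothManifold R n}.
Implicit Types (U : set M) (f h : M -> R) (p q : M) (i j : chart M) (X Y Z : vfield M).

(** Tangent vectors are named by a chart that jumps from point to point; this
    formula expresses the derivation X in one fixed chart, where its coefficients
    are smooth. *)
Lemma vact_chart U X f i q : open U -> smooth U f -> U q -> dom i q ->
  vact X f q = \sum_k vact X (coordf i k) q * dchart i k f q.
Proof.
move=> oU sf Uq iq; have cq := dom_chart_at q.
rewrite vactE; under eq_bigr do rewrite (dchart_change _ oU sf Uq cq iq) mulr_sumr.
rewrite exchange_big/=; apply: eq_bigr => k _; rewrite vactE mulr_suml.
by apply: eq_bigr => l _; rewrite mulrA.
Qed.

Lemma vact_coordf X p k : vact X (coordf (chart_at p) k) p = X p 0 k.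
Proof.
rewrite vactE (bigD1 k)//= dchart_coordf; last exact: dom_chart_at.
rewrite eqxx mulr1 big1 ?addr0// => l lk.
by rewrite dchart_coordf; [rewrite eq_sym (negbTE lk) mulr0|exact: dom_chart_at].
Qed.

Lemma vact_eq U X f h p : open U -> (forall q, U q -> f q = h q) -> U p ->
  vact X f p = vact X h p.
Proof.
move=> oU fh Up; rewrite !vactE; apply: eq_bigr => k _.
by rewrite (dchart_eq k oU fh Up (dom_chart_at p)).
Qed.

Lemma vact_cst X c p : vact X (fun=> c) p = 0.
Proof. by rewrite vactE big1// => k _; rewrite dchart_cst mulr0. Qed.

Lemma vactD U X f h p : smooth U f -> smooth U h -> U p ->
  vact X (fun q => f q + h q) p = vact X f p + vact X h p.
Proof.
move=> sf sh Up; rewrite !vactE -big_split/=; apply: eq_bigr => k _.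
by rewrite (dchartD k sf sh Up (dom_chart_at p)) mulrDr.
Qed.

Lemma vactM U X f h p : smooth U f -> smooth U h -> U p ->
  vact X (fun q => f q * h q) p = f p * vact X h p + h p * vact X f p.
Proof.
move=> sf sh Up; rewrite !vactE !mulr_sumr -big_split/=; apply: eq_bigr => k _.
rewrite (dchartM k sf sh Up (dom_chart_at p)) mulrDr.
by congr (_ + _); exact: mulrCA.
Qed.

Lemma vact_sum (I : Type) (r : seq I) U X (f : I -> M -> R) p : open U ->
  (forall k, smooth U (f k)) -> U p ->
  vact X (fun q => \sum_(k <- r) f k q) p = \sum_(k <- r) vact X (f k) p.
Proof.
move=> oU sf Up; elim: r => [|k r IH].
  rewrite big_nil (vact_eq X (h := fun=> 0) oU _ Up) ?vact_cst// => q _.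
  by rewrite big_nil.
rewrite big_cons -IH -(vactD X (sf k) (smooth_sum r oU sf) Up).
by apply: (vact_eq X oU _ Up) => q _; rewrite big_cons.
Qed.

Lemma smooth_setIl U U' f : smooth U f -> smooth (U `&` U') f.
Proof. by move=> sf; exact (smooth_subset (@subIsetl _ U U') sf). Qed.

Lemma smooth_setIr U U' f : smooth U' f -> smooth (U `&` U') f.
Proof. by move=> sf; exact (smooth_subset (@subIsetr _ U U') sf). Qed.

Lemma open_dom_setI U i : open U -> open (U `&` dom i).
Proof. by move=> oU; apply: openI => //; exact: open_dom. Qed.
Arguments open_dom_setI {U} i _.

Lemma smooth_vfield_sub U U' X : U' `<=` U -> smooth_vfield U X -> smooth_vfield U' X.
Proof.
by move=> UU sX i k; exact (smooth_subset (@setSI _ (dom i) _ _ UU) (sX i k)).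
Qed.

Lemma smooth_vact_chart U X f i : open U -> U `<=` dom i ->
  (forall k, smooth U (vact X (coordf i k))) -> smooth U f -> smooth U (vact X f).
Proof.
move=> oU Ui sX sf.
have sS := smooth_sum (index_enum 'I_n) oU
  (fun k => smoothM oU (sX k) (smooth_dchart k oU Ui sf)).
apply: (smooth_eq oU _ sS) => q Uq.
by rewrite -(vact_chart X oU sf Uq (Ui _ Uq)).
Qed.

Lemma smooth_vact U X f : open U -> smooth_vfield U X -> smooth U f ->
  smooth U (vact X f).
Proof.
move=> oU sX sf; apply: smooth_local => p Up.
have oU' := open_dom_setI (chart_at p) oU.
exists (U `&` dom (chart_at p)); split=> //; first by split=> //; exact: dom_chart_at.
apply: (smooth_vact_chart oU' (i := chart_at p)); first exact: subIsetr.
  by move=> k; exact: sX.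
exact (smooth_setIl sf).
Qed.

Lemma smooth_vfield_local U X :
  (forall p, U p -> exists U' i, [/\ open U', U' p, U' `<=` dom i &
     forall k, smooth U' (vact X (coordf i k))]) -> smooth_vfield U X.
Proof.
move=> H j k; apply: smooth_local => p [Up jp].
have [U' [i [oU' U'p U'i sX]]] := H p Up.
have oV := open_dom_setI j oU'.
exists (U' `&` dom j); split=> //.
apply: (smooth_vact_chart oV (i := i)).
- by move=> q [/U'i].
- by move=> l; exact (smooth_setIl (sX l)).
exact (smooth_setIr (smooth_coordf j k)).
Qed.

(** The field with constant components v in the chart i. *)
Definition chart_field i (v : 'rV[R]_n) : vfield M := fun q =>
  \row_k \sum_l v 0 l * dchart i l (coordf (chart_at q) k) q.

Lemma vact_chart_field U i v f q : open U -> smooth U f -> U q -> dom i q ->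
  vact (chart_field i v) f q = \sum_l v 0 l * dchart i l f q.
Proof.
move=> oU sf Uq iq; have cq := dom_chart_at q.
rewrite vactE; under [RHS]eq_bigr do rewrite (dchart_change _ oU sf Uq iq cq) mulr_sumr.
rewrite exchange_big/=; apply: eq_bigr => k _; rewrite mxE mulr_suml.
by apply: eq_bigr => l _; rewrite mulrA.
Qed.

Lemma chart_field_comp i v k q : dom i q -> vact (chart_field i v) (coordf i k) q = v 0 k.
Proof.
move=> iq; rewrite (vact_chart_field v (open_dom i) (smooth_coordf i k) iq iq).
rewrite (bigD1 k)//= dchart_coordf// eqxx mulr1 big1 ?addr0// => l lk.
by rewrite dchart_coordf// eq_sym (negbTE lk) mulr0.
Qed.

Lemma smooth_chart_field i v : smooth_vfield (dom i) (chart_field i v).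
Proof.
apply: smooth_vfield_local => p ip; exists (dom i), i; split=> //; first exact: open_dom.
move=> k; apply: (smooth_eq (open_dom i) _ (smooth_cst (v 0 k) (open_dom i))) => q iq.
by rewrite chart_field_comp.
Qed.

Lemma chart_field_at p v : chart_field (chart_at p) v p = v.
Proof.
apply/rowP => k; rewrite -(vact_coordf (chart_field (chart_at p) v)).
by rewrite chart_field_comp//; exact: dom_chart_at.
Qed.

Lemma chart_field_comp_row i X q : dom i q ->
  X q = chart_field i (\row_k vact X (coordf i k) q) q.
Proof.
move=> iq; apply/rowP => m; rewrite mxE -vact_coordf.
rewrite (vact_chart X (open_dom _) (smooth_coordf _ m) (dom_chart_at q) iq).
by apply: eq_bigr => l _; rewrite mxE.
Qed.

Lemma chart_field_sum i v q :
  chart_field i v q = \sum_l v 0 l *: chart_field i (delta_mx 0 l) q.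
Proof.
apply/rowP => k; rewrite mxE summxE; apply: eq_bigr => l _; rewrite !mxE.
congr (_ * _); rewrite (bigD1 l)//= mxE !eqxx mul1r big1 ?addr0// => l' ll.
by rewrite mxE (negbTE ll) andbF mul0r.
Qed.

(** The Lie bracket is the commutator of derivations: the second-order terms
    cancel by the symmetry of second partial derivatives. *)
Lemma vact_bracket U X Y f p : open U -> smooth_vfield U X -> smooth_vfield U Y ->
  smooth U f -> U p ->
  vact (bracket X Y) f p = vact X (vact Y f) p - vact Y (vact X f) p.
Proof.
move=> oU sX sY sf Up; set c := chart_at p; have cp : dom c p := dom_chart_at p.
have oU' := open_dom_setI c oU; have U'p : (U `&` dom c) p by [].
have sf' : smooth (U `&` dom c) f := smooth_setIl sf.
have sdf k : smooth (U `&` dom c) (dchart c k f).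
  exact (smooth_dchart k oU' (@subIsetr _ U (dom c)) sf').
have act Z : smooth_vfield U Z -> forall Z', vact Z' (vact Z f) p =
    \sum_k (vact Z (coordf c k) p * \sum_l Z' p 0 l * dchart c l (dchart c k f) p
            + dchart c k f p * vact Z' (vact Z (coordf c k)) p).
  move=> sZ Z'.
  rewrite (vact_eq Z' (h := fun q => \sum_k vact Z (coordf c k) q * dchart c k f q) oU' _ U'p);
    last by move=> q [Uq cq]; exact: (vact_chart Z oU sf Uq cq).
  have sM k := smoothM oU' (sZ c k) (sdf k).
  rewrite (vact_sum _ Z' oU' sM U'p); apply: eq_bigr => k _.
  by rewrite (vactM Z' (sZ c k) (sdf k) U'p) -vactE.
rewrite (act Y sY X) (act X sX Y) !big_split/= opprD addrACA.
have -> : \sum_k vact Y (coordf c k) p * (\sum_l X p 0 l * dchart c l (dchart c k f) p) -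
    \sum_k vact X (coordf c k) p * (\sum_l Y p 0 l * dchart c l (dchart c k f) p) = 0.
  apply/eqP; rewrite subr_eq0; apply/eqP.
  under eq_bigr do rewrite mulr_sumr; under [RHS]eq_bigr do rewrite mulr_sumr.
  rewrite exchange_big/=; apply: eq_bigr => k _; apply: eq_bigr => l _.
  by rewrite !vact_coordf (dchartC k l oU' sf' U'p cp) mulrCA.
rewrite add0r vactE -sumrB; apply: eq_bigr => k _.
by rewrite mxE -mulrBr mulrC.
Qed.

Lemma smooth_bracket U X Y : open U -> smooth_vfield U X -> smooth_vfield U Y ->
  smooth_vfield U (bracket X Y).
Proof.
move=> oU sX sY i k; have oU' := open_dom_setI i oU.
have sub W : smooth_vfield U W -> smooth_vfield (U `&` dom i) W.
  by apply: smooth_vfield_sub; exact: subIsetl.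
have sc : smooth (U `&` dom i) (coordf i k).
  exact (smooth_setIr (smooth_coordf i k)).
apply: (smooth_eq oU' _ (smoothB oU' (smooth_vact oU' (sub _ sX) (smooth_vact oU' (sub _ sY) sc))
  (smooth_vact oU' (sub _ sY) (smooth_vact oU' (sub _ sX) sc)))) => q Uq.
by rewrite (vact_bracket oU' (sub _ sX) (sub _ sY) sc Uq).
Qed.

End Fields.

Arguments smooth_chart_field {R n M} i v.
Arguments open_dom_setI {R n M U} i _.

(** * The metric, gradients and the Lie derivative of the metric *)

Section Metric.
Context {R : realType} {n : nat} {M : smoothManifold R n}.
Implicit Types (U : set M) (f h : M -> R) (p q : M) (i : chart M) (X Y Z : vfield M).
Implicit Types (A : 'M[R]_n) (v w : 'rV[R]_n) (g : riemannianMetric M).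

Lemma mx_formDl A v v' w : mx_form A (v + v') w = mx_form A v w + mx_form A v' w.
Proof. by rewrite /mx_form !mulmxDl mxE. Qed.

Lemma mx_formZl A a v w : mx_form A (a *: v) w = a * mx_form A v w.
Proof. by rewrite /mx_form -!scalemxAl mxE. Qed.

Lemma mx_formDr A v w w' : mx_form A v (w + w') = mx_form A v w + mx_form A v w'.
Proof. by rewrite /mx_form linearD mulmxDr mxE. Qed.

Lemma mx_formZr A a v w : mx_form A v (a *: w) = a * mx_form A v w.
Proof. by rewrite /mx_form linearZ -scalemxAr mxE. Qed.

Lemma mx_formNl A v w : mx_form A (- v) w = - mx_form A v w.
Proof. by rewrite -scaleN1r mx_formZl mulN1r. Qed.

Lemma mx_formNr A v w : mx_form A v (- w) = - mx_form A v w.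
Proof. by rewrite -scaleN1r mx_formZr mulN1r. Qed.

Lemma mx_form_suml A (I : Type) (r : seq I) (F : I -> 'rV[R]_n) w :
  mx_form A (\sum_(k <- r) F k) w = \sum_(k <- r) mx_form A (F k) w.
Proof. by rewrite /mx_form !mulmx_suml summxE. Qed.

Lemma mx_form_sumr A (I : Type) (r : seq I) (F : I -> 'rV[R]_n) v :
  mx_form A v (\sum_(k <- r) F k) = \sum_(k <- r) mx_form A v (F k).
Proof. by rewrite /mx_form linear_sum mulmx_sumr summxE. Qed.

Lemma mx_form_entries A v w :
  mx_form A v w = \sum_l v 0 l * \sum_m w 0 m * A l m.
Proof.
rewrite /mx_form -mulmxA mxE; apply: eq_bigr => l _; congr (_ * _).
by rewrite mxE; apply: eq_bigr => m _; rewrite mxE mulrC.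
Qed.

Lemma definite_unitmx A : (forall v, v != 0 -> mx_form A v v != 0) -> A \in unitmx.
Proof.
move=> H; rewrite -row_free_unit -kermx_eq0; apply/rowV0P => v /sub_kermxP vA.
apply/eqP; apply/negP => /negP /H; rewrite /mx_form vA mul0mx mxE.
by rewrite eqxx.
Qed.

Lemma metric_nondegenerate g p v : (forall w, mx_form (metric g p) v w = 0) -> v = 0.
Proof.
move=> H; apply/eqP; apply/negP => /negP /(metric_posdef g p).
by rewrite H ltxx.
Qed.

Definition gram g i q : 'M[R]_n := \matrix_(l, m)
  inner g (chart_field i (delta_mx 0 l)) (chart_field i (delta_mx 0 m)) q.

Lemma gram_form g i q v w :
  mx_form (gram g i q) v w = inner g (chart_field i v) (chart_field i w) q.
Proof.
rewrite mx_form_entries /inner (chart_field_sum i v) (chart_field_sum i w).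
rewrite mx_form_suml; apply: eq_bigr => l _.
rewrite mx_formZl mx_form_sumr; congr (_ * _); apply: eq_bigr => m _.
by rewrite mx_formZr mxE.
Qed.

Lemma gram_unit g i q : dom i q -> gram g i q \in unitmx.
Proof.
move=> iq; apply: definite_unitmx => v v0; rewrite gram_form /inner gt_eqF//.
apply: metric_posdef; apply: contra v0 => /eqP E; apply/eqP/rowP => k.
rewrite -(chart_field_comp v k iq) vactE big1 ?mxE// => l _.
by rewrite E mxE mul0r.
Qed.

Lemma smooth_gram g i l m : smooth (dom i) (fun q => gram g i q l m).
Proof.
have sG := metric_smooth g (open_dom i) (smooth_chart_field i (delta_mx 0 l))
  (smooth_chart_field i (delta_mx 0 m)).
by apply: (smooth_eq (open_dom i) _ sG) => q _; rewrite mxE.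
Qed.

Arguments smooth_gram g i l m : clear implicits.

Lemma inner_gradient g f X p : inner g (gradient g f) X p = vact X f p.
Proof. by rewrite /inner ((gradientP g f p _).2 erefl). Qed.

(** In a chart, the components of the gradient are those of the differential
    multiplied by the inverse Gram matrix of the coordinate fields. *)
Lemma smooth_gradient g U f : open U -> smooth U f -> smooth_vfield U (gradient g f).
Proof.
move=> oU sf; apply: smooth_vfield_local => p Up; set i := chart_at p.
have oU' := open_dom_setI i oU; exists (U `&` dom i), i.
split; [exact: oU'|by split=> //; exact: dom_chart_at|exact (@subIsetr _ U (dom i))|].
have sf' : smooth (U `&` dom i) f := smooth_setIl sf.
have sI := smooth_invmx oU' (A := gram g i)
  (fun q Uq => gram_unit g Uq.2)
  (fun l m => smooth_subset (@subIsetr _ U (dom i)) (smooth_gram g i l m)).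
move=> k; have sS := smooth_sum (index_enum 'I_n) oU' (fun m => smoothM oU'
  (smooth_dchart m oU' (@subIsetr _ U (dom i)) sf') (sI m k)).
apply: (smooth_eq oU' _ sS) => q [Uq iq].
pose a : 'rV[R]_n := \row_k vact (gradient g f) (coordf i k) q.
pose b : 'rV[R]_n := \row_m dchart i m f q.
have aE : a *m gram g i q = b.
  apply/rowP => m; rewrite [RHS]mxE.
  have := gram_form g i q a (delta_mx 0 m).
  rewrite /inner -(chart_field_comp_row (gradient g f) iq) => E.
  have := inner_gradient g f (chart_field i (delta_mx 0 m)) q.
  rewrite /inner -E (vact_chart_field _ oU sf Uq iq) => E'.
  transitivity (mx_form (gram g i q) a (delta_mx 0 m)).
    by rewrite /mx_form trmx_delta -colE [RHS]mxE.
  rewrite E' (bigD1 m)//= mxE !eqxx mul1r big1 ?addr0// => l lm.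
  by rewrite mxE (negbTE lm) andbF mul0r.
have -> : vact (gradient g f) (coordf i k) q = a 0 k by rewrite mxE.
have -> : a = b *m invmx (gram g i q) by rewrite -aE mulmxK// gram_unit.
by rewrite mxE; apply: eq_bigr => m _; rewrite mxE.
Qed.

(** Since g(grad f, Z) = Z f, the Lie derivative is
    X(Z f) - g([X, grad f], Z) - [X, Z] f, and X(Z f) - [X, Z] f = Z(X f) = 0. *)
Lemma lie_metric_gradient g U X Z f p : open U -> smooth_vfield U X ->
  smooth_vfield U Z -> smooth U f -> (forall q, U q -> vact X f q = 0) -> U p ->
  lie_metric g X (gradient g f) Z p = - inner g (bracket X (gradient g f)) Z p.
Proof.
move=> oU sX sZ sf Xf Up; rewrite /lie_metric inner_gradient.
rewrite (vact_eq X (h := vact Z f) oU _ Up); last by move=> q _; exact: inner_gradient.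
rewrite (vact_bracket oU sX sZ sf Up) (vact_eq Z (h := fun=> 0) oU Xf Up) vact_cst.
by rewrite subr0 addrAC subrr add0r.
Qed.

End Metric.

(** * The Killing form of a vector field *)

Section LinearAlgebra.
Context {R : realType} {n : nat}.
Implicit Types (A G S : 'M[R]_n) (v w xi : 'rV[R]_n).

Lemma mx_form_delta A l m : mx_form A (delta_mx 0 l) (delta_mx 0 m) = A l m.
Proof. by rewrite /mx_form trmx_delta -rowE -colE !mxE. Qed.

Lemma mx_form_inj A S : (forall v w, mx_form A v w = mx_form S v w) -> A = S.
Proof. by move=> H; apply/matrixP => l m; rewrite -!mx_form_delta. Qed.

Definition symmetrized G A : 'M[R]_n := A *m G + G *m A^T.

Lemma symmetrized_form G A v w :
  mx_form (symmetrized G A) v w = mx_form G (v *m A) w + mx_form G v (w *m A).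
Proof.
by rewrite /mx_form /symmetrized mulmxDr mulmxDl mxE trmx_mul !mulmxA.
Qed.

Lemma symmetrized_trace G A : G \in unitmx ->
  \tr (symmetrized G A *m invmx G) = \tr A + \tr A.
Proof.
move=> uG; rewrite /symmetrized mulmxDl linearD/= mulmxK//; congr (_ + _).
by rewrite mxtrace_mulC mulmxA mulVmx// mul1mx mxtrace_tr.
Qed.

(** A symmetric form that kills the orthogonal complement of a vector is a
    multiple of the square of the dual covector; its trace detects the factor. *)
Lemma symmetrized_eq0 G A xi :
  (forall v w, mx_form G v w = mx_form G w v) -> 0 < mx_form G xi xi ->
  G \in unitmx -> \tr A = 0 ->
  (forall v, mx_form G v xi = 0 -> forall w, mx_form (symmetrized G A) v w = 0) ->
  symmetrized G A = 0.
Proof.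
move=> symG c0 uG trA H; set c := mx_form G xi xi in c0 *.
set S := symmetrized G A in H *.
have symS v w : mx_form S v w = mx_form S w v.
  rewrite !symmetrized_form addrC; congr (_ + _); exact: symG.
have proj v w : mx_form S v w = mx_form G v xi / c * mx_form S xi w.
  have : mx_form S (v - (mx_form G v xi / c) *: xi) w = 0.
    apply: H; rewrite mx_formDl mx_formNl mx_formZl -/c divfK ?subrr//.
    exact: lt0r_neq0.
  by rewrite mx_formDl mx_formNl mx_formZl => /eqP; rewrite subr_eq0 => /eqP.
pose k := mx_form S xi xi / c ^+ 2.
have SE : S = k *: ((G *m xi^T) *m (xi *m G)).
  apply: mx_form_inj => v w; rewrite proj symS proj -/c.
  have -> : mx_form (k *: ((G *m xi^T) *m (xi *m G))) v w =
      k * (mx_form G v xi * mx_form G xi w).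
    rewrite /mx_form -scalemxAr -scalemxAl mxE; congr (_ * _).
    have -> : v *m (G *m xi^T *m (xi *m G)) *m w^T =
      (v *m G *m xi^T) *m (xi *m G *m w^T) by rewrite !mulmxA.
    by rewrite mxE big_ord1.
  by rewrite (symG xi w) /k; field; exact: lt0r_neq0.
have : \tr (S *m invmx G) = k * c.
  rewrite SE -scalemxAl linearZ/= -mulmxA mulmxK// mxtrace_mulC mulmxA.
  by rewrite /mxtrace big_ord1.
rewrite symmetrized_trace// trA addr0 => /esym/eqP.
by rewrite mulf_eq0 (gt_eqF c0) orbF => /eqP k0; rewrite SE k0 scale0r.
Qed.

End LinearAlgebra.

Section KillingForm.
Context {R : realType} {n : nat} {M : smoothManifold R n}.
Context {g : riemannianMetric M} {D : connection M} (hD : levi_civita g D).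
Context {X : vfield M} (hX : smooth_vfield setT X).
Implicit Types (U : set M) (f : M -> R) (p q : M) (Y Z : vfield M) (v w : 'rV[R]_n).

Let A p : 'M[R]_n := lin1_mx (fun v => cov D v X p).

Definition killing_form p : 'M[R]_n := symmetrized (metric g p) (A p).

Lemma cov_mulmx p v : cov D v X p = v *m A p.
Proof.
have lin := cov_linear D openT (I : setT p) hX.
have c0 : cov D 0 X p = 0.
  have := lin 1 0 0; rewrite scaler0 addr0 scale1r => /eqP.
  by rewrite -subr_eq subrr => /eqP.
have sumE (r : seq 'I_n) : cov D (\sum_(k <- r) v 0 k *: delta_mx 0 k) X p =
    \sum_(k <- r) v 0 k *: cov D (delta_mx 0 k) X p.
  by elim: r => [|k r IH]; rewrite ?big_nil// !big_cons lin IH.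
rewrite {1}(row_sum_delta v) sumE; apply/rowP => j; rewrite summxE mxE.
by apply: eq_bigr => k _; rewrite !mxE.
Qed.

Lemma smooth_vfieldX U : smooth_vfield U X.
Proof. by apply: smooth_vfield_sub hX. Qed.

(** The Levi-Civita connection makes the Lie derivative of the metric visibly
    tensorial: (L_X g)(Y, Z) = g(D_Y X, Z) + g(Y, D_Z X). *)
Lemma lie_metric_killing_form U Y Z p : open U -> U p ->
  smooth_vfield U Y -> smooth_vfield U Z ->
  lie_metric g X Y Z p = mx_form (killing_form p) (Y p) (Z p).
Proof.
move=> oU Up sY sZ; have [tf mc] := hD; have sX := @smooth_vfieldX U.
rewrite /lie_metric (mc U X Y Z p oU Up sX sY sZ) /inner.
rewrite -(tf U X Y p oU Up sX sY) -(tf U X Z p oU Up sX sZ).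
rewrite symmetrized_form -!cov_mulmx !mx_formDl !mx_formDr !mx_formNl !mx_formNr.
by ring.
Qed.

Lemma killing_formP : killing g X <-> forall p, killing_form p = 0.
Proof.
split=> [kX p|k0 U Y Z oU sY sZ p Up]; last first.
  rewrite (lie_metric_killing_form oU Up sY sZ) k0.
  by rewrite /mx_form mulmx0 mul0mx mxE.
apply: mx_form_inj => v w; set c := chart_at p.
have cp : dom c p := dom_chart_at p.
have := kX _ _ _ (open_dom c) (smooth_chart_field c v) (smooth_chart_field c w) p cp.
rewrite (lie_metric_killing_form (open_dom c) cp (smooth_chart_field c v)
  (smooth_chart_field c w)) !chart_field_at => ->.
by rewrite /mx_form mulmx0 mul0mx mxE.
Qed.

Lemma killing_form_gradient U f p w : open U -> smooth U f -> U p ->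
  (forall q, U q -> vact X f q = 0) ->
  mx_form (killing_form p) (gradient g f p) w =
  - mx_form (metric g p) (bracket X (gradient g f) p) w.
Proof.
move=> oU sf Up Xf; set c := chart_at p.
have oU' := open_dom_setI c oU; have cp : dom c p := dom_chart_at p.
have U'p : (U `&` dom c) p by [].
have sf' : smooth (U `&` dom c) f := smooth_setIl sf.
have sW : smooth_vfield (U `&` dom c) (chart_field c w).
  exact (smooth_vfield_sub (@subIsetr _ U (dom c)) (smooth_chart_field c w)).
have Xf' q : (U `&` dom c) q -> vact X f q = 0 by move=> [Uq _]; exact: Xf.
have := lie_metric_gradient g oU' (@smooth_vfieldX _) sW sf' Xf' U'p.
rewrite (lie_metric_killing_form oU' U'p (smooth_gradient g oU' sf') sW).
by rewrite /inner chart_field_at.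
Qed.

(** Where the field does not vanish every covector annihilating it is the
    differential of a local first integral. *)
Lemma first_integral_with_differential p (alpha : 'rV[R]_n) : X p != 0 ->
  \sum_k X p 0 k * alpha 0 k = 0 ->
  exists U f, [/\ open U, U p, smooth U f, forall q, U q -> vact X f q = 0 &
    differential f p = alpha].
Proof.
move=> Xp0 aX; set c := chart_at p; have cp : dom c p := dom_chart_at p.
have [i0 Xi0] : exists i0, X p 0 i0 != 0.
  apply/existsP; apply: contraNT Xp0; rewrite negb_exists => /forallP H.
  by apply/eqP/rowP => k; rewrite mxE; apply/eqP; have := H k; rewrite negbK.
pose Xh k := vact X (coordf c k) \o param c.
have Xhp k : Xh k (coord c p) = X p 0 k.
  by rewrite /Xh/= coordK// vact_coordf.
pose N := coord c @` (dom c `&` dom c).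
have oN : open N by apply: open_coord_image; exact: open_dom.
have sXh k : smooth_on N (Xh k).
  have sv : smooth (dom c) (vact X (coordf c k)).
    exact (smooth_vact (open_dom c) (@smooth_vfieldX _) (smooth_coordf c k)).
  exact: (sv c).
pose O := [set x | N x /\ Xh i0 x != 0].
have oO : open O.
  rewrite openE => x [Nx Xx].
  have n1 : \forall y \near x, N y by exact: open_nbhs_nbhs.
  have n2 : \forall y \near x, Xh i0 y != 0.
    exact: (smooth_on_continuous (sXh i0) Nx (open_nbhs_nbhs (conj (@open_neq R 0) Xx))).
  by move: n1 n2; apply: filterS2.
have ON : O `<=` N by move=> x [].
have Op : O (coord c p) by split; [exact: coord_image_mem|rewrite Xhp].
pose V k x := (Xh i0 x)^-1 * Xh k x.
have sV k : smooth_on O (V k).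
  have sO l : smooth_on O (Xh l) := smooth_on_sub ON (sXh l).
  by apply: (smooth_onM oO (smooth_onV oO _ (sO i0)) (sO k)) => x [].
have V1 x : O x -> V i0 x = 1 by move=> [_ x0]; exact: mulVf.
have [W [F [[oW WO] Wp sF FX dF]]] := first_integrals oO sV Op V1.
pose U := [set q | dom c q /\ W (coord c q)].
have oU : open U := open_coord_preimage c oW.
have Uc : U `<=` dom c by move=> q [].
have UW x : (coord c @` (U `&` dom c)) x -> W x /\ coord c (param c x) = x.
  by move=> /coord_image[[_ Wx] _ xE]; rewrite xE in Wx.
have Up : U p by [].
have sfj j : smooth U (fun q => F j (coord c q)).
  apply: (smooth_in_chart oU Uc); have oV := open_coord_image c oU.
  have sFU : smooth_on (coord c @` (U `&` dom c)) (F j).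
    by apply: smooth_on_sub (sF j) => x /UW[].
  by apply: (smooth_on_eq oV _ sFU) => x /UW[_ xE] /=; rewrite xE.
have dfj j k q : U q -> dchart c k (fun q => F j (coord c q)) q = partial k (F j) (coord c q).
  move=> Uq; apply: near_eq_derive.
  have := open_nbhs_nbhs (conj (open_coord_image c oU) (coord_image_mem Uq (Uc _ Uq))).
  by apply: filterS => x /UW[_ xE] /=; rewrite xE.
have sf j := smoothM oU (smooth_cst (alpha 0 j) oU) (sfj j).
have df k q : U q -> dchart c k (fun q => \sum_j alpha 0 j * F j (coord c q)) q =
    \sum_j alpha 0 j * partial k (F j) (coord c q).
  move=> Uq; rewrite (dchart_sum _ k oU sf Uq (Uc _ Uq)).
  apply: eq_bigr => j _.
  rewrite (dchartM k (smooth_cst (alpha 0 j) oU) (sfj j) Uq (Uc _ Uq)).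
  by rewrite dchart_cst mulr0 addr0 dfj.
have sS : smooth U (fun q => \sum_j alpha 0 j * F j (coord c q)).
  exact (smooth_sum _ oU sf).
exists U, (fun q => \sum_j alpha 0 j * F j (coord c q)); split=> //.
  move=> q Uq; rewrite (vact_chart X oU sS Uq (Uc _ Uq)).
  have [cq Wq] := Uq; have [_ x0] := WO _ Wq.
  transitivity (Xh i0 (coord c q) * \sum_j alpha 0 j *
      \sum_k V k (coord c q) * partial k (F j) (coord c q)); last first.
    by rewrite big1 ?mulr0// => j _; rewrite FX// mulr0.
  under eq_bigr do rewrite df// mulr_sumr.
  rewrite exchange_big/= mulr_sumr; apply: eq_bigr => j _.
  rewrite !mulr_sumr; apply: eq_bigr => k _; rewrite /V.
  have XhE : Xh k (coord c q) = vact X (coordf c k) q by rewrite /Xh/= coordK.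
  rewrite -XhE; move: x0 (partial k (F j) (coord c q)).
  by move: (Xh i0 _) (Xh k _) => a b a0 d; field.
apply/rowP => k; rewrite mxE -/(dchart c k _ p) df//.
under eq_bigr do rewrite dF mulrBr.
rewrite sumrB (bigD1 k)//= eqxx mulr1 big1 ?addr0; last first.
  by move=> j jk; rewrite (negbTE jk) mulr0.
rewrite (eq_bigr (fun j => (k == i0)%:R / X p 0 i0 * (X p 0 j * alpha 0 j))).
  by rewrite -mulr_sumr aX mulr0 subr0.
by move=> j _; rewrite /V !Xhp; ring.
Qed.

Lemma killing_form_zero_nbhd U p v w : open U -> U p -> (forall q, U q -> X q = 0) ->
  mx_form (killing_form p) v w = 0.
Proof.
move=> oU Up X0; rewrite symmetrized_form.
have sX := @smooth_vfieldX U.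
(* Near p the field X equals X + X, so its covariant derivative doubles. *)
have cov0 u : cov D u X p = 0.
  have E q : U q -> X q = X q + X q by move=> Uq; rewrite X0// addr0.
  have := cov_local D oU Up sX E u; rewrite (cov_add D oU Up sX sX) => /eqP.
  by rewrite -subr_eq subrr => /eqP.
by rewrite -!cov_mulmx !cov0 -(scale0r 0) mx_formZl mx_formZr !mul0r addr0.
Qed.

Context (divX : forall p, divergence D X p = 0).
Context (gradX : forall U f, open U -> smooth U f ->
  (forall p, U p -> vact X f p = 0) ->
  forall p, U p -> bracket X (gradient g f) p = 0).

(** The tangent vectors orthogonal to X p are gradients of first integrals, so
    gradX makes the form vanish on them; what is left is detected by the trace,
    that is, by the divergence. *)
Lemma killing_form_nonzero_point p : X p != 0 -> killing_form p = 0.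
Proof.
move=> Xp0; have uG := metric_unit g p.
apply: (symmetrized_eq0 (metric_sym g p) (metric_posdef g p Xp0) uG (divX p)).
move=> v vX w; have aX : \sum_k X p 0 k * (v *m metric g p) 0 k = 0.
  rewrite -[RHS]vX /mx_form [RHS]mxE; apply: eq_bigr => k _.
  by rewrite mulrC; congr (_ * _); rewrite [RHS]mxE.
have [U [f [oU Up sf Xf df]]] := first_integral_with_differential Xp0 aX.
have gf : gradient g f p = v by rewrite /gradient df mulmxK.
have := killing_form_gradient w oU sf Up Xf.
rewrite gf (gradX oU sf Xf Up) => ->.
by rewrite -(scale0r 0) mx_formZl mul0r oppr0.
Qed.

(** The zeros of X are either interior, where X is locally trivial, or limits of
    points where X does not vanish; continuity covers the latter. *)
Lemma killing_form_everywhere p : killing_form p = 0.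
Proof.
apply: mx_form_inj => v w; rewrite [RHS]/mx_form mulmx0 mul0mx mxE.
set c := chart_at p; have cp : dom c p := dom_chart_at p.
pose Y := chart_field c v; pose Z := chart_field c w.
have od := open_dom c.
have sY : smooth_vfield (dom c) Y := smooth_chart_field c v.
have sZ : smooth_vfield (dom c) Z := smooth_chart_field c w.
pose h q := lie_metric g X Y Z q.
have hE q : dom c q -> h q = mx_form (killing_form q) (Y q) (Z q).
  by move=> cq; exact: (lie_metric_killing_form od cq sY sZ).
have sX := @smooth_vfieldX (dom c).
have sh : smooth (dom c) h.
  have s1 := smooth_vact od sX (metric_smooth g od sY sZ).
  have s2 := metric_smooth g od (smooth_bracket od sX sY) sZ.
  have s3 := metric_smooth g od sY (smooth_bracket od sX sZ).
  exact (smoothB od (smoothB od s1 s2) s3).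
have -> : mx_form (killing_form p) v w = h p by rewrite hE// /Y /Z !chart_field_at.
apply: contrapT => /eqP hp0.
pose N := [set x | (coord c @` (dom c `&` dom c)) x /\ h (param c x) != 0].
have oN : open N.
  have oI := open_coord_image c od.
  rewrite openE => x [Ix hx].
  have n1 : \forall y \near x, (coord c @` (dom c `&` dom c)) y.
    exact: open_nbhs_nbhs.
  have n2 : \forall y \near x, h (param c y) != 0.
    exact: (smooth_on_continuous (sh c) Ix (open_nbhs_nbhs (conj (@open_neq R 0) hx))).
  by move: n1 n2; apply: filterS2.
have oU := open_coord_preimage c oN.
have hp : h (param c (coord c p)) != 0 by rewrite coordK.
have Up : dom c p /\ N (coord c p) := conj cp (conj (coord_image_mem cp cp) hp).
move/eqP: hp0; apply; rewrite hE// /Y /Z !chart_field_at.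
apply: (killing_form_zero_nbhd v w oU Up) => q [cq [_ hq]].
apply/eqP; apply: contraNT hq => /killing_form_nonzero_point k0.
by rewrite coordK// hE// k0 /mx_form mulmx0 mul0mx mxE.
Qed.

End KillingForm.

Unset Implicit Arguments.

Theorem proposition1p1 (R : realType) (n : nat) (M : smoothManifold R n)
    (g : riemannianMetric M) (D : connection M) (hD : levi_civita g D)
    (X : vfield M) (hX : smooth_vfield setT X) :
  killing g X <->
  (forall p : M, divergence D X p = 0) /\
  (forall (U : set M) (f : M -> R), open U -> smooth U f ->
     (forall p : M, U p -> vact X f p = 0) ->
     forall p : M, U p -> bracket X (gradient g f) p = 0).
Proof.
split=> [kX|[divX gradX]]; last first.
  apply/(killing_formP hD hX) => p.
  exact: (killing_form_everywhere hD hX divX gradX).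
have k0 := (killing_formP hD hX).1 kX; split=> [p|U f oU sf Xf p Up].
  have := symmetrized_trace (lin1_mx (fun v => cov D v X p)) (metric_unit g p).
  rewrite [symmetrized _ _]k0 mul0mx linear0 => /esym/eqP.
  by rewrite -mulr2n mulrn_eq0/= => /eqP.
apply: (@metric_nondegenerate _ _ _ g p) => w.
have := killing_form_gradient hD hX w oU sf Up Xf.
by rewrite k0 {1}/mx_form mulmx0 mul0mx mxE => /esym/eqP; rewrite oppr_eq0 => /eqP.
Qed.
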